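(* Let $\xi(j)$ and $\eta(j)$, $j\in\mathbb Z$, be zero mean, mutually uncorrelated (wide sense) stationary stochastic sequences with spectral densities $f(\lambda)$ and $g(\lambda)$ that satisfy the minimality condition $$\int_{-\pi}^{\pi}\frac{1}{f(\lambda)+g(\lambda)}\,d\lambda<\infty,$$ and let the coefficients $a(j)$, $j=0,1,\dots$, satisfy $$\sum_{j=0}^\infty|a(j)|<\infty,\qquad \sum_{j=0}^\infty(j+1)|a(j)|^2<\infty .$$ Then the spectral characteristic $h(e^{i\lambda})$ and the mean square error $\Delta(h;f,g)$ of the optimal linear estimate $\hat A\xi$ of the functional $A\xi=\sum_{j=0}^\infty a(j)\xi(j)$ from observations of the sequence $\xi(j)+\eta(j)$ at points of time $j=-1,-2,\dots$ can be calculated by the formulas $$h(e^{i\lambda})=A(e^{i\lambda})\frac{f(\lambda)}{f(\lambda)+g(\lambda)}-\frac{\sum_{k=0}^\infty(\mathbf B^{-1}\mathbf R\mathbf a)_k e^{ik\lambda}}{f(\lambda)+g(\lambda)},$$ $$\begin{aligned}\Delta(h;f,g)=E|A\xi-\hat A\xi|^2&=\frac1{2\pi}\int_{-\pi}^{\pi}\frac{\left|A(e^{i\lambda})g(\lambda)+\sum_{k=0}^\infty(\mathbf B^{-1}\mathbf R\mathbf a)_k e^{ik\lambda}\right|^2}{(f(\lambda)+g(\lambda))^2}f(\lambda)\,d\lambda\\&\quad+\frac1{2\pi}\int_{-\pi}^{\pi}\frac{\left|A(e^{i\lambda})f(\lambda)-\sum_{k=0}^\infty(\mathbf B^{-1}\mathbf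 R\mathbf a)_k e^{ik\lambda}\right|^2}{(f(\lambda)+g(\lambda))^2}g(\lambda)\,d\lambda\\&=\langle\mathbf R\mathbf a,\mathbf B^{-1}\mathbf R\mathbf a\rangle+\langle\mathbf Q\mathbf a,\mathbf a\rangle.\end{aligned}$$ Here $A(e^{i\lambda})=\sum_{j=0}^\infty a(j)e^{ij\lambda}$, $\mathbf a=(a(0),a(1),\dots)$, and $\mathbf B,\mathbf R,\mathbf Q$ are the linear operators in $\ell_2$ determined by the matrices with elements ($j,k=0,1,\dots$) $$B_{j,k}=\frac1{2\pi}\int_{-\pi}^\pi \frac{e^{-i(j-k)\lambda}}{f(\lambda)+g(\lambda)}d\lambda,\quad R_{j,k}=\frac1{2\pi}\int_{-\pi}^\pi e^{-i(j-k)\lambda}\frac{f(\lambda)}{f(\lambda)+g(\lambda)}d\lambda,\quad Q_{j,k}=\frac1{2\pi}\int_{-\pi}^\pi e^{-i(j-k)\lambda}\frac{f(\lambda)g(\lambda)}{f(\lambda)+g(\lambda)}d\lambda .$$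
   Context: Spectral densities: $E\xi(j+k)\overline{\xi(j)}=\frac1{2\pi}\int_{-\pi}^\pi e^{ik\lambda}f(\lambda)d\lambda$ and $E\eta(j+k)\overline{\eta(j)}=\frac1{2\pi}\int_{-\pi}^\pi e^{ik\lambda}g(\lambda)d\lambda$. The sequences have spectral representations $\xi(j)=\int_{-\pi}^\pi e^{ij\lambda}Z_\xi(d\lambda)$, $\eta(j)=\int_{-\pi}^\pi e^{ij\lambda}Z_\eta(d\lambda)$ with orthogonal stochastic measures $Z_\xi$, $Z_\eta$. $L_2(f+g)$ is the space of complex-valued functions square integrable with respect to the measure with density $f+g$, and $L_2^0(f+g)$ is its subspace generated by $e^{ij\lambda}$, $j=-1,-2,\dots$. The optimal linear estimate is the mean square optimal one; it has the form $\hat A\xi=\int_{-\pi}^\pi h(e^{i\lambda})(Z_\xi(d\lambda)+Z_\eta(d\lambda))$, where $h\in L_2^0(f+g)$ is called its spectral characteristic. $\langle x,y\rangle=\sum_{k=0}^\infty x(k)\overline{y(k)}$ is the inner product in $\ell_2$, $\mathbf B^{-1}$ is the inverse of $\mathbf B$, and $(\cdot)_k$ denotes the $k$-th component of a vector.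
   Formalization: The formal theorem additionally assumes that Ra lies in the range of B, so that B^{-1}Ra exists in ℓ2 (B being the self-adjoint, possibly unbounded, operator of its quadratic form); this can fail under the stated hypotheses, e.g. g=0, f=|1-e^{iλ}|^{-0.8}, a(j)=(j+1)^{-1-ε}. *)

(* Defs.v *)
From HB Require Import structures.
From mathcomp Require Import all_boot all_order all_algebra.
From mathcomp Require Import complex.
From mathcomp Require Import all_classical all_reals all_analysis.
Set Implicit Arguments.
Unset Strict Implicit.
Unset Printing Implicit Defensive.
Import Order.TTheory GRing.Theory Num.Theory.
Import numFieldNormedType.Exports.

Local Open Scope classical_set_scope.
Local Open Scope ring_scope.

Definition abs2 {R : realType} (z : R[i]) : R :=
  complex.Re z ^+ 2 + complex.Im z ^+ 2.

Definition expi {R : realType} (t : R) : R[i] := (cos t +i* sin t)%C.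

(* Meant for convergent series only; [limn] returns a junk value otherwise. *)
Definition csum {R : realType} (u : nat -> R[i]) : R[i] :=
  (limn (series (fun k => complex.Re (u k))) +i*
   limn (series (fun k => complex.Im (u k))))%C.

Definition cmeasurable_fun {R : realType} {d} {T : measurableType d}
    (D : set T) (F : T -> R[i]) : Prop :=
  measurable_fun D (fun x => complex.Re (F x)) /\
  measurable_fun D (fun x => complex.Im (F x)).

(* Meant for integrable functions only ([Rintegral] is junk otherwise). *)
Definition cintegral {R : realType} {d} {T : measurableType d}
    (mu : {measure set T -> \bar R}) (D : set T) (F : T -> R[i]) : R[i] :=
  (Rintegral mu D (fun x => complex.Re (F x)) +i*
   Rintegral mu D (fun x => complex.Im (F x)))%C.

(* Functions of e^{i lambda} are written as functions of lambda in this set. *)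
Definition circ {R : realType} : set R := `[- pi, pi].

Section Weighted_L2.
Context {R : realType}.
Implicit Types (w : R -> R) (F : R -> R[i]).

Definition wnorm2 w F : \bar R :=
  (\int[lebesgue_measure]_(x in circ) (abs2 (F x) * w x)%:E)%E.

Definition in_L2 w F : Prop :=
  cmeasurable_fun circ F /\ (wnorm2 w F < +oo)%E.

Definition negtrig (n : nat) (u : nat -> R[i]) (x : R) : R[i] :=
  \sum_(k < n) u k * expi (- (k.+1)%:R * x).

(* The closed linear span in L_2(w) of e^{ij lambda}, j = -1, -2, ... *)
Definition in_L2_neg w F : Prop :=
  in_L2 w F /\
  forall e : R, 0 < e ->
    exists n u, (wnorm2 w (fun x => F x - negtrig n u x)%R < e%:E)%E.

(* F(lambda) = sum_{k >= 0} c(k) e^{ik lambda}, the series being understood in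
   the sense of mean-square convergence on [-pi, pi]. *)
Definition is_L2_sum (c : nat -> R[i]) F : Prop :=
  in_L2 (fun=> 1) F /\
  (wnorm2 (fun=> 1%R) (fun x => F x - \sum_(k < n) c k * expi (k%:R * x))%R
     @[n --> \oo] --> 0)%E.

Definition symA (a : nat -> R[i]) (x : R) : R[i] :=
  csum (fun j => a j * expi (j%:R * x)).

End Weighted_L2.

Section Random.
Context {R : realType} {d : measure_display} {T : measurableType d}.
Variable P : probability T R.
Implicit Types (X Y : T -> R[i]) (xi eta : int -> T -> R[i]).
Implicit Types (f g w : R -> R) (Z : set R -> T -> R[i]).

Definition cexpect X : R[i] := cintegral P setT X.

(* E|X|^2 *)
Definition msnorm X : \bar R := (\int[P]_t (abs2 (X t))%:E)%E.

Definition sq_integrable X : Prop :=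
  cmeasurable_fun setT X /\ (msnorm X < +oo)%E.

Definition covar X Y : R[i] := cexpect (fun t => X t * (Y t)^*%C).

Definition stationary xi : Prop :=
  [/\ forall j, sq_integrable (xi j),
      forall j, cexpect (xi j) = cexpect (xi 0)
    & forall j k, covar (xi (j + k)) (xi j) = covar (xi k) (xi 0)].

Definition zero_mean xi : Prop := forall j, cexpect (xi j) = 0.

Definition mutually_uncorrelated xi eta : Prop :=
  forall j k, covar (xi j) (eta k) = 0.

Definition spectral_density xi f : Prop :=
  [/\ forall x, x \in circ -> 0 <= f x,
      lebesgue_measure.-integrable circ (EFin \o f)
    & forall j k : int, covar (xi (j + k)) (xi j) =
        ((2 * pi)^-1)%:C%C *
        cintegral lebesgue_measure circ (fun x => expi (k%:~R * x) * (f x)%:C%C)].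

Definition borel_arc (A : set R) : Prop := measurable A /\ A `<=` circ.

(* An orthogonal stochastic measure on [-pi, pi] whose structure measure has
   density f / (2 pi). *)
Definition orth_measure Z f : Prop :=
  [/\ forall A, borel_arc A -> sq_integrable (Z A),
      forall A B, borel_arc A -> borel_arc B -> A `&` B = set0 ->
        {ae P, forall t, Z (A `|` B) t = Z A t + Z B t}
    & forall A B, borel_arc A -> borel_arc B ->
        covar (Z A) (Z B) =
        ((2 * pi)^-1 * Rintegral lebesgue_measure (A `&` B) f)%:C%C].

Definition simple_fct (n : nat) (u : nat -> R[i]) (A : nat -> set R) (x : R)
  : R[i] := \sum_(k < n) u k * (\1_(A k) x)%:C%C.

Definition simple_int Z (n : nat) (u : nat -> R[i]) (A : nat -> set R) (t : T)
  : R[i] := \sum_(k < n) u k * Z (A k) t.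

(* [stoch_int Z w F X] : X is (a version of) the stochastic integral of
   F in L_2(w) with respect to the orthogonal measure Z with density w,
   i.e. the mean-square limit of integrals of simple functions which
   converge to F in L_2(w). *)
Definition stoch_int Z w (F : R -> R[i]) X : Prop :=
  [/\ in_L2 w F, sq_integrable X
    & forall e : R, 0 < e ->
        exists n u (A : nat -> set R),
          [/\ forall k, borel_arc (A k),
              (wnorm2 w (fun x => F x - simple_fct n u A x)%R < e%:E)%E
            & (msnorm (fun t => X t - simple_int Z n u A t)%R < e%:E)%E]].

Definition spectral_representation xi Z f : Prop :=
  orth_measure Z f /\
  forall j : int, stoch_int Z f (fun x => expi (j%:~R * x)) (xi j).

(* X = sum_{j >= 0} a(j) xi(j) in mean square. *)
Definition is_functional (a : nat -> R[i]) xi X : Prop :=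
  sq_integrable X /\
  (msnorm (fun t => X t - \sum_(j < n) a j * xi j%:Z t)%R @[n --> \oo] --> 0)%E.

(* The closed linear span in L_2(P) of zeta(j), j = -1, -2, ... *)
Definition linear_estimate (zeta : int -> T -> R[i]) Y : Prop :=
  sq_integrable Y /\
  forall e : R, 0 < e ->
    exists n (u : nat -> R[i]),
      (msnorm (fun t => Y t - \sum_(k < n) u k * zeta (- (k.+1)%:Z) t)%R
         < e%:E)%E.

Definition optimal_estimate (zeta : int -> T -> R[i]) X Y : Prop :=
  linear_estimate zeta Y /\
  forall Y', linear_estimate zeta Y' ->
    (msnorm (fun t => X t - Y t)%R <= msnorm (fun t => X t - Y' t)%R)%E.

Definition spectral_characteristic Z w (h : R -> R[i]) Y : Prop :=
  in_L2_neg w h /\ stoch_int Z w h Y.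

End Random.

Section Operators.
Context {R : realType}.
Implicit Types (M : nat -> nat -> R[i]) (x y : nat -> R[i]) (u : {poly R[i]}).

Definition in_ell2 x : Prop := (\sum_(0 <= k <oo) (abs2 (x k))%:E < +oo)%E.

Definition ell2_inner x y : R[i] := csum (fun k => x k * (y k)^*%C).

(* The rows of M applied to x. For M = R, Q below the entries are bounded and
   the theorem applies this to an absolutely summable x, so that the series
   converge absolutely (Q x may fail to be in ell_2). *)
Definition mat_apply M x (j : nat) : R[i] := csum (fun k => M j k * x k).

(* Finitely supported sequences are encoded by polynomials: u`_k is the k-th
   entry of u. *)
Definition mat_form M u : R[i] :=
  \sum_(j < size u) \sum_(k < size u) M j k * u`_k * (u`_j)^*%C.

(* [mat_op M x y] : x is in the domain of the operator of ell_2 determined by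
   the positive semidefinite Hermitian matrix M, and its value there is y.
   The operator may be unbounded (as may B below, 1/(f+g) being only
   integrable), so that the row series and the matrix columns need not make
   sense in ell_2; it is, as usual, the self-adjoint operator associated with
   the closure of the quadratic form of M on finitely supported sequences:
   x is the ell_2-limit of finitely supported U_m that are Cauchy for the form,
   and y = lim M U_m entrywise. If M is bounded then this is x |-> M x on all
   of ell_2. *)
Definition mat_op M x y : Prop :=
  [/\ in_ell2 x, in_ell2 y &
  exists U : nat -> {poly R[i]},
    [/\ (\sum_(0 <= k <oo) (abs2 (x k - (U m)`_k)%R)%:E @[m --> \oo] --> 0)%E,
        forall e : R, 0 < e -> exists m0, forall m m',
          (m0 <= m)%N -> (m0 <= m')%N -> abs2 (mat_form M (U m - U m')) < e
      & forall (j : nat) (e : R), 0 < e -> exists m0, forall m, (m0 <= m)%N ->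
          abs2 (\sum_(k < size (U m)) M j k * (U m)`_k - y j) < e]].

(* The value at y of the inverse operator; meant for y in the range. *)
Definition mat_inv M y : nat -> R[i] := xget (fun=> 0) [set x | mat_op M x y].

(* The matrix (1 / 2 pi) int e^{-i(j-k) lambda} phi(lambda) d lambda. *)
Definition toeplitz (phi : R -> R) (j k : nat) : R[i] :=
  ((2 * pi)^-1)%:C%C *
  cintegral lebesgue_measure circ
    (fun s : R => expi (- (j%:R - k%:R) * s) * (phi s)%:C%C).

Definition matB (f g : R -> R) := toeplitz (fun s : R => (f s + g s)^-1).
Definition matR (f g : R -> R) := toeplitz (fun s : R => f s / (f s + g s)).
Definition matQ (f g : R -> R) := toeplitz (fun s : R => f s * g s / (f s + g s)).

End Operators.

(* Main.v *)
(* With [w = f + g], covariances identify the closed span of the past of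
   [xi + eta] with the closed span of [e^{ij lambda}], [j < 0], in [L_2(w)], so
   that [Ahat] corresponds to a function [h0] there. Orthogonality of the error
   to the past says that [A f - h0 w] has no Fourier coefficients of negative
   index, while [h0] has none of nonnegative index. The function
   [h = A f / w - C / w] has both properties too: [C] is a power series, and
   [B c = R a] says that [C / w] and [A f / w] have the same Fourier
   coefficients of nonnegative index. Hence [psi = h - h0] has only negative
   frequencies and [psi w] only nonnegative ones. So [|psi|^2 w] is the product
   of [conj psi], of positive frequencies, and [psi w]; both factors and the
   product are merely integrable, and a theorem of Smirnov type (make the
   factors square integrable by dividing them by [1 + eps H], [H] analytic with
   [Re H = sqrt |psi| + sqrt |psi w|]) gives [int |psi|^2 w = 0], whence
   [h = h0]. The error formulas follow by passing to the limit in the error of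
   finite linear estimates. *)

Require Import Defs.
From mathcomp Require Import all_boot all_order all_algebra.
From mathcomp Require Import complex.
From mathcomp Require Import all_classical all_reals all_analysis.
From mathcomp Require Import measurable_realfun ring lra.
Import Order.TTheory GRing.Theory Num.Theory.
Import numFieldNormedType.Exports.
Local Open Scope classical_set_scope.
Local Open Scope ring_scope.
Set Implicit Arguments.
Unset Strict Implicit.
Unset Printing Implicit Defensive.

(** Minimality gives no boundedness: [1/(f+g)] is merely integrable, so [B] may be unbounded and the
    partial sums of the series of [C] need not converge in [L_2(1/(f+g))]. Hence [C] is reached
    through the finitely supported approximants of [mat_op]: they converge to [C] in the unweighted
    [L_2], a subsequence converges almost everywhere, and Fatou's lemma carries the limit over to
    the weighted norm. No Hardy space is used. Analytic functions appear as limits of polynomials in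
    [e^{i lambda}], and a one-sided spectrum as the vanishing of integrals against such polynomials.
    Division by [1 + eps H] requires polynomial approximants of [H] with nonnegative real part,
    which mere density would not give; the positivity of the Fejer kernel provides them, and each
    [1 + eps P] is then inverted by a Neumann series. All norms are squared, so every triangle
    inequality costs factors 2. Sequences are therefore extracted at the rate [8^-m], which leaves
    room for these losses and still gives the pointwise rate [4^-m] that makes differences
    summable. *)

Notation Re := complex.Re.
Notation Im := complex.Im.

(** * Complex-valued functions *)

Section Complex_algebra.
Context {R : realType}.
Implicit Types (z u : R[i]) (r : R).

Lemma cReD z u : Re (z + u) = Re z + Re u. Proof. by case: z; case: u. Qed.
Lemma cImD z u : Im (z + u) = Im z + Im u. Proof. by case: z; case: u. Qed.
Lemma cReN z : Re (- z) = - Re z. Proof. by case: z. Qed.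
Lemma cImN z : Im (- z) = - Im z. Proof. by case: z. Qed.
Lemma cReM z u : Re (z * u) = Re z * Re u - Im z * Im u.
Proof. by case: z; case: u. Qed.
Lemma cImM z u : Im (z * u) = Re z * Im u + Im z * Re u.
Proof. by case: z; case: u. Qed.
Lemma Re_conj z : Re z^*%C = Re z. Proof. by case: z. Qed.
Lemma Im_conj z : Im z^*%C = - Im z. Proof. by case: z. Qed.
Definition ReImE := (cReD, cImD, cReN, cImN, cReM, cImM, Re_conj, Im_conj).

Lemma Re_sum I (s : seq I) (P : pred I) (F : I -> R[i]) :
  Re (\sum_(i <- s | P i) F i) = \sum_(i <- s | P i) Re (F i).
Proof. by apply: (big_morph _ cReD). Qed.
Lemma Im_sum I (s : seq I) (P : pred I) (F : I -> R[i]) :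
  Im (\sum_(i <- s | P i) F i) = \sum_(i <- s | P i) Im (F i).
Proof. by apply: (big_morph _ cImD). Qed.

Lemma complex_ext z u : Re z = Re u -> Im z = Im u -> z = u.
Proof. by case: z => a b; case: u => c d /= -> ->. Qed.

Lemma abs2_ge0 z : 0 <= abs2 z.
Proof. by rewrite /abs2 addr_ge0 ?sqr_ge0. Qed.
Lemma abs2_eq0 z : abs2 z = 0 -> z = 0.
Proof.
rewrite /abs2; move/eqP; rewrite paddr_eq0 ?sqr_ge0// !sqrf_eq0.
by move=> /andP[/eqP a /eqP b]; apply: complex_ext.
Qed.
Lemma abs20 : abs2 (0 : R[i]) = 0.
Proof. by rewrite /abs2 /= expr0n /= addr0. Qed.
Lemma abs2M z u : abs2 (z * u) = abs2 z * abs2 u.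
Proof. by rewrite /abs2 !ReImE; ring. Qed.
Lemma abs2N z : abs2 (- z) = abs2 z.
Proof. by rewrite /abs2 !ReImE; ring. Qed.
Lemma abs2BC z u : abs2 (z - u) = abs2 (u - z).
Proof. by rewrite -abs2N opprB. Qed.
Lemma abs2_conj z : abs2 z^*%C = abs2 z.
Proof. by rewrite /abs2 !ReImE; ring. Qed.
Lemma abs2_real r : abs2 (r%:C%C : R[i]) = r ^+ 2.
Proof. by rewrite /abs2 /=; ring. Qed.
Lemma abs2D_le z u : abs2 (z + u) <= 2 * abs2 z + 2 * abs2 u.
Proof.
rewrite /abs2 !ReImE -subr_ge0.
by have := sqr_ge0 (Re z - Re u); have := sqr_ge0 (Im z - Im u); nra.
Qed.
Lemma mulJ z : z * z^*%C = (abs2 z)%:C%C.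
Proof. by apply: complex_ext; rewrite !ReImE /abs2 /=; ring. Qed.
Lemma conjM z u : (z * u)^*%C = z^*%C * u^*%C.
Proof. by apply: complex_ext; rewrite !ReImE; ring. Qed.
Lemma conjD z u : (z + u)^*%C = z^*%C + u^*%C.
Proof. by apply: complex_ext; rewrite !ReImE; ring. Qed.
Lemma conj_real r : (r%:C%C : R[i])^*%C = r%:C%C.
Proof. by apply: complex_ext; rewrite !ReImE //= oppr0. Qed.
Lemma conj_sum I (s : seq I) (P : pred I) (F : I -> R[i]) :
  (\sum_(i <- s | P i) F i)^*%C = \sum_(i <- s | P i) (F i)^*%C.
Proof.
by apply: complex_ext; rewrite !(Re_sum, Im_sum) ?ReImE ?Re_sum ?Im_sum -?sumrN;
   apply: eq_bigr => i _; rewrite ReImE.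
Qed.
Lemma abs2V z : abs2 z^-1 = (abs2 z)^-1.
Proof.
have [->|z0] := eqVneq z 0; first by rewrite invr0 abs20 invr0.
have zn : abs2 z != 0 by apply: contra_neq z0; exact: abs2_eq0.
by apply: (mulfI zn); rewrite divff// -abs2M divff// abs2_real expr1n.
Qed.

Lemma sqr_Re_le z : Re z ^+ 2 <= abs2 z.
Proof. by rewrite /abs2 lerDl sqr_ge0. Qed.
Lemma sqr_Im_le z : Im z ^+ 2 <= abs2 z.
Proof. by rewrite /abs2 lerDr sqr_ge0. Qed.

Lemma sqr_norm_le r s : 0 <= s -> r ^+ 2 <= s ^+ 2 -> `|r| <= s.
Proof. by move=> s0 h; rewrite -(ger0_norm s0) -!sqrtr_sqr ler_sqrt ?sqr_ge0. Qed.

Lemma normRe_le z r : 0 <= r -> abs2 z <= r ^+ 2 -> `|Re z| <= r.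
Proof. by move=> r0 h; apply: sqr_norm_le => //; exact: le_trans (sqr_Re_le z) h. Qed.
Lemma normIm_le z r : 0 <= r -> abs2 z <= r ^+ 2 -> `|Im z| <= r.
Proof. by move=> r0 h; apply: sqr_norm_le => //; exact: le_trans (sqr_Im_le z) h. Qed.

(** Componentwise, to match [csum] and [cintegral], which are built from real and imaginary
    parts. *)
Definition ccvg (v : nat -> R[i]) z : Prop :=
  (Re (v n) @[n --> \oo] --> Re z) /\ (Im (v n) @[n --> \oo] --> Im z).

Lemma ccvg_unique v z u : ccvg v z -> ccvg v u -> z = u.
Proof.
move=> [a b] [c d]; apply: complex_ext; [exact: (cvg_unique _ a c)|exact: (cvg_unique _ b d)].
Qed.

Lemma ccvg_abs2 v z : abs2 (v n - z) @[n --> \oo] --> (0 : R) -> ccvg v z.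
Proof.
move=> h.
have aux (p : nat -> R) (r : R) : (forall n, (p n - r) ^+ 2 <= abs2 (v n - z)) ->
   p n @[n --> \oo] --> r.
  move=> hp; apply/subr_cvg0/norm_cvg0P.
  have h2 : Num.sqrt (abs2 (v n - z)) @[n --> \oo] --> (0 : R).
    by rewrite -(@sqrtr0 R); apply: (cvg_comp _ _ h); exact: sqrt_continuous.
  apply: squeeze_cvgr h2; last exact: cvg_cst.
  by near=> n; rewrite normr_ge0/= -sqrtr_sqr ler_sqrt ?abs2_ge0.
split; apply: aux => n; first by rewrite -cReN -cReD sqr_Re_le.
by rewrite -cImN -cImD sqr_Im_le.
Unshelve. all: by end_near. Qed.

Lemma ccvg_abs2P v z : ccvg v z -> abs2 (v n - z) @[n --> \oo] --> (0 : R).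
Proof.
move=> [a b]; rewrite /abs2.
under eq_fun do rewrite !ReImE.
have -> : (0 : R) = (Re z - Re z) ^+ 2 + (Im z - Im z) ^+ 2 by rewrite !subrr expr0n addr0.
by apply: cvgD; rewrite expr2; under eq_fun do rewrite expr2;
  apply: cvgM; apply: cvgB => //; exact: cvg_cst.
Qed.

Lemma ccvgM v v' z z' : ccvg v z -> ccvg v' z' -> ccvg (fun n => v n * v' n) (z * z').
Proof.
by move=> [a b] [c d]; split => /=; under eq_fun do rewrite ReImE;
  rewrite ReImE; [apply: cvgB|apply: cvgD]; apply: cvgM.
Qed.
Lemma ccvgD v v' z z' : ccvg v z -> ccvg v' z' -> ccvg (fun n => v n + v' n) (z + z').
Proof.
by move=> [a b] [c d]; split => /=; under eq_fun do rewrite ReImE;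
  rewrite ReImE; apply: cvgD.
Qed.
Lemma ccvg_cst z : ccvg (fun=> z) z. Proof. by split; exact: cvg_cst. Qed.
Lemma ccvgN v z : ccvg v z -> ccvg (fun n => - v n) (- z).
Proof.
by move=> [a b]; split => /=; under eq_fun do rewrite ReImE;
  rewrite ReImE; apply: cvgN.
Qed.
Lemma ccvg_conj v z : ccvg v z -> ccvg (fun n => (v n)^*%C) z^*%C.
Proof.
move=> [a b]; split => /=; under eq_fun do rewrite ReImE; rewrite ReImE//.
exact: cvgN.
Qed.
Lemma csumE (v : nat -> R[i]) z : ccvg (fun n => \sum_(k < n) v k) z -> csum v = z.
Proof.
move=> [a b]; rewrite /csum; apply: complex_ext => /=; apply/cvg_lim => //.
- by rewrite (_ : series _ = fun n => Re (\sum_(k < n) v k))//; apply/funext => n;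
  rewrite /series /= big_mkord Re_sum.
- by rewrite (_ : series _ = fun n => Im (\sum_(k < n) v k))//; apply/funext => n;
  rewrite /series /= big_mkord Im_sum.
Qed.

(** For [c > 0] the minimum of the quadratic, at [- b / c], is [a - b^2 / c]. The degenerate cases
    are included because the forms to which this is applied may vanish; with [a = 0] the conclusion
    forces [b = 0], as [optimal_orth] needs. *)
Lemma discriminant_le (a b c : R) :
  (forall t, 0 <= a + 2 * b * t + c * t ^+ 2) -> b ^+ 2 <= a * c.
Proof.
move=> h.
have c0 : 0 <= c.
  rewrite leNgt; apply/negP => c0.
  (* If [c < 0], adding the values at [1 + t] and [- (1 + t)] cancels the linear term, and this [t]
     is large enough to make [a + c (1 + t)^2] negative. *)
  pose t := (1 + `|a| + `|b| * 2) / - c.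
  have cn : - c > 0 by rewrite oppr_gt0.
  have a1 : a <= `|a| by exact: ler_norm.
  have := h (1 + t).
  have := h (- (1 + t)).
  have ct : c * t = - (1 + `|a| + `|b| * 2).
    by rewrite /t; field; rewrite lt_eqF.
  have t0 : 0 <= t by rewrite divr_ge0 ?ltW// !addr_ge0 ?mulr_ge0.
  have hb : 0 <= `|b| by []. have ha : 0 <= `|a| by [].
  have -> : c * (1 + t) ^+ 2 = c + 2 * (c * t) + (c * t) * t by ring.
  have -> : c * (- (1 + t)) ^+ 2 = c + 2 * (c * t) + (c * t) * t by ring.
  rewrite ct; nra.
have [c00|cn] := eqVneq c 0.
  have [->|b0] := eqVneq b 0; first by rewrite expr0n /= c00 mulr0.
  (* Here the quadratic is affine and takes the value [-1]. *)
  have := h (- (a + 1) / (2 * b)).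
  rewrite c00 mul0r addr0.
  have -> : 2 * b * (- (a + 1) / (2 * b)) = - (a + 1).
    by field.
  lra.
have cp : 0 < c by rewrite lt_def cn c0.
have := h (- b / c).
have -> : a + 2 * b * (- b / c) + c * (- b / c) ^+ 2 = a - b ^+ 2 / c by field.
by rewrite subr_ge0 ler_pdivrMr.
Qed.

End Complex_algebra.

(** * Integrals of complex-valued functions *)

Section Complex_integral.
Context {R : realType} {d : measure_display} {T : measurableType d}.
Variables (mu : {measure set T -> \bar R}) (D : set T).
Hypothesis mD : measurable D.
Implicit Types (F G : T -> R[i]) (p q : T -> R).

Lemma rintegrable_dom p q : measurable_fun D p ->
  (forall x, D x -> `|p x| <= q x) -> mu.-integrable D (EFin \o q) ->
  mu.-integrable D (EFin \o p).
Proof.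
move=> mp h; apply: le_integrable => //; first exact/measurable_EFinP.
by move=> x Dx /=; rewrite lee_fin; apply: le_trans (h _ Dx) (ler_norm _).
Qed.

Lemma rintegrableZ (k : R) p : mu.-integrable D (EFin \o p) ->
  mu.-integrable D (EFin \o (fun x => k * p x)).
Proof. by move=> h; apply: (@integrableZl _ _ _ mu D mD k _ h). Qed.

Lemma rintegrableD p q : mu.-integrable D (EFin \o p) ->
  mu.-integrable D (EFin \o q) -> mu.-integrable D (EFin \o (fun x => p x + q x)).
Proof. by move=> h1 h2; apply: (integrableD mD h1 h2). Qed.

Lemma rintegrableB p q : mu.-integrable D (EFin \o p) ->
  mu.-integrable D (EFin \o q) -> mu.-integrable D (EFin \o (fun x => p x - q x)).
Proof. by move=> h1 h2; apply: (integrableB mD h1 h2). Qed.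

Lemma rintegrableN p : mu.-integrable D (EFin \o p) ->
  mu.-integrable D (EFin \o (fun x => - p x)).
Proof. by move=> h1; apply: (integrableN h1). Qed.

Lemma rintegrable_meas p : mu.-integrable D (EFin \o p) -> measurable_fun D p.
Proof. by move=> /measurable_int/measurable_EFinP. Qed.

Lemma rintegrable_ext p q : (forall x, D x -> p x = q x) ->
  mu.-integrable D (EFin \o p) -> mu.-integrable D (EFin \o q).
Proof.
move=> pq; apply: eq_integrable => // x; rewrite inE => Dx /=.
by rewrite pq.
Qed.

Definition cintegrable F : Prop :=
  mu.-integrable D (EFin \o (fun x => Re (F x))) /\
  mu.-integrable D (EFin \o (fun x => Im (F x))).

Lemma cintegrable_meas F : cintegrable F -> cmeasurable_fun D F.
Proof. by move=> [/rintegrable_meas a /rintegrable_meas b]; split. Qed.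

Lemma cmeasurableD F G : cmeasurable_fun D F -> cmeasurable_fun D G ->
  cmeasurable_fun D (fun x => F x + G x).
Proof.
by move=> [a b] [e f]; split; under eq_fun do rewrite ReImE; exact: measurable_funD.
Qed.
Lemma cmeasurableM F G : cmeasurable_fun D F -> cmeasurable_fun D G ->
  cmeasurable_fun D (fun x => F x * G x).
Proof.
move=> [a b] [e f]; split; under eq_fun do rewrite ReImE.
  by apply: measurable_funB; exact: measurable_funM.
by apply: measurable_funD; exact: measurable_funM.
Qed.
Lemma cmeasurable_conj F : cmeasurable_fun D F ->
  cmeasurable_fun D (fun x => (F x)^*%C).
Proof.
move=> [a b]; split; under eq_fun do rewrite ReImE; first exact: a.
exact: measurable_funN.
Qed.
Lemma cmeasurable_cst (c : R[i]) : cmeasurable_fun D (fun=> c).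
Proof. by split; exact: measurable_cst. Qed.
Lemma cmeasurable_real p : measurable_fun D p -> cmeasurable_fun D (fun x => (p x)%:C%C).
Proof. by split. Qed.
Lemma cmeasurableN F : cmeasurable_fun D F -> cmeasurable_fun D (fun x => - F x).
Proof.
by move=> [a b]; split; under eq_fun do rewrite ReImE; exact: measurable_funN.
Qed.
Lemma cmeasurableB F G : cmeasurable_fun D F -> cmeasurable_fun D G ->
  cmeasurable_fun D (fun x => F x - G x).
Proof. by move=> a b; apply: cmeasurableD => //; exact: cmeasurableN. Qed.
Lemma cmeasurable_sum n (F : nat -> T -> R[i]) :
  (forall k, cmeasurable_fun D (F k)) ->
  cmeasurable_fun D (fun x => \sum_(k < n) F k x).
Proof.
move=> h; elim: n => [|n IH].
  by under eq_fun do rewrite big_ord0; exact: cmeasurable_cst.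
by under eq_fun do rewrite big_ord_recr; exact: cmeasurableD.
Qed.
Lemma cmeasurable_abs2 F : cmeasurable_fun D F -> measurable_fun D (fun x => abs2 (F x)).
Proof. by move=> [a b]; apply: measurable_funD; exact: measurable_funX. Qed.
Lemma measurable_funV p : measurable_fun D p -> measurable_fun D (fun x => (p x)^-1).
Proof.
move=> mp; apply: (measurableT_comp _ mp) => /=.
(* Inversion is discontinuous at [0] only; that point is split off, and the inverse there is [0]. *)
have -> : [set: R] = [set 0] `|` ~` [set 0] by rewrite setUv.
apply/measurable_funU => //; first exact: measurableC.
split.
  apply: (@eq_measurable_fun _ _ _ _ _ (fun=> 0 : R)); last exact: measurable_cst.
  by move=> x; rewrite inE /= => ->; rewrite invr0.
have oA : open (~` [set (0 : R)]).
  by rewrite (_ : ~` _ = [set x | x != 0]); [exact: open_neq|apply/seteqP; split=> x /= /eqP].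
apply: open_continuous_measurable_fun => // x; rewrite inE /= => /eqP x0.
exact: inv_continuous.
Qed.

Lemma cintegrable_dom F q : cmeasurable_fun D F ->
  (forall x, D x -> `|Re (F x)| <= q x /\ `|Im (F x)| <= q x) ->
  mu.-integrable D (EFin \o q) -> cintegrable F.
Proof.
move=> [a b] h iq; split; apply: rintegrable_dom iq => // x Dx.
  by have [] := h _ Dx.
by have [] := h _ Dx.
Qed.

Lemma cintegrableD F G : cintegrable F -> cintegrable G ->
  cintegrable (fun x => F x + G x).
Proof.
move=> [a b] [e f]; split.
  by under [X in EFin \o X]eq_fun do rewrite ReImE; exact: rintegrableD.
by under [X in EFin \o X]eq_fun do rewrite ReImE; exact: rintegrableD.
Qed.

Lemma cintegrableZ (c : R[i]) F : cintegrable F -> cintegrable (fun x => c * F x).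
Proof.
move=> [a b]; split; under [X in EFin \o X]eq_fun do rewrite ReImE.
  by apply: rintegrableB; exact: rintegrableZ.
by apply: rintegrableD; exact: rintegrableZ.
Qed.

Lemma cintegrable_conj F : cintegrable F -> cintegrable (fun x => (F x)^*%C).
Proof.
move=> [a b]; split; under [X in EFin \o X]eq_fun do rewrite ReImE; first exact: a.
exact: rintegrableN.
Qed.

Lemma cintegrable_ext F G : (forall x, D x -> F x = G x) ->
  cintegrable F -> cintegrable G.
Proof. by move=> h [a b]; split; [move: a|move: b]; apply: rintegrable_ext => x /h ->. Qed.

Lemma cintegral_ext F G : (forall x, D x -> F x = G x) ->
  cintegral mu D F = cintegral mu D G.
Proof.
by move=> h; rewrite /cintegral; congr (_ +i* _)%C; apply: eq_Rintegral => x;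
  rewrite inE => /h ->.
Qed.

Lemma cintegralD F G : cintegrable F -> cintegrable G ->
  cintegral mu D (fun x => F x + G x) = cintegral mu D F + cintegral mu D G.
Proof.
move=> [a b] [e f]; apply: complex_ext; rewrite ReImE /=.
  by under eq_Rintegral do rewrite ReImE; rewrite RintegralD.
by under eq_Rintegral do rewrite ReImE; rewrite RintegralD.
Qed.

Lemma cintegralZ (c : R[i]) F : cintegrable F ->
  cintegral mu D (fun x => c * F x) = c * cintegral mu D F.
Proof.
move=> [a b]; apply: complex_ext; rewrite ReImE /=.
  under eq_Rintegral do rewrite ReImE.
  by rewrite RintegralB ?RintegralZl//; exact: rintegrableZ.
under eq_Rintegral do rewrite ReImE.
by rewrite RintegralD ?RintegralZl//; exact: rintegrableZ.
Qed.

Lemma cintegral_conj F : cintegrable F ->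
  cintegral mu D (fun x => (F x)^*%C) = (cintegral mu D F)^*%C.
Proof.
move=> [a b]; apply: complex_ext; rewrite ReImE /=.
  by under eq_Rintegral do rewrite ReImE.
under eq_Rintegral do rewrite ReImE -mulN1r.
by rewrite RintegralZl// mulN1r.
Qed.

Lemma cintegral_sum n (F : nat -> T -> R[i]) : (forall k, cintegrable (F k)) ->
  cintegrable (fun x => \sum_(k < n) F k x) /\
  cintegral mu D (fun x => \sum_(k < n) F k x) = \sum_(k < n) cintegral mu D (F k).
Proof.
move=> h; elim: n => [|n [IH1 IH2]].
  under [in X in X /\ _]eq_fun do rewrite big_ord0.
  under [X in cintegral _ _ X]eq_fun do rewrite big_ord0.
  split.
    by split; exact: integrable0.
  rewrite big_ord0; apply: complex_ext => /=; rewrite -[RHS]/0 -[RHS](mul0r (fine (mu D)));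
  by rewrite Rintegral_cst.
under [in X in X /\ _]eq_fun do rewrite big_ord_recr.
under [X in cintegral _ _ X]eq_fun do rewrite big_ord_recr.
by split; [exact: cintegrableD|rewrite cintegralD// IH2 big_ord_recr].
Qed.

End Complex_integral.

(** * The spaces L_2(w) *)

Section L2_space.
Context {R : realType} {d : measure_display} {T : measurableType d}.
Variables (mu : {measure set T -> \bar R}) (D : set T).
Hypothesis mD : measurable D.
Implicit Types (F G H : T -> R[i]) (w v : T -> R) (c : R[i]).

Definition weight w : Prop := measurable_fun D w /\ forall x, D x -> 0 <= w x.

Definition L2 w F : Prop :=
  cmeasurable_fun D F /\ mu.-integrable D (EFin \o (fun x => abs2 (F x) * w x)).

(** A real number, unlike [wnorm2] and [msnorm], and kept squared: the triangle inequality takes the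
    form [n2_triangle], with factors 2 and no square roots. *)
Definition n2 w F : R := Rintegral mu D (fun x => abs2 (F x) * w x).

Definition cip w F G : R[i] :=
  cintegral mu D (fun x => F x * (G x)^*%C * (w x)%:C%C).

Lemma n2_ge0 w F : weight w -> 0 <= n2 w F.
Proof. by move=> [_ w0]; apply: Rintegral_ge0 => x Dx; rewrite mulr_ge0 ?abs2_ge0 ?w0. Qed.

Lemma n2E w F : L2 w F -> (\int[mu]_(x in D) (abs2 (F x) * w x)%:E = (n2 w F)%:E)%E.
Proof.
by move=> [_ iF]; rewrite /n2 /Rintegral fineK//; exact: integrable_fin_num iF.
Qed.

Lemma L2P w F : weight w -> cmeasurable_fun D F ->
  (\int[mu]_(x in D) (abs2 (F x) * w x)%:E < +oo)%E -> L2 w F.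
Proof.
move=> [mw w0] mF lF; split=> //; apply/integrableP; split.
  by apply/measurable_EFinP/measurable_funM => //; exact: cmeasurable_abs2.
rewrite (_ : integral _ _ _ = \int[mu]_(x in D) (abs2 (F x) * w x)%:E)%E//.
apply: eq_integral => x; rewrite inE => Dx.
by rewrite /= ger0_norm// mulr_ge0 ?abs2_ge0 ?w0.
Qed.

Lemma L2_lty w F : L2 w F -> (\int[mu]_(x in D) (abs2 (F x) * w x)%:E < +oo)%E.
Proof. by move=> /n2E ->; rewrite ltry. Qed.

Lemma L2_dom w v F G k : weight w -> weight v -> L2 w F -> cmeasurable_fun D G ->
  (forall x, D x -> abs2 (G x) * v x <= k * (abs2 (F x) * w x)) ->
  L2 v G /\ n2 v G <= k * n2 w F.
Proof.
move=> [mw w0] [mv v0] [mF iF] mG h.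
have LG : L2 v G.
  split=> //; apply: (rintegrable_dom mD) (rintegrableZ mD k iF) => //.
    by apply: measurable_funM => //; exact: cmeasurable_abs2.
  by move=> x Dx; rewrite ger0_norm ?mulr_ge0 ?abs2_ge0 ?v0 ?h.
split=> //; rewrite /n2 -RintegralZl//; apply: le_Rintegral => //; first by case: LG.
exact: rintegrableZ.
Qed.

Lemma L2_bounded w F k : weight w -> mu.-integrable D (EFin \o w) ->
  cmeasurable_fun D F -> (forall x, D x -> abs2 (F x) <= k) ->
  L2 w F /\ n2 w F <= k * Rintegral mu D w.
Proof.
move=> ww iw mF h.
have L1 : L2 w (fun=> 1).
  split; first exact: cmeasurable_cst.
  by apply: (rintegrable_ext mD) iw => x _; rewrite (abs2_real 1) expr1n mul1r.
have [] := @L2_dom w w (fun=> 1) F k ww ww L1 mF.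
  move=> x Dx; rewrite (abs2_real 1) expr1n mul1r ler_wpM2r ?h//.
  by case: ww => _; apply.
move=> LF; rewrite /n2; under [in X in _ * X]eq_Rintegral do rewrite (abs2_real 1) expr1n mul1r.
by [].
Qed.

Section Fixed_weight.
Variable w : T -> R.
Hypothesis ww : weight w.
Let mw : measurable_fun D w. Proof. by case: ww. Qed.
Let w0 x : D x -> 0 <= w x. Proof. by case: ww => _; apply. Qed.

Lemma cip_int F G : L2 w F -> L2 w G ->
  cintegrable mu D (fun x => F x * (G x)^*%C * (w x)%:C%C).
Proof.
move=> [mF iF] [mG iG].
apply: (cintegrable_dom mD) (rintegrableD mD iF iG) => //.
  by apply: cmeasurableM; [apply: cmeasurableM => //; exact: cmeasurable_conj
                          |exact: cmeasurable_real].
move=> x Dx; have wx := w0 Dx.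
have h z : z ^+ 2 <= abs2 (F x) * abs2 (G x) -> `|z * w x| <= abs2 (F x) * w x + abs2 (G x) * w x.
  move=> hz; rewrite normrM (ger0_norm wx) -mulrDl ler_wpM2r//.
  apply: sqr_norm_le; first by rewrite addr_ge0 ?abs2_ge0.
  by have := abs2_ge0 (F x); have := abs2_ge0 (G x); nra.
rewrite !ReImE /= !mulr0 subr0 add0r; split; apply: h.
  by rewrite -(abs2_conj (G x)) -abs2M; apply: le_trans (sqr_Re_le _); rewrite !ReImE.
by rewrite -(abs2_conj (G x)) -abs2M; apply: le_trans (sqr_Im_le _); rewrite !ReImE.
Qed.

Lemma cip_self F : L2 w F -> cip w F F = (n2 w F)%:C%C.
Proof.
move=> LF; apply: complex_ext; rewrite /cip /cintegral /=.
  by apply: eq_Rintegral => x _; rewrite mulJ !ReImE /=; ring.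
under eq_Rintegral do rewrite mulJ !ReImE /= mul0r mulr0 addr0.
by rewrite Rintegral_cst// mul0r.
Qed.

Lemma cip_conj F G : L2 w F -> L2 w G -> cip w G F = (cip w F G)^*%C.
Proof.
move=> LF LG; rewrite /cip -cintegral_conj//; last exact: cip_int.
by apply: cintegral_ext => x _; apply: complex_ext; rewrite !ReImE /=; ring.
Qed.

Lemma L20 : L2 w 0.
Proof.
split; first exact: cmeasurable_cst.
apply: (@rintegrable_ext _ _ _ mu _ mD (fun=> 0)); first by move=> x _; rewrite abs20 mul0r.
exact: integrable0.
Qed.

Lemma L2D F G : L2 w F -> L2 w G -> L2 w (F + G).
Proof.
move=> [mF iF] [mG iG]; split; first exact: cmeasurableD.
have := rintegrableD mD (rintegrableZ mD 2 iF) (rintegrableZ mD 2 iG).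
apply: (rintegrable_dom mD) => //.
  by apply: measurable_funM => //; apply: cmeasurable_abs2; exact: cmeasurableD.
move=> x Dx; have wx := w0 Dx; rewrite ger0_norm ?mulr_ge0 ?abs2_ge0//.
by rewrite !mulrA -mulrDl ler_wpM2r// abs2D_le.
Qed.

Lemma L2Z c F : L2 w F -> L2 w (c *: F).
Proof.
move=> [mF iF]; split; first by apply: cmeasurableM => //; exact: cmeasurable_cst.
by apply: (rintegrable_ext mD) (rintegrableZ mD (abs2 c) iF) => x _; rewrite abs2M mulrA.
Qed.

Lemma L2N F : L2 w F -> L2 w (- F).
Proof. by move=> /(L2Z (-1)); rewrite scaleN1r. Qed.

Lemma L2B F G : L2 w F -> L2 w G -> L2 w (F - G).
Proof. by move=> a b; apply: L2D => //; exact: L2N. Qed.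

Lemma L2_sum I (r : seq I) (P : pred I) (F : I -> T -> R[i]) :
  (forall k, L2 w (F k)) -> L2 w (\sum_(k <- r | P k) F k).
Proof. by move=> h; elim/big_ind : _ => //; [exact: L20|exact: L2D]. Qed.

Lemma cipDl F G H : L2 w F -> L2 w G -> L2 w H ->
  cip w (F + G) H = cip w F H + cip w G H.
Proof.
move=> LF LG LH; rewrite /cip -cintegralD//; try exact: cip_int.
by apply: cintegral_ext => x _; rewrite fctE !mulrDl.
Qed.

Lemma cipZl c F H : L2 w F -> L2 w H -> cip w (c *: F) H = c * cip w F H.
Proof.
move=> LF LH; rewrite /cip -cintegralZ//; try exact: cip_int.
by apply: cintegral_ext => x _; rewrite !mulrA.
Qed.

Lemma cipDr F G H : L2 w F -> L2 w G -> L2 w H ->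
  cip w H (F + G) = cip w H F + cip w H G.
Proof.
move=> LF LG LH; rewrite cip_conj ?cipDl ?conjD//; last exact: L2D.
by rewrite -!cip_conj.
Qed.

Lemma cipZr c F H : L2 w F -> L2 w H -> cip w H (c *: F) = c^*%C * cip w H F.
Proof.
move=> LF LH; rewrite cip_conj ?cipZl ?conjM//; last exact: L2Z.
by rewrite -!cip_conj.
Qed.

Lemma cipNl F H : L2 w F -> L2 w H -> cip w (- F) H = - cip w F H.
Proof. by move=> LF LH; rewrite -scaleN1r cipZl// mulN1r. Qed.

Lemma cipNr F H : L2 w F -> L2 w H -> cip w H (- F) = - cip w H F.
Proof.
have conjN1 : (-1 : R[i])^*%C = -1 by apply: complex_ext; rewrite !ReImE // (_ : Im 1 = 0) ?oppr0.
by move=> LF LH; rewrite -scaleN1r cipZr// conjN1 mulN1r.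
Qed.

Lemma cipBl F G H : L2 w F -> L2 w G -> L2 w H ->
  cip w (F - G) H = cip w F H - cip w G H.
Proof. by move=> *; rewrite cipDl ?cipNl//; exact: L2N. Qed.

Lemma cipBr F G H : L2 w F -> L2 w G -> L2 w H ->
  cip w H (F - G) = cip w H F - cip w H G.
Proof. by move=> *; rewrite cipDr ?cipNr//; exact: L2N. Qed.

Lemma cip0l H : L2 w H -> cip w 0 H = 0.
Proof. by move=> LH; rewrite -(scale0r (0 : T -> R[i])) cipZl ?mul0r//; exact: L20. Qed.

Lemma cip_suml n (a : nat -> R[i]) (F : nat -> T -> R[i]) H :
  (forall k, L2 w (F k)) -> L2 w H ->
  cip w (\sum_(k < n) a k *: F k) H = \sum_(k < n) a k * cip w (F k) H.
Proof.
move=> LF LH; elim: n => [|n IH]; first by rewrite !big_ord0 cip0l.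
rewrite !big_ord_recr cipDl ?cipZl ?IH//; last exact: L2Z.
by apply: L2_sum => k; exact: L2Z.
Qed.

Lemma cip_sumr n (a : nat -> R[i]) (F : nat -> T -> R[i]) H :
  (forall k, L2 w (F k)) -> L2 w H ->
  cip w H (\sum_(k < n) a k *: F k) = \sum_(k < n) (a k)^*%C * cip w H (F k).
Proof.
move=> LF LH; rewrite cip_conj//; last by apply: L2_sum => k; exact: L2Z.
rewrite cip_suml// conj_sum; apply: eq_bigr => i _.
by rewrite conjM -cip_conj.
Qed.

Lemma gram n m (a b : nat -> R[i]) (F G : nat -> T -> R[i]) :
  (forall k, L2 w (F k)) -> (forall k, L2 w (G k)) ->
  cip w (\sum_(k < n) a k *: F k) (\sum_(k < m) b k *: G k) =
  \sum_(j < n) \sum_(k < m) a j * (b k)^*%C * cip w (F j) (G k).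
Proof.
move=> LF LG; rewrite cip_suml//; last by apply: L2_sum => k; exact: L2Z.
apply: eq_bigr => j _; rewrite cip_sumr// big_distrr /=.
by apply: eq_bigr => k _; rewrite mulrA.
Qed.

Lemma n2D F G : L2 w F -> L2 w G ->
  n2 w (F + G) = n2 w F + 2 * Re (cip w F G) + n2 w G.
Proof.
move=> LF LG; have := cip_self (L2D LF LG).
rewrite cipDl ?cipDr ?cip_self//; try exact: L2D.
rewrite (cip_conj LF LG) => /(congr1 (@complex.Re R)); rewrite !ReImE /= => <-; ring.
Qed.

Lemma n2Z c F : L2 w F -> n2 w (c *: F) = abs2 c * n2 w F.
Proof.
move=> LF; have := cip_self (L2Z c LF).
rewrite cipZl ?cipZr//; last exact: L2Z.
by rewrite cip_self// mulrA mulJ => /(congr1 (@complex.Re R)); rewrite ReImE /= mulr0 subr0 => <-.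
Qed.

Lemma n2N F : L2 w F -> n2 w (- F) = n2 w F.
Proof. by move=> LF; apply: eq_Rintegral => x _; rewrite abs2N. Qed.

Lemma n2BC F G : L2 w F -> L2 w G -> n2 w (F - G) = n2 w (G - F).
Proof. by move=> LF LG; apply: eq_Rintegral => x _; rewrite abs2BC. Qed.

Lemma cip_CauchySchwarz F G : L2 w F -> L2 w G -> abs2 (cip w F G) <= n2 w F * n2 w G.
Proof.
move=> LF LG; set z := cip w F G.
have : abs2 z ^+ 2 <= n2 w F * (abs2 z * n2 w G).
  (* Along [F + t z G] with [z = <F, G>] the cross term is [t |z|^2], real whatever the phase of
     [z]. The surplus factor [|z|^2] is cancelled afterwards. *)
  apply: discriminant_le => t.
  have := n2_ge0 (F + (t%:C%C * z) *: G) ww.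
  rewrite n2D ?n2Z ?cipZr//; last exact: L2Z.
  rewrite -/z conjM conj_real abs2M abs2_real -mulrA [_^*%C * _]mulrC mulJ.
  rewrite ReImE /= mul0r subr0 => h; apply: le_trans h _.
  by rewrite le_eqVlt; apply/orP; left; apply/eqP; ring.
have := abs2_ge0 z; rewrite le_eqVlt => /predU1P[<- _|z0].
  by rewrite mulr_ge0 ?n2_ge0.
by rewrite mulrCA expr2 ler_pM2l.
Qed.

Lemma n2D_le F G : L2 w F -> L2 w G -> n2 w (F + G) <= 2 * n2 w F + 2 * n2 w G.
Proof.
move=> LF LG; have := n2_ge0 (F - G) ww.
rewrite !n2D//; last exact: L2N.
by rewrite n2N// cipNr// ReImE; lra.
Qed.

Lemma n2_triangle F G H : L2 w F -> L2 w G -> L2 w H ->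
  n2 w (F - H) <= 2 * n2 w (F - G) + 2 * n2 w (G - H).
Proof.
move=> LF LG LH; rewrite (_ : F - H = (F - G) + (G - H)); last by rewrite addrA subrK.
by apply: n2D_le; exact: L2B.
Qed.

Lemma cip_cvg (Fn Gn : nat -> T -> R[i]) F G :
  (forall n, L2 w (Fn n)) -> (forall n, L2 w (Gn n)) -> L2 w F -> L2 w G ->
  n2 w (Fn n - F) @[n --> \oo] --> (0 : R) ->
  n2 w (Gn n - G) @[n --> \oo] --> (0 : R) ->
  ccvg (fun n => cip w (Fn n) (Gn n)) (cip w F G).
Proof.
move=> LFn LGn LF LG cF cG; apply: ccvg_abs2.
apply: (@squeeze_cvgr _ _ _ _ (fun=> 0)
  (fun n => 2 * (n2 w (Fn n - F) * (2 * n2 w (Gn n - G) + 2 * n2 w G))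
      + 2 * (n2 w F * n2 w (Gn n - G)))); last 2 first.
- exact: cvg_cst.
- rewrite [X in _ --> X](_ : _ = 2 * (0 * (2 * 0 + 2 * n2 w G)) + 2 * (n2 w F * 0)).
    apply: cvgD; apply: cvgM; try exact: cvg_cst.
      by apply: cvgM => //; apply: cvgD; apply: cvgM => //; exact: cvg_cst.
    by apply: cvgM => //; exact: cvg_cst.
  by rewrite mul0r !mulr0 addr0.
near=> n; rewrite abs2_ge0 /=.
rewrite (_ : _ - _ = cip w (Fn n - F) (Gn n) + cip w F (Gn n - G)); last first.
  by rewrite cipBl// cipBr// addrA subrK.
apply: le_trans (abs2D_le _ _) _; apply: lerD; rewrite ler_pM2l//.
  apply: le_trans (cip_CauchySchwarz _ _) _ => //; first exact: L2B.
  rewrite ler_wpM2l ?n2_ge0//.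
  by rewrite -{1}(subrK G (Gn n)); apply: n2D_le => //; exact: L2B.
by apply: cip_CauchySchwarz => //; exact: L2B.
Unshelve. all: by end_near. Qed.

Lemma n2_cvg (Fn : nat -> T -> R[i]) F :
  (forall n, L2 w (Fn n)) -> L2 w F ->
  n2 w (Fn n - F) @[n --> \oo] --> (0 : R) ->
  (n2 w \o Fn) n @[n --> \oo] --> n2 w F.
Proof.
move=> LFn LF cF; have [+ _] := cip_cvg LFn LFn LF LF cF cF.
have -> : n2 w \o Fn = fun n => Re (cip w (Fn n) (Fn n)).
  by apply/funext => n; rewrite cip_self.
by rewrite cip_self.
Qed.

End Fixed_weight.
End L2_space.

(** * Rapidly converging sequences, almost everywhere limits, completeness of [L_2(w)] *)

Lemma fast_cvg {R : realType} (u : nat -> R) (k : R) :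
  (forall m, (u m.+1 - u m) ^+ 2 <= k * (4^-1) ^+ m) -> cvgn u.
Proof.
move=> h.
have k0 : 0 <= k by have := h 0; rewrite expr0 mulr1; apply: le_trans; exact: sqr_ge0.
have h1 m : `|u m.+1 - u m| <= Num.sqrt k * (2^-1) ^+ m.
  apply: sqr_norm_le; first by rewrite mulr_ge0 ?sqrtr_ge0 ?exprn_ge0.
  rewrite exprMn sqr_sqrtr// exprAC (_ : 2^-1 ^+ 2 = 4^-1) ?h//; by field.
have : cvgn [normed series (telescope u)].
  apply: (@series_le_cvg _ _ (geometric (Num.sqrt k) 2^-1)).
  - by move=> n /=; exact: normr_ge0.
  - by move=> n; rewrite geometric_ge0 ?sqrtr_ge0.
  - by move=> n /=; exact: h1.
  - apply: is_cvg_geometric_series; rewrite ger0_norm//.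
    by rewrite invf_lt1// ltr1n.
move=> /normed_cvg; rewrite telescopeK => c.
rewrite (_ : u = (fun n => u n - u 0) \+ cst (u 0)); last by apply/funext => n /=; rewrite subrK.
by apply: is_cvgD => //; exact: is_cvg_cst.
Qed.

Section Almost_everywhere.
Context {R : realType} {d : measure_display} {T : measurableType d}.
Variables (mu : {measure set T -> \bar R}) (D : set T).
Hypothesis mD : measurable D.
Implicit Types (F G : T -> R[i]) (w : T -> R).

Lemma ae_imp (P Q : T -> Prop) : (forall x, P x -> Q x) ->
  {ae mu, forall x, P x} -> {ae mu, forall x, Q x}.
Proof. exact: filterS. Qed.

Lemma ae_imp2 (P1 P2 Q : T -> Prop) : (forall x, P1 x -> P2 x -> Q x) ->
  {ae mu, forall x, P1 x} -> {ae mu, forall x, P2 x} -> {ae mu, forall x, Q x}.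
Proof. exact: filterS2. Qed.

(** Since [4/8 = 1/2], the series of [4^m |G_m|^2 w] has integral at most 2, so its sum is finite
    almost everywhere. Each term is at most the sum, and division by [w(x) > 0] gives the constant
    [k]. *)
Lemma ae_rapid w (G : nat -> T -> R[i]) : weight D w ->
  {ae mu, forall x, D x -> 0 < w x} ->
  (forall m, L2 mu D w (G m)) -> (forall m, n2 mu D w (G m) <= (8^-1) ^+ m) ->
  {ae mu, forall x, D x -> exists k, forall m, abs2 (G m x) <= k * (4^-1) ^+ m}.
Proof.
move=> ww wpos LG hG; have [mw w0] := ww.
pose t m x := (4 ^+ m * (abs2 (G m x) * w x))%:E.
have mt m : measurable_fun D (t m).
  apply/measurable_EFinP; apply: measurable_funM; first exact: measurable_cst.
  by case: (LG m) => _ /rintegrable_meas.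
have t0 m x : D x -> (0 <= t m x)%E.
  by move=> Dx; rewrite lee_fin !mulr_ge0 ?abs2_ge0 ?w0 ?exprn_ge0.
have It : mu.-integrable D (fun x => \sum_(m <oo) t m x)%E.
  apply/integrableP; split.
    exact: (@ge0_emeasurable_sum _ _ _ D t xpredT (fun m x Dx _ => t0 m x Dx) (fun m _ => mt m)).
  rewrite (_ : integral _ _ _ = \int[mu]_(x in D) (\sum_(m <oo) t m x))%E; last first.
    by apply: eq_integral => x; rewrite inE => Dx; rewrite gee0_abs// nneseries_ge0// => *; exact: t0.
  rewrite integral_nneseries//.
  have le2 : (\sum_(m <oo) \int[mu]_(x in D) t m x <=
     \sum_(m <oo) ((2 : R) / (2 ^ (m + 0.+1))%:R)%:E)%E.
    apply: lee_nneseries => [m _ _|m _]; first by apply: integral_ge0 => x Dx; exact: t0.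
    have -> : (\int[mu]_(x in D) t m x = (4 ^+ m * n2 mu D w (G m))%:E)%E.
      rewrite EFinM -n2E// -ge0_integralZl ?lee_fin ?exprn_ge0//.
      + by apply/measurable_EFinP; case: (LG m) => _ /rintegrable_meas.
      + by move=> x Dx; rewrite lee_fin mulr_ge0 ?abs2_ge0 ?w0.
    rewrite lee_fin; apply: le_trans (ler_wpM2l _ (hG m)) _; first by rewrite exprn_ge0.
    rewrite -exprMn addn1 natrX exprS invfM mulrA divff// mul1r -exprVn.
    by rewrite (_ : 4 * 8^-1 = 2^-1)//; field.
  apply: le_lt_trans le2 _.
  rewrite (_ : (\sum_(_ <oo) _)%E = (2 / 2 ^+ 0)%:E :> \bar R) ?ltry//.
  by apply/cvg_lim => //; exact: cvg_geometric_eseries_half.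
apply: filterS2 wpos (integrable_ae mD It) => x wx fx Dx.
have {}wx := wx Dx; have {}fx := fx Dx.
exists (fine (\sum_(m <oo) t m x)%E / w x) => m.
rewrite mulrAC ler_pdivlMr// exprVn ler_pdivlMr ?exprn_gt0// mulrC.
rewrite -lee_fin fineK//.
have := @nneseries_lim_ge R (fun m => t m x) xpredT 0 m.+1 (fun n _ _ => t0 n x Dx).
apply: le_trans; rewrite big_nat_recr//= leeDr//.
by apply: sume_ge0 => i _; exact: t0.
Qed.

(** The limit is built from upper limits of the real and imaginary parts, which are measurable
    whether or not the sequence converges at a given point. *)
Lemma ae_limit (Fn : nat -> T -> R[i]) : (forall m, cmeasurable_fun D (Fn m)) ->
  {ae mu, forall x, D x -> exists k, forall m,
     abs2 (Fn m.+1 x - Fn m x) <= k * (4^-1) ^+ m} ->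
  exists F, cmeasurable_fun D F /\
    {ae mu, forall x, D x -> ccvg (fun m => Fn m x) (F x)}.
Proof.
move=> mF h.
have aux (p : nat -> T -> R) : (forall m, measurable_fun D (p m)) ->
    measurable_fun D (fun x => fine (limn_esup (fun m => (p m x)%:E))) /\
    forall x, cvgn (fun m => p m x) ->
      p m x @[m --> \oo] --> fine (limn_esup (fun m => (p m x)%:E)).
  move=> mp; split.
    apply: (measurableT_comp (@fine_measurable R setT measurableT)).
    by apply: (measurable_fun_limn_esup (f := fun m x => (p m x)%:E)) => m; exact/measurable_EFinP.
  move=> x /cvg_ex[l hl].
  have hE : (p m x)%:E @[m --> \oo] --> l%:E by apply: cvg_EFin => //; exact: nearW.
  by rewrite (cvg_limn_einf_sup hE).2.
have [mR cR] := aux _ (fun m => (mF m).1).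
have [mI cI] := aux _ (fun m => (mF m).2).
exists (fun x => (fine (limn_esup (fun m => (Re (Fn m x))%:E)) +i*
                  fine (limn_esup (fun m => (Im (Fn m x))%:E)))%C); split => //.
apply: filterS h => x h Dx; have [k hk] := h Dx; split => /=.
  by apply: cR; apply: (@fast_cvg _ _ k) => m; apply: le_trans (hk m); rewrite -cReN -cReD sqr_Re_le.
by apply: cI; apply: (@fast_cvg _ _ k) => m; apply: le_trans (hk m); rewrite -cImN -cImD sqr_Im_le.
Qed.

Lemma rapid_ccvg (v : nat -> R[i]) z k :
  (forall m, abs2 (v m - z) <= k * (4^-1) ^+ m) -> ccvg v z.
Proof.
move=> h; apply: ccvg_abs2; apply: (@squeeze_cvgr _ _ _ _ (fun=> 0) (fun m => k * (4^-1) ^+ m)).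
- by near=> n; rewrite abs2_ge0 h.
- exact: cvg_cst.
- by apply: cvg_geometric; rewrite ger0_norm// invf_lt1// ltr1n.
Unshelve. all: by end_near. Qed.

(** Stated with integrals in [\bar R], so that it can serve to prove that [F - G] is in [L_2(w)] in
    the first place. *)
Lemma fatou_n2 w (Fn : nat -> T -> R[i]) F G N e : weight D w ->
  (forall m, cmeasurable_fun D (Fn m)) -> cmeasurable_fun D F -> cmeasurable_fun D G ->
  {ae mu, forall x, D x -> ccvg (fun m => Fn m x) (F x)} ->
  (forall m, (N <= m)%N -> (\int[mu]_(x in D) (abs2 (Fn m x - G x) * w x)%:E <= e)%E) ->
  (\int[mu]_(x in D) (abs2 (F x - G x) * w x)%:E <= e)%E.
Proof.
move=> [mw w0] mFn mF mG cF h.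
pose q m x := (abs2 (Fn (m + N)%N x - G x) * w x)%:E.
have mq F1 : cmeasurable_fun D F1 -> measurable_fun D (fun x => (abs2 (F1 x - G x) * w x)%:E).
  move=> mF1; apply/measurable_EFinP; apply: measurable_funM => //.
  by apply: cmeasurable_abs2; exact: cmeasurableB.
have q0 m x : D x -> (0 <= q m x)%E.
  by move=> Dx; rewrite lee_fin mulr_ge0 ?abs2_ge0 ?w0.
have -> : (\int[mu]_(x in D) (abs2 (F x - G x) * w x)%:E =
    \int[mu]_(x in D) (limn_einf (q^~ x)))%E.
  apply: ae_eq_integral => //.
  - exact: mq.
  - rewrite (_ : (fun x => _) = fun x => (- limn_esup (fun m => (- q m x)%E))%E); last first.
      by apply/funext => x; rewrite -limn_einfN; congr limn_einf; apply/funext => m; rewrite /comp oppeK.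
    apply: measurableT_comp => //; apply: (measurable_fun_limn_esup (f := fun m x => (- q m x)%E)) => m.
    by apply: measurableT_comp => //; exact: mq.
  apply: filterS cF => x c Dx; apply/esym.
  suff qc : q^~ x @ \oo --> (abs2 (F x - G x) * w x)%:E by rewrite (cvg_limn_einf_sup qc).1.
  apply: cvg_EFin; first exact: nearW.
  rewrite /=; apply: cvgM; last exact: cvg_cst.
  have {}c := c Dx.
  have c2 : ccvg (fun m => Fn (m + N)%N x) (F x).
    by case: c => a b; split; rewrite /= (cvg_shiftn N (fun m => _ (Fn m x))).
  have [a b] := ccvgD c2 (ccvgN (ccvg_cst (G x))).
  by rewrite /abs2; under eq_fun do rewrite !expr2; rewrite !expr2; apply: cvgD; apply: cvgM.
apply: le_trans (fatou mu mD _ q0) _; first by move=> m; exact: mq.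
rewrite limn_einf_lim; apply: lime_le.
  exact: is_cvg_einfs.
near=> n; apply: le_trans (ereal_inf_lbound _) (h (n + N)%N (leq_addl _ _)).
by exists n => /=.
Unshelve. all: by end_near. Qed.

(** The pointwise limit and the Cauchy property may come from different sources: in [mat_op_L2] the
    limit is found with weight 1, while the sequence is Cauchy for the weight [1/(f+g)]. *)
Lemma L2_fatou w (Fn : nat -> T -> R[i]) F : weight D w ->
  (forall m, L2 mu D w (Fn m)) -> cmeasurable_fun D F ->
  {ae mu, forall x, D x -> ccvg (fun m => Fn m x) (F x)} ->
  (forall e : R, 0 < e -> exists N, forall n m, (N <= n)%N -> (N <= m)%N ->
    n2 mu D w (Fn n - Fn m) < e) ->
  L2 mu D w F /\ n2 mu D w (Fn n - F) @[n --> \oo] --> (0 : R).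
Proof.
move=> ww LFn mF cF hC.
have key e : 0 < e -> exists N, forall n, (N <= n)%N ->
    (\int[mu]_(x in D) (abs2 ((F - Fn n) x) * w x)%:E <= e%:E)%E.
  move=> /hC[N hN]; exists N => n Nn.
  apply: (fatou_n2 (N := N) ww _ mF _ cF) => [m||m Nm]; [by case: (LFn m)|by case: (LFn n)|].
  rewrite [X in (X <= _)%E](n2E mD (L2B mD ww (LFn m) (LFn n))).
  by rewrite lee_fin ltW// hN.
have LB n : (\int[mu]_(x in D) (abs2 ((F - Fn n) x) * w x)%:E < +oo)%E ->
    L2 mu D w (F - Fn n).
  by move=> h; apply: L2P => //; apply: cmeasurableB => //; case: (LFn n).
have LF : L2 mu D w F.
  have [N hN] := key 1 ltr01.
  rewrite -(subrK (Fn N) F); apply: L2D => //; apply: LB.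
  by apply: le_lt_trans (hN N (leqnn N)) _; rewrite ltry.
split=> //; apply/cvgrPdist_le => e e0; have [N hN] := key e e0.
exists N => // n /= Nn; rewrite sub0r normrN ger0_norm ?n2_ge0// n2BC//.
rewrite -lee_fin -n2E//; last exact: L2B.
exact: hN.
Qed.

Lemma n2_fast_cauchy w (Fn : nat -> T -> R[i]) : weight D w ->
  (forall m, L2 mu D w (Fn m)) ->
  (forall m, n2 mu D w (Fn m.+1 - Fn m) <= (8^-1) ^+ m) ->
  forall e : R, 0 < e -> exists N, forall n m, (N <= n)%N -> (N <= m)%N ->
    n2 mu D w (Fn n - Fn m) < e.
Proof.
move=> ww LFn h e e0.
(* The constant 3 reproduces itself in the induction because [2 + 2 * 3 / 8 <= 3]. *)
have step k m : n2 mu D w (Fn (m + k)%N - Fn m) <= 3 * (8^-1) ^+ m.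
  elim: k m => [|k IH] m.
    rewrite addn0 subrr (_ : n2 _ _ _ _ = 0) ?mulr_ge0 ?exprn_ge0//.
    rewrite /n2; under eq_Rintegral do rewrite abs20 mul0r.
    by rewrite Rintegral_cst// mul0r.
  rewrite addnS -addSn; apply: le_trans (n2_triangle mD ww (LFn _) (LFn m.+1) (LFn _)) _.
  have := IH m.+1; have := h m; rewrite exprS.
  have : 0 <= (8^-1) ^+ m :> R by rewrite exprn_ge0. lra.
(* [12 = 2 * 3 + 2 * 3]: the distances of both terms to the [N]-th one are at most [3 * 8^-N], and
   the triangle inequality doubles each. *)
have /cvgrPdist_lt cv : (fun m => 12 * (8^-1) ^+ m) @ \oo --> (0 : R).
  by apply: (@cvg_geometric R 12 8^-1); rewrite ger0_norm// invf_lt1// ltr1n.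
have [N _ hN] := cv _ e0; exists N => n m Nn Nm.
apply: le_lt_trans (n2_triangle mD ww (LFn n) (LFn N) (LFn m)) _.
rewrite (n2BC (LFn N) (LFn m)).
have := hN N (leqnn N); rewrite /= sub0r normrN ger0_norm ?mulr_ge0 ?exprn_ge0//.
have := step (n - N)%N N; have := step (m - N)%N N; rewrite !subnKC//; lra.
Qed.

Lemma L2_complete w (Fn : nat -> T -> R[i]) : weight D w ->
  {ae mu, forall x, D x -> 0 < w x} ->
  (forall m, L2 mu D w (Fn m)) ->
  (forall m, n2 mu D w (Fn m.+1 - Fn m) <= (8^-1) ^+ m) ->
  exists F, [/\ L2 mu D w F, n2 mu D w (Fn n - F) @[n --> \oo] --> (0 : R)
    & {ae mu, forall x, D x -> ccvg (fun m => Fn m x) (F x)}].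
Proof.
move=> ww wpos LFn h.
have /ae_limit[|F [mF cF]] := ae_rapid ww wpos (fun m => L2B mD ww (LFn m.+1) (LFn m)) h.
  by move=> m; case: (LFn m).
exists F; have [] := L2_fatou ww LFn mF cF (n2_fast_cauchy ww LFn h).
by split.
Qed.

Lemma n2_eq0 w F : weight D w -> {ae mu, forall x, D x -> 0 < w x} ->
  L2 mu D w F -> n2 mu D w F = 0 -> {ae mu, forall x, D x -> F x = 0}.
Proof.
move=> [mw w0] wpos LF h.
have mq : measurable_fun D (fun x => (abs2 (F x) * w x)%:E).
  by apply/measurable_EFinP; case: LF => _ /rintegrable_meas.
have /(ae_eq_integral_abs mu mD mq) : (\int[mu]_(x in D) `|(abs2 (F x) * w x)%:E| = 0)%E.
  transitivity (\int[mu]_(x in D) (abs2 (F x) * w x)%:E)%E.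
    by apply: eq_integral => x; rewrite inE => Dx; rewrite gee0_abs// lee_fin mulr_ge0 ?abs2_ge0 ?w0.
  by rewrite n2E// h.
apply: filterS2 wpos => x wx hx Dx; have {}wx := wx Dx.
have /eqP := hx Dx; rewrite eqe mulf_eq0 (gt_eqF wx) orbF => /eqP.
exact: abs2_eq0.
Qed.

Lemma Rintegral_dominated (pn : nat -> T -> R) (p q : T -> R) :
  (forall n, measurable_fun D (pn n)) -> measurable_fun D p ->
  mu.-integrable D (EFin \o q) -> (forall n x, D x -> `|pn n x| <= q x) ->
  {ae mu, forall x, D x -> pn n x @[n --> \oo] --> p x} ->
  mu.-integrable D (EFin \o p) /\
  Rintegral mu D (pn n) @[n --> \oo] --> Rintegral mu D p.
Proof.
move=> mpn mp iq h cp.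
have [] := @dominated_convergence _ _ _ mu D mD (fun n => EFin \o pn n) (EFin \o p) (EFin \o q) _ _ _ iq.
- by move=> n; exact/measurable_EFinP.
- exact/measurable_EFinP.
- apply: filterS cp => x cx Dx; apply: cvg_EFin; first exact: nearW.
  exact: cx.
- by apply: aeW => x n Dx /=; rewrite lee_fin h.
move=> ip _ c; split=> //.
by rewrite /Rintegral; apply: fine_cvg; rewrite fineK//; exact: integrable_fin_num ip.
Qed.

Lemma n2_dominated w (Fn : nat -> T -> R[i]) F (q : T -> R) : weight D w ->
  (forall n, cmeasurable_fun D (Fn n)) -> cmeasurable_fun D F ->
  mu.-integrable D (EFin \o q) ->
  (forall n x, D x -> abs2 (Fn n x - F x) * w x <= q x) ->
  {ae mu, forall x, D x -> ccvg (fun n => Fn n x) (F x)} ->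
  n2 mu D w (Fn n - F) @[n --> \oo] --> (0 : R).
Proof.
move=> [mw w0] mFn mF iq h cF.
have m1 n : measurable_fun D (fun x => abs2 (Fn n x - F x) * w x).
  by apply: measurable_funM => //; apply: cmeasurable_abs2; exact: cmeasurableB.
have b1 n x : D x -> `|abs2 (Fn n x - F x) * w x| <= q x.
  by move=> Dx; rewrite ger0_norm ?h// mulr_ge0 ?abs2_ge0 ?w0.
have c1 : {ae mu, forall x, D x -> abs2 (Fn n x - F x) * w x @[n --> \oo] --> (0 : R)}.
  apply: filterS cF => x cx Dx; rewrite -[X in _ --> X](mul0r (w x)).
  by apply: cvgM; [exact: ccvg_abs2P (cx Dx)|exact: cvg_cst].
have [_] := Rintegral_dominated m1 (measurable_cst (0 : R)) iq b1 c1.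
by rewrite Rintegral_cst// mul0r.
Qed.

Lemma cintegral_dominated (Fn : nat -> T -> R[i]) F (q : T -> R) :
  (forall n, cmeasurable_fun D (Fn n)) -> cmeasurable_fun D F ->
  mu.-integrable D (EFin \o q) ->
  (forall n x, D x -> abs2 (Fn n x) <= q x ^+ 2) -> (forall x, D x -> 0 <= q x) ->
  {ae mu, forall x, D x -> ccvg (fun n => Fn n x) (F x)} ->
  cintegrable mu D F /\ ccvg (fun n => cintegral mu D (Fn n)) (cintegral mu D F).
Proof.
move=> mFn [mR mI] iq h q0 cF.
have cFR : {ae mu, forall x, D x -> Re (Fn n x) @[n --> \oo] --> Re (F x)}.
  by apply: filterS cF => x cx Dx; have [] := cx Dx.
have cFI : {ae mu, forall x, D x -> Im (Fn n x) @[n --> \oo] --> Im (F x)}.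
  by apply: filterS cF => x cx Dx; have [] := cx Dx.
have [iR cR] := @Rintegral_dominated (fun n x => Re (Fn n x)) _ q (fun n => (mFn n).1) mR iq
  (fun n x Dx => normRe_le (q0 x Dx) (h n x Dx)) cFR.
have [iI cI] := @Rintegral_dominated (fun n x => Im (Fn n x)) _ q (fun n => (mFn n).2) mI iq
  (fun n x Dx => normIm_le (q0 x Dx) (h n x Dx)) cFI.
by split; split.
Qed.

End Almost_everywhere.

Notation wcirc := (weight (T := measurableTypeR _) circ).
Notation mcirc := (cmeasurable_fun (T := measurableTypeR _) circ).

(** * Trigonometric polynomials *)

Section Circle.
Context {R : realType}.
Implicit Types (x t : R) (P : {poly R[i]}) (F : R -> R[i]) (w : R -> R).
Local Notation leb := (@lebesgue_measure R).

Lemma measurable_circ : measurable (@circ R : set (measurableTypeR R)).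
Proof. exact: measurable_itv. Qed.

Lemma pi_lt : - pi < pi :> R.
Proof. by have := pi_gt0 R; lra. Qed.

Lemma leb_circ : leb circ = (2 * pi)%:E.
Proof.
rewrite /circ lebesgue_measure_itv /= lte_fin pi_lt -EFinD opprK.
by congr (_%:E); ring.
Qed.

Lemma integrable_cst_circ (r : R) : leb.-integrable circ (EFin \o (fun=> r)).
Proof.
apply: continuous_compact_integrable; first exact: segment_compact.
by apply: continuous_subspaceT => x; exact: cvg_cst.
Qed.

Lemma Rintegral_cst_circ (r : R) : Rintegral leb circ (fun=> r) = r * (2 * pi).
Proof. by rewrite (Rintegral_cst leb measurable_circ) /= leb_circ. Qed.

Lemma weight1 : weight (R := R) (T := measurableTypeR R) circ (fun=> 1).
Proof. by split; [exact: measurable_cst|move=> x _; exact: ler01]. Qed.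

Lemma abs2_expi t : abs2 (expi t) = 1.
Proof. by rewrite /abs2 /= cos2Dsin2. Qed.
Lemma expi0 : expi 0 = 1 :> R[i].
Proof. by rewrite /expi cos0 sin0. Qed.
Lemma expiD t s : expi (t + s) = expi t * expi s.
Proof. by apply: complex_ext; rewrite ReImE /= ?cosD ?sinD //; ring. Qed.
Lemma expi_conj t : (expi t)^*%C = expi (- t).
Proof. by apply: complex_ext; rewrite ReImE /= ?cosN ?sinN. Qed.
Lemma expiX t n : expi t ^+ n = expi (n%:R * t).
Proof.
elim: n => [|n IH]; first by rewrite expr0 mul0r expi0.
by rewrite exprS IH -expiD -natr1; congr expi; ring.
Qed.

Definition E (j : int) x : R[i] := expi (j%:~R * x).
(** The analytic trigonometric polynomials, encoded by genuine polynomials so that multiplicativity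
    ([peM]) and the mean value as constant coefficient ([cintegral_pe]) come from polynomial
    algebra. *)
Definition pe P x : R[i] := P.[expi x].

Lemma abs2_E j x : abs2 (E j x) = 1. Proof. exact: abs2_expi. Qed.
Lemma E_mul j k x : E j x * E k x = E (j + k) x.
Proof. by rewrite /E -expiD intrD mulrDl. Qed.
Lemma E_conj j x : (E j x)^*%C = E (- j) x.
Proof. by rewrite /E expi_conj intrN mulNr. Qed.
Lemma E0 x : E 0 x = 1. Proof. by rewrite /E mul0r expi0. Qed.

Lemma measurable_cos D : measurable_fun D (@cos R).
Proof. by apply: measurable_funTS; apply: continuous_measurable_fun; exact: continuous_cos. Qed.
Lemma measurable_sin D : measurable_fun D (@sin R).
Proof. by apply: measurable_funTS; apply: continuous_measurable_fun; exact: continuous_sin. Qed.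

Lemma cmeasurable_expi (p : R -> R) (D : set (measurableTypeR R)) :
  measurable_fun D p -> cmeasurable_fun D (fun x => expi (p x)).
Proof.
move=> mp; rewrite /expi; split => /=; first exact: (measurableT_comp (f := @cos R) (@measurable_cos setT) mp).
exact: (measurableT_comp (f := @sin R) (@measurable_sin setT) mp).
Qed.

Lemma cmeasurable_E j (D : set (measurableTypeR R)) : cmeasurable_fun D (E j).
Proof. by apply: cmeasurable_expi; apply: measurable_funM => //; exact: measurable_cst. Qed.

Lemma peE P x : pe P x = \sum_(k < size P) P`_k * E k%:Z x.
Proof. by rewrite /pe horner_coef; apply: eq_bigr => k _; rewrite expiX. Qed.

Lemma pe_sum P n x : (size P <= n)%N -> pe P x = \sum_(k < n) P`_k * E k%:Z x.
Proof. by move=> h; rewrite /pe (horner_coef_wide _ h); apply: eq_bigr => k _; rewrite expiX. Qed.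

Lemma cmeasurable_pe P (D : set (measurableTypeR R)) : cmeasurable_fun D (pe P).
Proof.
rewrite (_ : pe P = fun x => \sum_(k < size P) P`_k * E k%:Z x); last first.
  by apply/funext => x; exact: peE.
apply: (@cmeasurable_sum _ _ _ _ _ (fun (k : nat) x => P`_k * E k%:Z x)) => k.
by apply: cmeasurableM; [exact: cmeasurable_cst|exact: cmeasurable_E].
Qed.

Lemma pe_bounded P : exists k, 0 <= k /\ forall x, abs2 (pe P x) <= k.
Proof.
elim/poly_ind: P => [|P c [k [k0 hk]]].
  by exists 0; split => // x; rewrite /pe horner0 abs20.
exists (2 * k + 2 * abs2 c); split; first by rewrite addr_ge0 ?mulr_ge0 ?abs2_ge0.
move=> x; rewrite /pe hornerMXaddC; apply: le_trans (abs2D_le _ _) _.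
by rewrite abs2M abs2_expi mulr1 lerD2r ler_wpM2l// hk.
Qed.

Lemma L2_pe w P : wcirc w -> leb.-integrable circ (EFin \o w) -> L2 leb circ w (pe P).
Proof.
move=> ww iw; have [k [k0 hk]] := pe_bounded P.
have [] // := L2_bounded measurable_circ ww iw (cmeasurable_pe P circ) (k := k).
Qed.

Lemma L2_E w j : wcirc w -> leb.-integrable circ (EFin \o w) -> L2 leb circ w (E j).
Proof.
move=> ww iw.
have [] // := L2_bounded measurable_circ ww iw (cmeasurable_E j circ) (k := 1).
by move=> x _; rewrite abs2_E.
Qed.

Lemma Rintegral_cos (j : R) : j != 0 -> sin (j * pi) = 0 ->
  Rintegral leb circ (fun x => cos (j * x)) = 0.
Proof.
move=> j0 sj.
have dF x : is_derive x 1 (fun x => j^-1 * sin (j * x)) (cos (j * x)).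
  have h : is_derive x 1 (fun y => j * y) j.
    by apply: is_derive_eq; rewrite ?scaler0 ?addr0 /GRing.scale/= ?mulr1 ?add0r.
  have hs : is_derive (j * x) 1 (@sin R) (cos (j * x)) by exact: is_derive_sin.
  apply: (is_derive_eq (@is_deriveZ R R _ _ j^-1 _ _ _ (is_derive1_comp hs h))).
  by rewrite /GRing.scale/=; field.
rewrite /Rintegral (@continuous_FTC2 _ (fun x => cos (j * x)) (fun x => j^-1 * sin (j * x))).
- by rewrite mulrN sinN sj oppr0 mulr0 subee.
- exact: pi_lt.
- apply: continuous_subspaceT => x.
  apply: (@continuous_comp _ _ _ (fun x => j * x) cos); last exact: continuous_cos.
  exact: mulrl_continuous.
- split.
  + by move=> x _; have [] := dF x.
  + apply: cvg_at_right_filter.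
    by have [/derivable1_diffP/differentiable_continuous] := dF (- pi).
  + apply: cvg_at_left_filter.
    by have [/derivable1_diffP/differentiable_continuous] := dF pi.
- by move=> x _; rewrite derive1E; have [_] := dF x.
Qed.

Lemma Rintegral_sin (j : R) : Rintegral leb circ (fun x => sin (j * x)) = 0.
Proof.
have [->|j0] := eqVneq j 0.
  by under eq_Rintegral do rewrite mul0r sin0; rewrite Rintegral_cst_circ mul0r.
have dF x : is_derive x 1 (fun x => - j^-1 * cos (j * x)) (sin (j * x)).
  have h : is_derive x 1 (fun y => j * y) j.
    by apply: is_derive_eq; rewrite ?scaler0 ?addr0 /GRing.scale/= ?mulr1 ?add0r.
  have hs : is_derive (j * x) 1 (@cos R) (- sin (j * x)) by exact: is_derive_cos.
  apply: (is_derive_eq (@is_deriveZ R R _ _ (- j^-1) _ _ _ (is_derive1_comp hs h))).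
  by rewrite /GRing.scale/=; field.
rewrite /Rintegral (@continuous_FTC2 _ (fun x => sin (j * x)) (fun x => - j^-1 * cos (j * x))).
- by rewrite mulrN cosN subee.
- exact: pi_lt.
- apply: continuous_subspaceT => x.
  apply: (@continuous_comp _ _ _ (fun x => j * x) sin); last exact: continuous_sin.
  exact: mulrl_continuous.
- split.
  + by move=> x _; have [] := dF x.
  + apply: cvg_at_right_filter.
    by have [/derivable1_diffP/differentiable_continuous] := dF (- pi).
  + apply: cvg_at_left_filter.
    by have [/derivable1_diffP/differentiable_continuous] := dF pi.
- by move=> x _; rewrite derive1E; have [_] := dF x.
Qed.

Lemma sin_natpi n : sin (n%:R * pi) = 0 :> R.
Proof.
elim: n => [|n IH]; first by rewrite mul0r sin0.
by rewrite -natr1 mulrDl mul1r sinD IH sinpi mul0r mulr0 addr0.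
Qed.

Lemma sin_intpi (j : int) : sin (j%:~R * pi) = 0 :> R.
Proof.
case: j => n; first exact: sin_natpi.
by rewrite NegzE intrN mulNr sinN sin_natpi oppr0.
Qed.

Lemma cintegrable_bounded F k : mcirc F -> (forall x, abs2 (F x) <= k) ->
  cintegrable leb circ F.
Proof.
move=> mF h; have k0 : 0 <= k by apply: le_trans (h 0); exact: abs2_ge0.
have [s [s0 hs]] : exists s, 0 <= s /\ forall x, abs2 (F x) <= s ^+ 2.
  by exists (Num.sqrt k); split => // x; rewrite sqr_sqrtr.
apply: (cintegrable_dom measurable_circ mF _ (integrable_cst_circ s)) => x _.
by split; [apply: normRe_le|apply: normIm_le].
Qed.

Lemma cintegral_E j : cintegral leb circ (E j) = if j == 0 then (2 * pi)%:C%C else 0.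
Proof.
apply: complex_ext; rewrite /cintegral /=; last first.
  by rewrite Rintegral_sin; case: ifP.
case: ifPn => [/eqP ->|j0] /=.
  by under eq_Rintegral do rewrite mul0r cos0; rewrite Rintegral_cst_circ mul1r.
by apply: Rintegral_cos; rewrite ?intr_eq0//; exact: sin_intpi.
Qed.

Lemma cintegrable_E j : cintegrable leb circ (E j).
Proof. by apply: (@cintegrable_bounded _ 1) => [|x]; [exact: cmeasurable_E|rewrite abs2_E]. Qed.

Lemma cintegral_pe P : cintegral leb circ (pe P) = (2 * pi)%:C%C * P`_0.
Proof.
have -> : pe P = fun x => \sum_(k < size P) P`_k * E k%:Z x.
  by apply/funext => x; exact: peE.
have [_ ->] := @cintegral_sum _ _ _ leb circ measurable_circ (size P)
   (fun (k : nat) x => P`_k * E k%:Z x)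
   (fun k => cintegrableZ measurable_circ _ (cintegrable_E k)).
under eq_bigr => k _ do rewrite (cintegralZ measurable_circ _ (cintegrable_E k)) cintegral_E.
case: (size P) (@nth_default _ 0 P 0) => [h|n _].
  by rewrite big_ord0 h ?mulr0.
rewrite big_ord_recl /= big1 ?addr0 1?mulrC// => k _.
by rewrite mulr0.
Qed.

Lemma cintegrable_pe P : cintegrable leb circ (pe P).
Proof.
by have [k [_ hk]] := pe_bounded P; apply: (cintegrable_bounded _ hk); exact: cmeasurable_pe.
Qed.

Lemma peD P Q : pe (P + Q) = pe P + pe Q.
Proof. by apply/funext => x; rewrite /pe hornerD. Qed.
Lemma peN P : pe (- P) = - pe P.
Proof. by apply/funext => x; rewrite /pe hornerN. Qed.
Lemma peB P Q : pe (P - Q) = pe P - pe Q.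
Proof. by rewrite peD peN. Qed.
Lemma peM P Q x : pe (P * Q) x = pe P x * pe Q x.
Proof. by rewrite /pe hornerM. Qed.

(* [P ^ 2] has mean value [P`_0 ^ 2], whose real part is nonnegative. *)
Lemma pe_conjugate_bound P : Im P`_0 = 0 ->
  n2 leb circ (fun=> 1) (pe P) <=
  2 * Rintegral leb circ (fun x => (Re (pe P x)) ^+ 2).
Proof.
move=> P0.
have [k [k0 hk]] := pe_bounded P.
have mP := cmeasurable_pe P circ.
have iR2 : leb.-integrable circ (EFin \o (fun x => (Re (pe P x)) ^+ 2)).
  apply: (rintegrable_dom measurable_circ _ _ (integrable_cst_circ k)).
    by apply: measurable_funX; case: mP.
  by move=> x _; rewrite ger0_norm ?sqr_ge0//; apply: le_trans (hk x); exact: sqr_Re_le.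
have [iPP _] := cintegrable_pe (P * P).
have : 0 <= Rintegral leb circ (fun x => Re (pe (P * P) x)).
  have := cintegral_pe (P * P) => /(congr1 (@complex.Re R)) /= ->.
  rewrite coef0M ReImE /= mul0r subr0 mulr_ge0//.
    by rewrite mulr_ge0 ?pi_ge0.
  by rewrite ReImE P0 mulr0 subr0 -expr2 sqr_ge0.
have -> : n2 leb circ (fun=> 1) (pe P) = 2 * Rintegral leb circ (fun x => (Re (pe P x)) ^+ 2)
      - Rintegral leb circ (fun x => Re (pe (P * P) x)).
  rewrite -RintegralZl//; last exact: measurable_circ.
  rewrite -RintegralB//; [|exact: measurable_circ|apply: rintegrableZ => //; exact: measurable_circ].
  by apply: eq_Rintegral => x _; rewrite peM ReImE /abs2; ring.
by move=> h; rewrite lerBlDr lerDl.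
Qed.

End Circle.

(** * Fejer means *)

Section Fejer.
Context {R : realType}.
Implicit Types (x y t : R) (P : {poly R[i]}) (g : R -> R).
Local Notation leb := (@lebesgue_measure R).
Let mC := @measurable_circ R.

(** Convolution with [kap] produces real parts of analytic polynomials. This is closed under sums
    and real multiples, which reduces the Fejer kernel to single cosines. *)
Definition trig_kernel (kap : R -> R) : Prop := forall g,
  leb.-integrable circ (EFin \o g) ->
  (forall x, leb.-integrable circ (EFin \o (fun y => kap (x - y) * g y))) /\
  exists P, forall x, Rintegral leb circ (fun y => kap (x - y) * g y) = Re (pe P x).

Lemma trig_kernel0 : trig_kernel (fun=> 0).
Proof.
move=> g ig; split=> [x|].
  by apply: (rintegrable_ext mC _ (integrable_cst_circ 0)) => y _; rewrite mul0r.
exists 0 => x; rewrite /pe horner0 /=.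
by under eq_Rintegral do rewrite mul0r; rewrite Rintegral_cst_circ mul0r.
Qed.

Lemma trig_kernelD k1 k2 : trig_kernel k1 -> trig_kernel k2 ->
  trig_kernel (fun t => k1 t + k2 t).
Proof.
move=> h1 h2 g ig; have [i1 [P1 e1]] := h1 g ig; have [i2 [P2 e2]] := h2 g ig.
split=> [x|].
  by apply: (rintegrable_ext mC _ (rintegrableD mC (i1 x) (i2 x))) => y _; rewrite mulrDl.
exists (P1 + P2) => x; rewrite peD -[(pe P1 + pe P2) x]/(pe P1 x + pe P2 x) ReImE -e1 -e2.
by under eq_Rintegral do rewrite mulrDl; rewrite RintegralD.
Qed.

Lemma trig_kernelZ (r : R) k1 : trig_kernel k1 -> trig_kernel (fun t => r * k1 t).
Proof.
move=> h1 g ig; have [i1 [P1 e1]] := h1 g ig.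
split=> [x|].
  by apply: (rintegrable_ext mC _ (rintegrableZ mC r (i1 x))) => y _; rewrite mulrA.
exists (r%:C%C *: P1) => x; rewrite /pe hornerZ ReImE /= mul0r subr0 -[P1.[_]]/(pe P1 x) -e1.
by under eq_Rintegral do rewrite -mulrA; rewrite RintegralZl.
Qed.

Lemma integrable_trigM (p : R -> R) g : leb.-integrable circ (EFin \o g) ->
  measurable_fun (circ : set (measurableTypeR R)) p -> (forall y, `|p y| <= 1) ->
  leb.-integrable circ (EFin \o (fun y => p y * g y)).
Proof.
move=> ig mp p1; apply: (rintegrable_dom mC _ _ (integrable_norm ig)).
  by apply: measurable_funM => //; exact: rintegrable_meas ig.
by move=> y _ /=; rewrite normrM ler_piMl.
Qed.

Lemma measurable_scale (m : R) (D : set (measurableTypeR R)) :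
  measurable_fun D (fun y : measurableTypeR R => m * y).
Proof. by apply: measurable_funM => //; exact: measurable_cst. Qed.

Lemma trig_kernel_cos (m : nat) : trig_kernel (fun t => cos (m%:R * t)).
Proof.
move=> g ig.
have mm : measurable_fun (circ : set (measurableTypeR R)) (fun y : measurableTypeR R => m%:R * y).
  exact: measurable_scale.
have ic : leb.-integrable circ (EFin \o (fun y => cos (m%:R * y) * g y)).
  apply: integrable_trigM => // [|y]; last exact: cos_max.
  exact: (measurableT_comp (f := @cos R) (@measurable_cos R setT) mm).
have is_ : leb.-integrable circ (EFin \o (fun y => sin (m%:R * y) * g y)).
  apply: integrable_trigM => // [|y]; last exact: sin_max.
  exact: (measurableT_comp (f := @sin R) (@measurable_sin R setT) mm).
have eq1 x y : cos (m%:R * (x - y)) * g y =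
    cos (m%:R * x) * (cos (m%:R * y) * g y) + sin (m%:R * x) * (sin (m%:R * y) * g y).
  by rewrite mulrBr cosB; ring.
split=> [x|].
  by apply: (rintegrable_ext mC _ (rintegrableD mC (rintegrableZ mC (cos (m%:R * x)) ic)
      (rintegrableZ mC (sin (m%:R * x)) is_))) => y _; rewrite eq1.
(* [Re ((p - i q) e^{imx}) = p cos mx + q sin mx]. *)
exists ((Rintegral leb circ (fun y => cos (m%:R * y) * g y) +i*
     - Rintegral leb circ (fun y => sin (m%:R * y) * g y))%C *: 'X^m) => x.
rewrite /pe hornerZ hornerXn expiX ReImE /=.
under eq_Rintegral do rewrite eq1.
rewrite RintegralD ?RintegralZl//; [ring|exact: (rintegrableZ mC)|exact: (rintegrableZ mC)].
Qed.

Lemma trig_kernel_sum n (k : 'I_n -> R -> R) : (forall i, trig_kernel (k i)) ->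
  trig_kernel (fun t => \sum_(i < n) k i t).
Proof.
move=> h; rewrite (_ : (fun t => _) = \sum_(i < n) k i); last by apply/funext => t; rewrite fct_sumE.
elim/big_ind : _ => //; first exact: trig_kernel0.
by move=> k1 k2; exact: trig_kernelD.
Qed.

(** The square shows nonnegativity at once; the cosine expansion [fejerE] is what makes it a
    [trig_kernel]. *)
Definition fejer n t : R := n%:R^-1 * abs2 (\sum_(j < n) expi (j%:R * t)).

Lemma cos_int (j : int) t : cos (j%:~R * t) = cos (`|j|%N%:R * t).
Proof. by case: j => n //; rewrite NegzE intrN mulNr cosN abszN. Qed.

Lemma fejerE n t : fejer n t =
  n%:R^-1 * \sum_(j < n) \sum_(k < n) cos ((`|j%:Z - k%:Z|%N)%:R * t).
Proof.
rewrite /fejer; congr (_ * _).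
have -> (z : R[i]) : abs2 z = Re (z * z^*%C) by rewrite mulJ.
rewrite conj_sum mulr_suml Re_sum; apply: eq_bigr => j _.
rewrite mulr_sumr Re_sum; apply: eq_bigr => k _.
by rewrite -cos_int expi_conj -expiD intrD intrN mulrDl mulNr.
Qed.

Lemma fejer_ge0 n t : 0 <= fejer n t.
Proof. by rewrite mulr_ge0 ?invr_ge0 ?abs2_ge0. Qed.

Lemma trig_kernel_fejer n : trig_kernel (fejer n).
Proof.
rewrite (_ : fejer n = fun t => n%:R^-1 * \sum_(j < n) \sum_(k < n) cos ((`|j%:Z - k%:Z|%N)%:R * t)).
  apply: trig_kernelZ.
  apply: (trig_kernel_sum (k := fun (j : 'I_n) t => \sum_(k < n) cos ((`|j%:Z - k%:Z|%N)%:R * t))) => j.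
  apply: (trig_kernel_sum (k := fun (k : 'I_n) t => cos ((`|j%:Z - k%:Z|%N)%:R * t))) => k.
  exact: trig_kernel_cos.
by apply/funext => t; exact: fejerE.
Qed.

(** Only the diagonal of the double sum survives integration in [y]: [n] terms, each equal to
    [2 pi / n]. *)
Lemma fejer_mass n x : (0 < n)%N -> Rintegral leb circ (fun y => fejer n (x - y)) = 2 * pi.
Proof.
move=> n0.
have E1 : (fun y => fejer n (x - y)) =
    fun y => Re (\sum_(j < n) \sum_(k < n) n%:R^-1%:C%C * (E (j%:Z - k%:Z) x * E (k%:Z - j%:Z) y)).
  apply/funext => y; rewrite fejerE Re_sum mulr_sumr; apply: eq_bigr => j _.
  rewrite Re_sum mulr_sumr; apply: eq_bigr => k _.
  rewrite cReM -[Re _%:C%C]/(n%:R^-1) -[Im _%:C%C]/(0 : R) mul0r subr0 -cos_int.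
  by rewrite /E -expiD -(opprB j%:Z) intrN mulNr -mulrBr.
rewrite E1.
have c1 (j k : nat) : cintegrable leb circ
    (fun y => n%:R^-1%:C%C * (E (j%:Z - k%:Z) x * E (k%:Z - j%:Z) y)).
  by do 2 apply: (cintegrableZ mC); exact: cintegrable_E.
have [c2 e2] : (forall j : nat, cintegrable leb circ
   (fun y => \sum_(k < n) n%:R^-1%:C%C * (E (j%:Z - k%:Z) x * E (k%:Z - j%:Z) y))) /\
   (forall j : nat, cintegral leb circ
   (fun y => \sum_(k < n) n%:R^-1%:C%C * (E (j%:Z - k%:Z) x * E (k%:Z - j%:Z) y)) =
   \sum_(k < n) n%:R^-1%:C%C * (E (j%:Z - k%:Z) x * (if k%:Z - j%:Z == 0 then (2 * pi)%:C%C else 0))).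
  split=> j; have [a b] := cintegral_sum mC n (c1 j); first exact: a.
  rewrite b; apply: eq_bigr => k _.
  by rewrite !(cintegralZ mC) ?cintegral_E//; do ?apply: (cintegrableZ mC); exact: cintegrable_E.
have [_ e3] := cintegral_sum mC n c2.
transitivity (Re (\sum_(j < n) ((n%:R^-1 * (2 * pi))%:C%C : R[i]))).
  rewrite -[LHS]/(Re (cintegral leb circ (fun y => \sum_(j < n) \sum_(k < n)
    n%:R^-1%:C%C * (E (j%:Z - k%:Z) x * E (k%:Z - j%:Z) y)))) e3; congr (Re _).
  apply: eq_bigr => j _; rewrite e2 (bigD1 j)//= big1 ?addr0.
    by rewrite subrr eqxx E0 mul1r -rmorphM.
  move=> k kj; rewrite ifF ?mulr0//; apply/negbTE.
  by rewrite subr_eq0; apply: contra kj => /eqP[/ord_inj ->].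
rewrite Re_sum sumr_const card_ord /= -[_ *+ n]mulr_natl mulrA divff ?mul1r//.
by rewrite pnatr_eq0 -lt0n.
Qed.

(** Summing the geometric progression, the Dirichlet sum times [e^{it} - 1] is [e^{int} - 1], of
    squared modulus at most 4, while [|e^{it} - 1|^2 = 2 (1 - cos t)]. This moment replaces an
    estimate of the kernel away from the origin. *)
Lemma fejer_moment n t : (0 < n)%N -> fejer n t * (1 - cos t) <= 2 / n%:R.
Proof.
move=> n0; have nn : 0 < n%:R :> R by rewrite ltr0n.
have z1 : abs2 (expi t - 1) = 2 * (1 - cos t).
  by rewrite /abs2 !ReImE /= subr0; have := cos2Dsin2 t; lra.
have z2 : abs2 (expi t ^+ n - 1) <= 4.
  apply: le_trans (abs2D_le _ _) _.
  by rewrite abs2N expiX abs2_expi (abs2_real 1) expr1n; lra.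
have e : \sum_(j < n) expi (j%:R * t) = \sum_(j < n) (expi t) ^+ j.
  by apply: eq_bigr => j _; rewrite expiX.
have h : abs2 (\sum_(j < n) expi t ^+ j) * (2 * (1 - cos t)) <= 4.
  by rewrite -z1 -abs2M mulrC -subrX1.
rewrite /fejer e -mulrA [2 / _]mulrC ler_pM2l ?invr_gt0//.
by move: h; rewrite mulrCA; lra.
Qed.

Definition fejer_mean n g x : R :=
  (2 * pi)^-1 * Rintegral leb circ (fun y => fejer n (x - y) * g y).

Let twopi_gt0 : 0 < 2 * pi :> R.
Proof. by rewrite mulr_gt0 ?pi_gt0. Qed.

Lemma fejer_mean_trig n g : leb.-integrable circ (EFin \o g) ->
  exists P, forall x, fejer_mean n g x = Re (pe P x).
Proof.
move=> ig; have [_ [P eP]] := trig_kernel_fejer n ig.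
exists ((2 * pi)^-1%:C%C *: P) => x.
by rewrite /fejer_mean eP /pe hornerZ cReM /= mul0r subr0.
Qed.

Lemma integrable_fejer n g x : leb.-integrable circ (EFin \o g) ->
  leb.-integrable circ (EFin \o (fun y => fejer n (x - y) * g y)).
Proof. by move=> ig; have [] := trig_kernel_fejer n ig. Qed.

Lemma integrable_fejer1 n x :
  leb.-integrable circ (EFin \o (fun y => fejer n (x - y))).
Proof.
by apply: (rintegrable_ext mC _ (integrable_fejer n x (integrable_cst_circ 1))) => y _;
  rewrite mulr1.
Qed.

Lemma fejer_mean_ge0 n g x : (forall y, circ y -> 0 <= g y) -> 0 <= fejer_mean n g x.
Proof.
move=> g0; rewrite mulr_ge0 ?invr_ge0 ?(ltW twopi_gt0)//.
by apply: Rintegral_ge0 => y Dy; rewrite mulr_ge0 ?fejer_ge0 ?g0.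
Qed.

Lemma fejer_mean_le n g x k : (0 < n)%N -> leb.-integrable circ (EFin \o g) ->
  (forall y, circ y -> g y <= k) -> fejer_mean n g x <= k.
Proof.
move=> n0 ig gk; rewrite /fejer_mean mulrC ler_pdivrMr// -(fejer_mass x n0) -RintegralZl//;
  last exact: integrable_fejer1.
apply: le_Rintegral => //; first exact: integrable_fejer.
  exact: (rintegrableZ mC k (integrable_fejer1 n x)).
by move=> y Dy; rewrite mulrC ler_wpM2r ?fejer_ge0 ?gk.
Qed.

Lemma cos_gap (d u : R) : 0 < d <= pi -> d <= u <= 2 * pi - d -> cos u <= cos d.
Proof.
move=> /andP[d0 dpi] /andP[du ud].
have H (s : R) : d <= s -> s <= pi -> cos s <= cos d.
  move=> ds sp; rewrite leNgt; apply/negP => h.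
  have := @ltr_cos R s d; rewrite !in_itv /= (ltW d0) dpi (le_trans (ltW d0) ds) sp.
  by rewrite h => /(_ isT isT)/esym; rewrite ltNge ds.
have [up|up] := leP u pi; first exact: H.
rewrite (_ : cos u = cos (2 * pi - u)); first by apply: H; lra.
by rewrite -[RHS]cosN opprB -(cosD2pi (u - 2 * pi)) mulr2n; congr cos; ring.
Qed.

(** A modulus of continuity of Korovkin type: continuity handles [y] near [x], and elsewhere
    [1 - cos (x - y)] is bounded below, so that a multiple of it dominates the oscillation.
    Integrated against the kernel, the mass gives [eta] and [fejer_moment] makes the rest [O(1/n)].
    The endpoints are excluded because [g] need not be periodic. *)
Lemma modulus_cos g M x : continuous g -> (forall y, 0 <= g y <= M) ->
  x \in `]- pi, pi[ -> forall eta : R, 0 < eta -> exists C, 0 <= C /\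
  forall y, circ y -> `|g y - g x| <= eta + C * (1 - cos (x - y)).
Proof.
move=> cg gM; rewrite in_itv /= => /andP[x1 x2] eta eta0.
have /cvgrPdist_lt/(_ _ eta0)[/= d d0 hd] := cg x.
(* The second bound keeps [|x - y| <= 2 pi - d'] for every [y] in [circ], so that [x] and [y] stay
   apart on the circle as well, as [cos_gap] requires. *)
pose d' := Num.min d (pi - `|x|).
have xpi : `|x| < pi by rewrite ltr_norml x1 x2.
have d'0 : 0 < d' by rewrite lt_min d0 subr_gt0.
have d'd : d' <= d by rewrite ge_min lexx.
have d'x : d' <= pi - `|x| by rewrite ge_min lexx orbT.
have d'pi : d' <= pi by apply: le_trans d'x _; rewrite gerBl.
have cd : cos d' < 1.
  have := @ltr_cos R 0 d'; rewrite !in_itv /= (ltW d'0) d'pi lexx pi_ge0 => /(_ isT isT).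
  by rewrite cos0 => ->.
have M0 : 0 <= M by have /andP[] := gM 0; apply: le_trans.
have C0 : 0 <= M / (1 - cos d') by rewrite divr_ge0// subr_ge0 ltW.
exists (M / (1 - cos d')); split => // y; rewrite /circ /= in_itv /= => /andP[y1 y2].
have [yx|yx] := ltP `|x - y| d.
  have := hd y yx; rewrite distrC => /ltW h; apply: le_trans h _.
  by rewrite lerDl mulr_ge0// subr_ge0 cos_le1.
have gyM : `|g y - g x| <= M.
  by rewrite ler_norml; have /andP[a b] := gM y; have /andP[c e] := gM x; apply/andP; split; lra.
apply: (le_trans gyM); apply: (@le_trans _ _ (M / (1 - cos d') * (1 - cos (x - y)))); last first.
  by rewrite lerDr ltW.
rewrite -mulrA ler_peMr// ler_pdivlMl ?subr_gt0// mulr1 lerB//.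
rewrite -(cos_norm (x - y)); apply: cos_gap; first by rewrite d'0.
rewrite (le_trans d'd yx) /=.
have := ler_normB x y; have : `|y| <= pi by rewrite ler_norml y1 y2.
lra.
Qed.

Lemma fejer_mean_cvg g M x : continuous g -> (forall y, 0 <= g y <= M) ->
  leb.-integrable circ (EFin \o g) -> x \in `]- pi, pi[ ->
  fejer_mean n.+1 g x @[n --> \oo] --> g x.
Proof.
move=> cg gM ig xI; apply/cvgrPdist_le => e e0.
have e2 : 0 < e / 2 by rewrite divr_gt0.
have [C [C0 hC]] := modulus_cos cg gM xI e2.
have key n : `|g x - fejer_mean n.+1 g x| <= e / 2 + 2 * C * harmonic n.
  have -> : g x = (2 * pi)^-1 * Rintegral leb circ (fun y => g x * fejer n.+1 (x - y)).
    rewrite RintegralZl//; last exact: integrable_fejer1.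
    by rewrite fejer_mass// mulrCA mulVf ?mulr1 ?gt_eqF.
  have i1 := rintegrableZ mC (g x) (integrable_fejer1 n.+1 x).
  have i2 := integrable_fejer n.+1 x ig.
  rewrite /fejer_mean -mulrBr -RintegralB// normrM gtr0_norm ?invr_gt0//.
  rewrite mulrC ler_pdivrMr//.
  apply: le_trans (le_normr_Rintegral mC (rintegrableB mC i1 i2)) _.
  have i3 := rintegrableD mC (rintegrableZ mC (e / 2) (integrable_fejer1 n.+1 x))
    (integrable_cst_circ (2 * C * harmonic n)).
  apply: (@le_trans _ _ (Rintegral leb circ (fun y => e / 2 * fejer n.+1 (x - y) + 2 * C * harmonic n))).
    apply: le_Rintegral => //; first exact: integrable_norm (rintegrableB mC i1 i2).
    move=> y Dy; rewrite mulrC -mulrBr normrM (ger0_norm (fejer_ge0 _ _)) distrC.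
    apply: le_trans (ler_wpM2l (fejer_ge0 _ _) (hC y Dy)) _.
    rewrite mulrDr [X in X + _]mulrC lerD2l mulrCA.
    have := fejer_moment (x - y) (ltn0Sn n) => h.
    apply: le_trans (ler_wpM2l C0 h) _.
    by rewrite le_eqVlt; apply/orP; left; apply/eqP; rewrite /harmonic /=; ring.
  rewrite RintegralD//; [|exact: (rintegrableZ mC (e / 2) (integrable_fejer1 n.+1 x))|exact: integrable_cst_circ].
  rewrite RintegralZl//; last exact: integrable_fejer1.
  by rewrite fejer_mass// Rintegral_cst_circ -mulrDl.
have /cvgrPdist_lt ch : (fun n => 2 * C * harmonic n) @ \oo --> (0 : R).
  by rewrite -(mulr0 (2 * C)); apply: cvgM; [exact: cvg_cst|exact: cvg_harmonic].
have [N _ hN] := ch _ e2; exists N => // n Nn.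
have h : `|0 - 2 * C * harmonic n| < e / 2 := hN n Nn.
move: h (key n); rewrite sub0r normrN; set t := 2 * C * harmonic n => h k.
apply: le_trans k _; have := ler_norm t; lra.
Qed.

End Fejer.

(** * Approximation in [L_2] by nonnegative trigonometric polynomials *)

Lemma small_triangle2 {R : realType} (s a b c d e : R) :
  0 < e -> s <= 2 * a + 2 * b -> b <= 2 * c + 2 * d ->
  a < e / 16 -> c < e / 16 -> d < e / 16 -> s < e.
Proof. by move=> h0 h1 h2 h3 h4 h5; lra. Qed.

Section Density.
Context {R : realType}.
Implicit Types (x y : R) (P : {poly R[i]}) (g v : R -> R).
Local Notation leb := (@lebesgue_measure R).
Local Notation L1 := (L2 leb circ (fun=> 1)).
Local Notation N1 := (n2 leb circ (fun=> 1)).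
Let mC := @measurable_circ R.
Let ww1 := @weight1 R.
Let iw1 := @integrable_cst_circ R 1.

Definition rc v : R -> R[i] := fun x => (v x)%:C%C.

Lemma L2_rc v : measurable_fun (circ : set (measurableTypeR R)) v ->
  leb.-integrable circ (EFin \o (fun x => v x ^+ 2)) -> L1 (rc v).
Proof.
move=> mv iv; split; first exact: cmeasurable_real.
by apply: (rintegrable_ext mC _ iv) => x _; rewrite abs2_real mulr1.
Qed.

Lemma L2_rc_bounded v k : measurable_fun (circ : set (measurableTypeR R)) v ->
  (forall x, circ x -> `|v x| <= k) -> L1 (rc v).
Proof.
move=> mv vk.
have mF : cmeasurable_fun (circ : set (measurableTypeR R)) (rc v) by exact: cmeasurable_real.
have hF x : circ x -> abs2 (rc v x) <= k ^+ 2.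
  move=> Dx; rewrite abs2_real -real_normK ?num_real// ler_sqr ?nnegrE ?vk//.
  by apply: le_trans (vk x Dx).
by have [] := L2_bounded mC ww1 iw1 mF hF.
Qed.

Lemma ae_interior : {ae leb, forall x, circ x -> x \in `]- pi, pi[}.
Proof.
have ng (r : R) : leb.-negligible [set r].
  by apply/negligibleP; [exact: measurable_set1|exact: lebesgue_measure_set1].
apply: (negligibleS _ (negligibleU (ng (- pi)) (ng pi))).
move=> x /= /not_implyP[]; rewrite /circ /= in_itv /= => /andP[a b] h.
have [->|xl] := eqVneq x (- pi); first by left.
have [->|xr] := eqVneq x pi; first by right.
by exfalso; apply: h; rewrite in_itv /= !lt_def a b xl eq_sym xr.
Qed.

Lemma ccvg_rc (p : nat -> R) (r : R) : p n @[n --> \oo] --> r ->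
  ccvg (fun n => (p n)%:C%C) (r%:C%C).
Proof. by move=> h; split => //=; exact: cvg_cst. Qed.

Lemma eventually_small (u : nat -> R) (e : R) : 0 < e -> u n @[n --> \oo] --> (0 : R) ->
  exists n, u n < e.
Proof.
move=> e0 /cvgrPdist_lt/(_ _ e0)[N _ h]; exists N.
by have := h N (leqnn N); rewrite /= sub0r normrN; apply: le_lt_trans (ler_norm _).
Qed.

Lemma truncation v e : measurable_fun (circ : set (measurableTypeR R)) v ->
  (forall x, circ x -> 0 <= v x) ->
  leb.-integrable circ (EFin \o (fun x => v x ^+ 2)) -> 0 < e ->
  exists n : nat, N1 (rc (fun x => Num.min (v x) n%:R) - rc v) < e.
Proof.
move=> mv v0 iv e0; apply: eventually_small => //.
have mm n : measurable_fun (circ : set (measurableTypeR R)) (fun x => Num.min (v x) n%:R).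
  by apply: measurable_minr => //; exact: measurable_cst.
apply: (n2_dominated mC ww1 _ _ iv) => //.
- by move=> n; apply: cmeasurable_real; exact: mm.
- move=> n x Dx; rewrite mulr1 -rmorphB abs2_real.
  have vx := v0 x Dx; have n0 : 0 <= n%:R :> R by [].
  by rewrite minElt; case: ifP => h; nra.
- apply: aeW => x Dx; apply: ccvg_rc; apply: cvg_near_cst.
  exists (Num.truncn (v x)).+1 => // n /= hn.
  rewrite min_l//; apply: ltW; apply: lt_le_trans (Num.Theory.truncnS_gt _) _.
  by rewrite ler_nat.
Qed.

(** The approximation is available in [L_1]; between functions with values in [[0, k]] it passes to
    [L_2], since [(g - v)^2 <= k |g - v|]. *)
Lemma continuous_dense v k e : measurable_fun (circ : set (measurableTypeR R)) v ->
  (forall x, circ x -> 0 <= v x <= k) -> 0 <= k -> 0 < e ->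
  exists g, [/\ continuous g, forall x, 0 <= g x <= k & N1 (rc g - rc v) < e].
Proof.
move=> mv vk k0 e0.
have iv : leb.-integrable circ (EFin \o v).
  apply: (rintegrable_dom mC mv _ (integrable_cst_circ k)) => x /vk/andP[a b].
  by rewrite ger0_norm.
have lc : (leb circ < +oo)%E by rewrite leb_circ ltry.
have [gn [cgn ign /fine_cvgP[_ hgn]]] := approximation_continuous_integrable mC lc iv.
have k1 : 0 < e / (k + 1) by rewrite divr_gt0// ltr_wpDl.
have [n hn] := eventually_small k1 hgn.
(* Clamping to [[0, k]], where [v] takes its values, does not increase the distance to [v]. *)
pose g x := Num.max 0 (Num.min (gn n x) k).
have cg : continuous g.
  move=> x; apply: (@continuous_max _ _ (fun=> 0) (fun x => Num.min (gn n x) k)).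
    exact: cst_continuous.
  by apply: (@continuous_min _ _ (gn n) (fun=> k)); [exact: cgn|exact: cst_continuous].
have gk x : 0 <= g x <= k.
  by rewrite /g le_max lexx /= ge_max k0 /= ge_min lexx orbT.
exists g; split => //.
have mg : measurable_fun (circ : set (measurableTypeR R)) g.
  by apply: measurable_funTS; exact: continuous_measurable_fun.
have idf : leb.-integrable circ (EFin \o (fun x => `|v x - gn n x|)).
  by apply: (integrable_norm (rintegrableB mC iv (ign n))).
have -> : N1 (rc g - rc v) = Rintegral leb circ (fun x => (g x - v x) ^+ 2).
  by apply: eq_Rintegral => x _; rewrite mulr1 -[(rc g - rc v) x]/(rc g x - rc v x) -rmorphB abs2_real.
apply: (@le_lt_trans _ _ (k * Rintegral leb circ (fun x => `|v x - gn n x|))); last first.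
  have h0 : 0 <= Rintegral leb circ (fun x => `|v x - gn n x|).
    by apply: Rintegral_ge0 => x _.
  move: hn; rewrite /= -/(Rintegral leb circ (fun x => `|v x - gn n x|)).
  rewrite ltr_pdivlMr ?ltr_wpDl//.
  set J := Rintegral _ _ _ in h0 * => h; nra.
rewrite -RintegralZl//; apply: le_Rintegral => //.
- apply: (rintegrable_dom mC _ _ (integrable_cst_circ (k ^+ 2))).
    by apply: measurable_funX; exact: measurable_funB.
  move=> x Dx; rewrite ger0_norm ?sqr_ge0//.
  by have /andP[a b] := gk x; have /andP[a' b'] := vk x Dx; nra.
- exact: rintegrableZ.
move=> x Dx; have /andP[a b] := gk x; have /andP[a' b'] := vk x Dx.
rewrite -real_normK ?num_real// expr2; apply: ler_pM => //.
  by rewrite ler_norml; apply/andP; split; lra.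
rewrite /g; set a0 := gn n x; set b0 := v x in a' b' *.
have [h1|h1] := leP a0 k; last first.
  rewrite max_r// ger0_norm ?subr_ge0// distrC; apply: le_trans (ler_norm _); lra.
have [h2|h2] := leP 0 a0; first by rewrite distrC.
by rewrite sub0r normrN ger0_norm//; apply: le_trans (ler_norm _); lra.
Qed.

(** Truncation, a continuous approximant, then a Fejer mean. All three steps preserve nonnegativity,
    which [annihilated_div] later needs from the polynomials themselves. *)
Lemma trig_dense_ge0 v e : measurable_fun (circ : set (measurableTypeR R)) v ->
  (forall x, circ x -> 0 <= v x) ->
  leb.-integrable circ (EFin \o (fun x => v x ^+ 2)) -> 0 < e ->
  exists P, (forall x, 0 <= Re (pe P x)) /\ N1 (rc (fun x => Re (pe P x)) - rc v) < e.
Proof.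
move=> mv v0 iv e0.
have e4 : 0 < e / 16 by rewrite divr_gt0.
have [m hm] := truncation mv v0 iv e4.
have mm : measurable_fun (circ : set (measurableTypeR R)) (fun x => Num.min (v x) m%:R).
  by apply: measurable_minr => //; exact: measurable_cst.
have mk x : circ x -> 0 <= Num.min (v x) m%:R <= m%:R.
  by move=> Dx; rewrite le_min v0//= ler0n ge_min lexx orbT.
have [g [cg gk hg]] := continuous_dense mm mk (ler0n _ m) e4.
have mg : measurable_fun (circ : set (measurableTypeR R)) g.
  by apply: measurable_funTS; exact: continuous_measurable_fun.
have ig : leb.-integrable circ (EFin \o g).
  apply: (rintegrable_dom mC mg _ (integrable_cst_circ m%:R)) => x _.
  by have /andP[a b] := gk x; rewrite ger0_norm.
have FP n := cid (fejer_mean_trig n ig).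
pose P n := projT1 (FP n.+1).
have PE n x : Re (pe (P n) x) = fejer_mean n.+1 g x by rewrite /P; case: (FP n.+1).
have mP n : measurable_fun (circ : set (measurableTypeR R)) (fun x => Re (pe (P n) x)).
  by have [] := cmeasurable_pe (P n) circ.
have PK n x : 0 <= Re (pe (P n) x) <= m%:R.
  rewrite PE fejer_mean_ge0 ?fejer_mean_le// => y _; by have /andP[] := gk y.
have cP : N1 (rc (fun x => Re (pe (P n) x)) - rc g) @[n --> \oo] --> (0 : R).
  apply: (n2_dominated mC ww1 _ _ (integrable_cst_circ (m%:R ^+ 2))) => //.
  - by move=> n; exact: cmeasurable_real.
  - move=> n x Dx; rewrite mulr1 -rmorphB abs2_real.
    by have /andP[a b] := PK n x; have /andP[a' b'] := gk x; nra.
  - apply: ae_imp ae_interior => x xI Dx; apply: ccvg_rc.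
    under eq_fun do rewrite PE.
    exact: (fejer_mean_cvg cg gk ig (xI Dx)).
have [n hn] := eventually_small e4 cP.
exists (P n); split=> [x|]; first by have /andP[] := PK n x.
have LP : L1 (rc (fun x => Re (pe (P n) x))).
  by apply: (L2_rc_bounded (k := m%:R)) => // x _; have /andP[a b] := PK n x; rewrite ger0_norm.
have Lg : L1 (rc g).
  by apply: (L2_rc_bounded (k := m%:R)) => // x _; have /andP[a b] := gk x; rewrite ger0_norm.
have Lm : L1 (rc (fun x => Num.min (v x) m%:R)).
  by apply: (L2_rc_bounded (k := m%:R)) => // x Dx; have /andP[a b] := mk x Dx; rewrite ger0_norm.
have Lv := L2_rc mv iv.
exact: small_triangle2 e0 (n2_triangle mC ww1 LP Lg Lv) (n2_triangle mC ww1 Lg Lm Lv) hn hg hm.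
Qed.

End Density.

(** * A theorem of Smirnov type *)

Section Density_of_polynomials.
Context {R : realType}.
Implicit Types (x : R) (P Q S : {poly R[i]}) (v : R -> R) (F G : R -> R[i]).
Local Notation leb := (@lebesgue_measure R).
Local Notation L1 := (L2 leb circ (fun=> 1)).
Local Notation N1 := (n2 leb circ (fun=> 1)).
Local Notation C1 := (cip leb circ (fun=> 1)).
Let mC := @measurable_circ R.
Let ww1 := @weight1 R.
Let iw1 := @integrable_cst_circ R 1.

Lemma cRe_inv (z : R[i]) : Re z^-1 = Re z / abs2 z.
Proof. by case: z. Qed.
Lemma cIm_inv (z : R[i]) : Im z^-1 = - (Im z / abs2 z).
Proof. by case: z. Qed.

Lemma cmeasurableV F : mcirc F -> mcirc (fun x => (F x)^-1).
Proof.
move=> mF; have [a b] := mF; have mV := measurable_funV (cmeasurable_abs2 mF).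
split; [under eq_fun do rewrite cRe_inv|under eq_fun do rewrite cIm_inv].
  exact: measurable_funM.
by apply: measurable_funN; exact: measurable_funM.
Qed.

Lemma trig_dense_real v e : measurable_fun (circ : set (measurableTypeR R)) v ->
  leb.-integrable circ (EFin \o (fun x => v x ^+ 2)) -> 0 < e ->
  exists P, N1 (rc (fun x => Re (pe P x)) - rc v) < e.
Proof.
move=> mv iv e0; have e4 : 0 < e / 4 by rewrite divr_gt0.
pose vp x := Num.max (v x) 0; pose vm x := Num.max (- v x) 0.
have mp : measurable_fun (circ : set (measurableTypeR R)) vp.
  by apply: measurable_maxr => //; exact: measurable_cst.
have mm : measurable_fun (circ : set (measurableTypeR R)) vm.
  by apply: measurable_maxr; [exact: measurable_funN|exact: measurable_cst].
have ip : leb.-integrable circ (EFin \o (fun x => vp x ^+ 2)).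
  apply: (rintegrable_dom mC _ _ iv); first exact: measurable_funX.
  by move=> x _; rewrite ger0_norm ?sqr_ge0// /vp maxEle; case: ifP => // _; rewrite expr0n sqr_ge0.
have im : leb.-integrable circ (EFin \o (fun x => vm x ^+ 2)).
  apply: (rintegrable_dom mC _ _ iv); first exact: measurable_funX.
  move=> x _; rewrite ger0_norm ?sqr_ge0// /vm maxEle; case: ifP => // _; rewrite ?sqrrN//.
  by rewrite expr0n sqr_ge0.
have vE x : v x = vp x - vm x.
  by rewrite /vp /vm !maxEle; case: ifP => [h1|/negbT]; case: ifP => [h2|/negbT]; rewrite -?ltNge; lra.
have [P1 [_ h1]] := trig_dense_ge0 mp (fun x _ => ltac:(by rewrite /vp le_max lexx orbT)) ip e4.
have [P2 [_ h2]] := trig_dense_ge0 mm (fun x _ => ltac:(by rewrite /vm le_max lexx orbT)) im e4.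
exists (P1 - P2).
pose A := rc (fun x => Re (pe P1 x)) - rc vp.
pose B := rc (fun x => Re (pe P2 x)) - rc vm.
have LP P : L1 (rc (fun x => Re (pe P x))).
  have [k [k0 hk]] := pe_bounded P.
  apply: (L2_rc_bounded (k := Num.sqrt k)); first by have [] := cmeasurable_pe P circ.
  by move=> x _; apply: normRe_le; rewrite ?sqrtr_ge0// sqr_sqrtr.
have LA : L1 A by apply: (L2B mC ww1) => //; exact: L2_rc.
have LB : L1 B by apply: (L2B mC ww1) => //; exact: L2_rc.
have -> : rc (fun x => Re (pe (P1 - P2) x)) - rc v = A - B.
  apply/funext => x; apply: complex_ext => /=; last by rewrite !subr0 ?subrr.
  by rewrite peB /= !ReImE vE; ring.
apply: le_lt_trans (n2D_le mC ww1 LA (L2N mC LB)) _.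
by rewrite (n2N LB); move: h1 h2; rewrite -/A -/B; lra.
Qed.

Lemma trig_dense F e : L1 F -> 0 < e -> exists Q1 Q2,
  Q2`_0 = 0 /\ N1 (F - (pe Q1 + (fun x => (pe Q2 x)^*%C))) < e.
Proof.
move=> LF e0; have [[mR mI] iF] := LF.
have e4 : 0 < e / 4 by rewrite divr_gt0.
have iR : leb.-integrable circ (EFin \o (fun x => Re (F x) ^+ 2)).
  apply: (rintegrable_dom mC _ _ iF); first exact: measurable_funX.
  by move=> x _; rewrite mulr1 ger0_norm ?sqr_ge0 ?sqr_Re_le.
have iI : leb.-integrable circ (EFin \o (fun x => Im (F x) ^+ 2)).
  apply: (rintegrable_dom mC _ _ iF); first exact: measurable_funX.
  by move=> x _; rewrite mulr1 ger0_norm ?sqr_ge0 ?sqr_Im_le.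
have [P hP] := trig_dense_real mR iR e4.
have [P' hP'] := trig_dense_real mI iI e4.
pose i : R[i] := (0 +i* 1)%C; pose h : R[i] := (2^-1)%:C%C.
(* [q1 + conj q2 = Re P + i Re P']. The constant coefficient of [q2] is then moved, conjugated, into
   the first polynomial, so that the second one has no constant term. *)
pose q1 := h *: P + (h * i) *: P'; pose q2 := h *: P - (h * i) *: P'.
exists (q1 + ((q2`_0)^*%C)%:P), (q2 - (q2`_0)%:P); split.
  by rewrite coefB coefC eqxx subrr.
pose A := rc (fun x => Re (pe P x)) - rc (fun x => Re (F x)).
pose B := rc (fun x => Re (pe P' x)) - rc (fun x => Im (F x)).
have LP P0 : L1 (rc (fun x => Re (pe P0 x))).
  have [k [k0 hk]] := pe_bounded P0.
  apply: (L2_rc_bounded (k := Num.sqrt k)); first by have [] := cmeasurable_pe P0 circ.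
  by move=> x _; apply: normRe_le; rewrite ?sqrtr_ge0// sqr_sqrtr.
have LA : L1 A by apply: (L2B mC ww1) => //; exact: L2_rc.
have LB : L1 B by apply: (L2B mC ww1) => //; exact: L2_rc.
have -> : F - (pe (q1 + ((q2`_0)^*%C)%:P) + (fun x => (pe (q2 - (q2`_0)%:P) x)^*%C)) =
    - (A + i *: B).
  apply/funext => x.
  rewrite -[LHS]/(F x - (pe (q1 + ((q2`_0)^*%C)%:P) x + (pe (q2 - (q2`_0)%:P) x)^*%C)).
  rewrite -[RHS]/(- ((rc (fun x => Re (pe P x)) x - rc (fun x => Re (F x)) x)
     + i * (rc (fun x => Re (pe P' x)) x - rc (fun x => Im (F x)) x))).
  move: (q2`_0) => [p q]; rewrite /rc /pe /q1 /q2 !(hornerD, hornerN, hornerC, hornerZ).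
  move: (P.[_]) (P'.[_]) (F x) => [a b] [c d0] [r s].
  by apply: complex_ext; rewrite /rc !ReImE /=; field.
rewrite (n2N (L2D mC ww1 LA (L2Z mC i LB))).
apply: le_lt_trans (n2D_le mC ww1 LA (L2Z mC i LB)) _.
rewrite (n2Z mC ww1 i LB) (_ : abs2 i = 1) ?mul1r; last by rewrite /abs2 /=; ring.
by move: hP hP'; rewrite -/A -/B; lra.
Qed.

(** [F] has only positive frequencies and [G] only nonnegative ones. Projecting away the negative
    frequencies shows that [G] is an [L_2] limit of polynomials [pe Q1], and each of these
    integrates to zero against [F]. *)
Lemma analytic_product F G : L1 F -> L1 G ->
  (forall S, cintegral leb circ (fun x => F x * pe S x) = 0) ->
  (forall S, S`_0 = 0 -> cintegral leb circ (fun x => G x * pe S x) = 0) ->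
  cintegral leb circ (fun x => F x * G x) = 0.
Proof.
move=> LF LG hF hG.
pose cj (A : R -> R[i]) : R -> R[i] := fun x => (A x)^*%C.
have LJ A : L1 A -> L1 (cj A).
  move=> [mA iA]; split; first exact: cmeasurable_conj.
  by apply: (rintegrable_ext mC _ iA) => x _; rewrite abs2_conj.
have NJ A : N1 (cj A) = N1 A by apply: eq_Rintegral => x _; rewrite abs2_conj.
have CJ A B : C1 A (cj B) = cintegral leb circ (fun x => A x * B x).
  apply: cintegral_ext => x _; rewrite mulr1; congr (_ * _).
  by apply: complex_ext; rewrite !ReImE ?opprK.
have LP S : L1 (pe S) by exact: L2_pe.
apply: abs2_eq0; apply/eqP; rewrite eq_le abs2_ge0 andbT.
apply/ler_addgt0Pl => e e0; rewrite addr0 -CJ.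
have d0 : 0 < e / (N1 F + 1) by rewrite divr_gt0// ltr_wpDl ?n2_ge0.
have [Q1 [Q2 [Q20 hQ]]] := trig_dense LG d0.
have LD := L2B mC ww1 LG (LP Q1).
have orth : C1 (G - pe Q1) (cj (pe Q2)) = 0.
  rewrite cipBl//; last exact: LJ.
  rewrite !CJ hG// sub0r; apply/eqP; rewrite oppr_eq0; apply/eqP.
  rewrite -[LHS](_ : cintegral leb circ (pe (Q1 * Q2)) = _); last first.
    by apply: cintegral_ext => x _; rewrite peM.
  by rewrite cintegral_pe coef0M Q20 !mulr0.
(* Pythagoras: by [orth], removing [conj (pe Q2)] from the approximant can only decrease the
   error. *)
have small : N1 (G - pe Q1) < e / (N1 F + 1).
  apply: le_lt_trans hQ; rewrite opprD addrA -/(cj (pe Q2)).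
  rewrite (n2D mC ww1 LD (L2N mC (LJ _ (LP Q2)))) cipNr//; last exact: LJ.
  rewrite orth oppr0 mulr0 addr0 lerDl; exact: n2_ge0.
have -> : C1 F (cj G) = C1 F (cj (G - pe Q1)).
  rewrite (_ : cj (G - pe Q1) = cj G - cj (pe Q1)); last first.
    by apply/funext => x; apply: complex_ext; rewrite !ReImE; ring.
  by rewrite cipBr ?(CJ _ (pe Q1)) ?hF ?subr0//; exact: LJ.
apply: le_trans (cip_CauchySchwarz mC ww1 LF (LJ _ LD)) _.
rewrite NJ; have h0 : 0 <= N1 F by exact: n2_ge0.
apply: (@le_trans _ _ (N1 F * (e / (N1 F + 1)))); first by rewrite ler_wpM2l// ltW.
by rewrite mulrCA ler_piMr ?(ltW e0)// ler_pdivrMr ?ltr_wpDl// mul1r lerDl.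
Qed.

End Density_of_polynomials.

(** * Division by analytic functions of nonnegative real part *)

Section Annihilators.
Context {R : realType}.
Implicit Types (x : R) (P S : {poly R[i]}) (F G H : R -> R[i]).
Local Notation leb := (@lebesgue_measure R).
Let mC := @measurable_circ R.

Definition cmod (z : R[i]) : R := Num.sqrt (abs2 z).

Lemma cmod_ge0 z : 0 <= cmod z. Proof. exact: sqrtr_ge0. Qed.
Lemma sqr_cmod z : cmod z ^+ 2 = abs2 z. Proof. by rewrite sqr_sqrtr ?abs2_ge0. Qed.

Lemma measurable_sqrt (p : R -> R) : measurable_fun (circ : set (measurableTypeR R)) p ->
  measurable_fun (circ : set (measurableTypeR R)) (fun x => Num.sqrt (p x)).
Proof.
move=> mp; apply: (measurableT_comp (f := @Num.sqrt R) _ mp).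
by apply: continuous_measurable_fun; exact: sqrt_continuous.
Qed.

Lemma measurable_cmod F : mcirc F -> measurable_fun (circ : set (measurableTypeR R)) (cmod \o F).
Proof. by move=> mF; apply: measurable_sqrt; exact: cmeasurable_abs2. Qed.

Lemma integrable_cmod F : cintegrable leb circ F -> leb.-integrable circ (EFin \o (cmod \o F)).
Proof.
move=> cF; have [iR iI] := cF.
apply: (rintegrable_dom mC _ _ (rintegrableD mC (integrable_norm iR) (integrable_norm iI))).
  exact: measurable_cmod (cintegrable_meas cF).
move=> x _ /=; rewrite ger0_norm ?cmod_ge0//.
have h : 0 <= `|Re (F x)| + `|Im (F x)| by rewrite addr_ge0.
rewrite -(ger0_norm h) -sqrtr_sqr ler_sqrt ?sqr_ge0// /abs2.
rewrite -(real_normK (num_real (Re (F x)))) -(real_normK (num_real (Im (F x)))).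
have : 0 <= `|Re (F x)| by []. have : 0 <= `|Im (F x)| by [].
nra.
Qed.

Lemma cintegrableM F G k : cintegrable leb circ F -> mcirc G ->
  (forall x, circ x -> abs2 (G x) <= k) -> cintegrable leb circ (fun x => F x * G x).
Proof.
move=> cF mG hG.
have [k0|k0] := leP 0 k; last first.
  apply: (cintegrable_ext mC _ cF) => x Dx; exfalso.
  by move: k0; rewrite ltNge (le_trans (abs2_ge0 (G x)) (hG x Dx)).
apply: (cintegrable_dom mC _ _ (rintegrableZ mC (Num.sqrt k) (integrable_cmod cF))).
  exact: cmeasurableM (cintegrable_meas cF) mG.
move=> x Dx.
have p0 : 0 <= Num.sqrt k * cmod (F x) by rewrite mulr_ge0 ?sqrtr_ge0 ?cmod_ge0.
have hh : abs2 (F x * G x) <= (Num.sqrt k * cmod (F x)) ^+ 2.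
  by rewrite abs2M exprMn sqr_sqrtr// sqr_cmod mulrC ler_wpM2r ?abs2_ge0 ?hG.
by split; [exact: normRe_le|exact: normIm_le].
Qed.

Lemma abs2_ge1 (z : R[i]) : 1 <= Re z -> 1 <= abs2 z.
Proof. by move=> h; apply: le_trans (sqr_Re_le z); rewrite exprn_ege1. Qed.

Lemma neq0_Re_ge1 (z : R[i]) : 1 <= Re z -> z != 0.
Proof. by move=> h; apply/eqP => z0; move: h; rewrite z0 /= ler10. Qed.

(* Neumann series: for [M] large, [1 - P / M] is uniformly smaller than [1]. *)
Lemma neumann P : (forall x, 1 <= Re (pe P x)) -> exists S : nat -> {poly R[i]},
  (forall n x, abs2 (pe (S n) x) <= 4) /\
  (forall x, ccvg (fun n => pe (S n) x) (pe P x)^-1).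
Proof.
move=> P1; have [M [M0 hM]] := pe_bounded P.
have M1 : 1 <= M by apply: le_trans (hM 0); apply: abs2_ge1.
have Mp : 0 < M by apply: lt_le_trans M1.
pose r := 1 - M^-1.
have r0 : 0 <= r by rewrite subr_ge0 invf_le1.
have r1 : r < 1 by rewrite gtrBl invr_gt0.
pose c : R[i] := (M^-1)%:C%C.
pose z x := 1 - c * pe P x.
(* [M] bounds [|P|^2], and [Re P >= 1], so [|1 - P/M|^2 <= 1 - 2/M + 1/M = r < 1]. *)
have zr x : abs2 (z x) <= r.
  have -> : abs2 (z x) = 1 - 2 * (M^-1 * Re (pe P x)) + M^-1 * (M^-1 * abs2 (pe P x)).
    by rewrite /z /abs2 !ReImE /=; ring.
  have h1 : M^-1 <= M^-1 * Re (pe P x) by rewrite ler_peMr ?P1// invr_ge0.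
  have h2 : M^-1 * (M^-1 * abs2 (pe P x)) <= M^-1.
    by rewrite ler_piMr ?invr_ge0// ler_pdivrMl// mulr1.
  by rewrite /r; lra.
have Pn0 x : pe P x != 0 by apply: neq0_Re_ge1.
have cn0 : c != 0 by apply/eqP => /(congr1 (@complex.Re R)) /= /eqP; rewrite gt_eqF ?invr_gt0.
exists (fun n => c *: \sum_(j < n) (1 - c *: P) ^+ j).
(* The partial sum is [(1 - z^n) / P], of squared modulus at most 4 because [|z| <= 1 <= |P|]. *)
have SE n x : pe (c *: \sum_(j < n) (1 - c *: P) ^+ j) x = (1 - z x ^+ n) * (pe P x)^-1.
  rewrite /pe hornerZ horner_sum.
  under eq_bigr => j _ do rewrite horner_exp hornerD hornerN hornerZ hornerC.
  rewrite -/(pe P x) -/(z x).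
  have h := subrX1 (z x) n.
  apply: (mulIf (Pn0 x)); rewrite divfK//.
  rewrite -opprB h /z; ring.
split=> [n x|x].
  rewrite SE abs2M -[leRHS]mulr1; apply: ler_pM; rewrite ?abs2_ge0//; last first.
    by rewrite abs2V invf_le1 ?abs2_ge1// (lt_le_trans ltr01)// abs2_ge1.
  apply: le_trans (abs2D_le _ _) _; rewrite (abs2_real 1) expr1n abs2N.
  suff : abs2 (z x ^+ n) <= 1 by lra.
  elim: n => [|n IH]; first by rewrite expr0 (abs2_real 1) expr1n.
  rewrite exprS abs2M -[leRHS]mulr1; apply: ler_pM; rewrite ?abs2_ge0//.
  by apply: le_trans (zr x) _; exact: ltW.
under eq_fun do rewrite SE.
rewrite -[X in ccvg _ X]mul1r -[X in ccvg _ (X * _)]subr0.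
apply: ccvgM; last exact: ccvg_cst.
apply: ccvgD; first exact: ccvg_cst.
apply: ccvgN; apply: ccvg_abs2.
apply: (@squeeze_cvgr _ _ _ _ (fun=> 0) (fun n => r ^+ n)).
- apply: nearW => n; rewrite abs2_ge0 subr0 /=.
  elim: n => [|n IH]; first by rewrite !expr0 (abs2_real 1) expr1n.
  by rewrite !exprS abs2M; apply: ler_pM; rewrite ?abs2_ge0.
- exact: cvg_cst.
- have := @cvg_geometric R 1 r; rewrite ger0_norm// => /(_ r1).
  by apply: cvg_trans; apply: near_eq_cvg; apply: nearW => n /=; rewrite mul1r.
Qed.

Lemma annihilated_div_poly F P : cintegrable leb circ F -> (forall x, 1 <= Re (pe P x)) ->
  (forall S, cintegral leb circ (fun x => F x * pe S x) = 0) ->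
  cintegral leb circ (fun x => F x * (pe P x)^-1) = 0.
Proof.
move=> cF P1 hF; have [S [bS cS]] := neumann P1.
have mF := cintegrable_meas cF.
have mFP : mcirc (fun x => F x * (pe P x)^-1).
  by apply: cmeasurableM => //; apply: cmeasurableV; exact: cmeasurable_pe.
have mFS n : mcirc (fun x => F x * pe (S n) x).
  by apply: cmeasurableM => //; exact: cmeasurable_pe.
have bd n x : circ x -> abs2 (F x * pe (S n) x) <= (2 * cmod (F x)) ^+ 2.
  move=> _; rewrite abs2M exprMn sqr_cmod mulrC ler_wpM2r ?abs2_ge0//.
  by apply: le_trans (bS n x) _; rewrite expr2; lra.
have b0 x : circ x -> 0 <= 2 * cmod (F x) by move=> _; rewrite mulr_ge0 ?cmod_ge0.
have cv : {ae leb, forall x, circ x -> ccvg (fun n => F x * pe (S n) x) (F x * (pe P x)^-1)}.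
  by apply: aeW => x _; apply: ccvgM; [exact: ccvg_cst|exact: cS].
have [_ c] := cintegral_dominated mC mFS mFP (rintegrableZ mC 2 (integrable_cmod cF)) bd b0 cv.
apply: (ccvg_unique c); rewrite (_ : (fun n => _) = fun=> 0); first exact: ccvg_cst.
by apply/funext => n; rewrite hF.
Qed.

(** Nonnegative real parts give [|1 / (1 + eps P_n)| <= 1], so [|F|] dominates the whole sequence
    and the polynomial case passes to the limit [H]. *)
Lemma annihilated_div F H (Pn : nat -> {poly R[i]}) (eps : R) :
  cintegrable leb circ F -> mcirc H -> 0 <= eps ->
  (forall n x, 0 <= Re (pe (Pn n) x)) -> (forall x, circ x -> 0 <= Re (H x)) ->
  {ae leb, forall x, circ x -> ccvg (fun n => pe (Pn n) x) (H x)} ->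
  (forall S, cintegral leb circ (fun x => F x * pe S x) = 0) ->
  cintegral leb circ (fun x => F x * (1 + eps%:C%C * H x)^-1) = 0.
Proof.
move=> cF mH e0 P0 H0 cPH hF.
have ReE (z : R[i]) : 0 <= Re z -> 1 <= Re (1 + eps%:C%C * z).
  by move=> z0; rewrite !ReImE /= mul0r subr0 lerDl mulr_ge0.
have mF := cintegrable_meas cF.
have hn n : cintegral leb circ (fun x => F x * (1 + eps%:C%C * pe (Pn n) x)^-1) = 0.
  have := @annihilated_div_poly F (1 + eps%:C%C *: Pn n) cF.
  have pE x : pe (1 + eps%:C%C *: Pn n) x = 1 + eps%:C%C * pe (Pn n) x.
    by rewrite /pe hornerD hornerC hornerZ.
  under eq_fun do rewrite pE; move=> -> // x.
  by rewrite pE; exact: ReE.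
have mE G : mcirc G -> mcirc (fun x => F x * (1 + eps%:C%C * G x)^-1).
  move=> mG; apply: cmeasurableM => //; apply: cmeasurableV; apply: cmeasurableD.
    exact: cmeasurable_cst.
  by apply: cmeasurableM => //; exact: cmeasurable_cst.
have bd n x : circ x -> abs2 (F x * (1 + eps%:C%C * pe (Pn n) x)^-1) <= cmod (F x) ^+ 2.
  move=> _; rewrite abs2M sqr_cmod ler_piMr ?abs2_ge0// abs2V.
  by rewrite invf_le1 ?abs2_ge1 ?ReE// (lt_le_trans ltr01)// abs2_ge1 ?ReE.
have cv : {ae leb, forall x, circ x ->
    ccvg (fun n => F x * (1 + eps%:C%C * pe (Pn n) x)^-1) (F x * (1 + eps%:C%C * H x)^-1)}.
  apply: ae_imp cPH => x cx Dx; have {}cx := cx Dx.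
  apply: ccvgM; first exact: ccvg_cst.
  apply: ccvg_abs2.
  have /ccvg_abs2P c1 : ccvg (fun n => 1 + eps%:C%C * pe (Pn n) x) (1 + eps%:C%C * H x).
    by apply: ccvgD; [exact: ccvg_cst|apply: ccvgM => //; exact: ccvg_cst].
  apply: (squeeze_cvgr _ (cvg_cst 0) c1).
  apply: nearW => n; rewrite abs2_ge0 /=.
  set a := 1 + _; set b := 1 + _.
  have a1 : 1 <= Re a by apply: ReE.
  have b1 : 1 <= Re b by apply: ReE; exact: H0.
  (* Inversion is a contraction on the half plane [Re >= 1]. *)
  have -> : a^-1 - b^-1 = (b - a) * (a^-1 * b^-1).
    by field; rewrite !neq0_Re_ge1.
  rewrite abs2M (abs2BC b a) ler_piMr ?abs2_ge0// abs2M !abs2V -invfM invf_le1.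
    by rewrite -[1]mulr1 ler_pM ?abs2_ge1.
  by rewrite mulr_gt0// (lt_le_trans ltr01) ?abs2_ge1.
have [_ c] := cintegral_dominated mC (fun n => mE _ (cmeasurable_pe (Pn n) circ)) (mE _ mH)
  (integrable_cmod cF) bd (fun x _ => cmod_ge0 (F x)) cv.
apply: (ccvg_unique c); rewrite (_ : (fun n => _) = fun=> 0); first exact: ccvg_cst.
by apply/funext => n; rewrite hn.
Qed.

End Annihilators.

(** * Products of integrable functions with one-sided spectra *)

Section Smirnov.
Context {R : realType}.
Implicit Types (x : R) (P S : {poly R[i]}) (u : R -> R) (F G H : R -> R[i]).
Local Notation leb := (@lebesgue_measure R).
Local Notation L1 := (L2 leb circ (fun=> 1)).
Local Notation N1 := (n2 leb circ (fun=> 1)).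
Let mC := @measurable_circ R.
Let ww1 := @weight1 R.
Let iw1 := @integrable_cst_circ R 1.

Lemma L2_rc_Re_pe P : L1 (rc (fun x => Re (pe P x))).
Proof.
have [k [k0 hk]] := pe_bounded P.
apply: (L2_rc_bounded (k := Num.sqrt k)); first by have [] := cmeasurable_pe P circ.
by move=> x _; apply: normRe_le; rewrite ?sqrtr_ge0// sqr_sqrtr.
Qed.

(* The analytic completions of the nonnegative trigonometric polynomials
   approximating [u] converge, since their L2 norm is controlled by that of
   their real parts. *)
Lemma herglotz u : measurable_fun (circ : set (measurableTypeR R)) u ->
  (forall x, circ x -> 0 <= u x) ->
  leb.-integrable circ (EFin \o (fun x => u x ^+ 2)) ->
  exists (Pn : nat -> {poly R[i]}) H, [/\ mcirc H,
    forall n x, 0 <= Re (pe (Pn n) x), forall x, Re (H x) = u x &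
    {ae leb, forall x, circ x -> ccvg (fun n => pe (Pn n) x) (H x)}].
Proof.
move=> mu u0 iu.
(* The extra factor [1/8] pays for two doublings, in [pe_conjugate_bound] and in [n2_triangle]:
   [2 (2/64 + 2/8) <= 1]. *)
have ex n : exists P, [/\ Im P`_0 = 0, forall x, 0 <= Re (pe P x) &
    N1 (rc (fun x => Re (pe P x)) - rc u) < (8^-1) ^+ n / 8].
  have [|P [P0 hP]] := @trig_dense_ge0 R u ((8^-1) ^+ n / 8) mu u0 iu.
    by rewrite divr_gt0// exprn_gt0.
  (* Subtracting an imaginary constant does not affect the real part and gives the normalization
     required by [pe_conjugate_bound]. *)
  pose c : R[i] := (0 +i* Im P`_0)%C.
  have PE x : Re (pe (P - c%:P) x) = Re (pe P x).
    by rewrite /pe hornerD hornerN hornerC !ReImE /= subr0.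
  exists (P - c%:P); split.
  - by rewrite coefB coefC eqxx !ReImE subrr.
  - by move=> x; rewrite PE.
  - by under [X in rc X - _]eq_fun do rewrite PE.
pose Pn n := projT1 (cid (ex n)).
have [Pn1 Pn2 Pn3] : [/\ forall n, Im (Pn n)`_0 = 0, forall n x, 0 <= Re (pe (Pn n) x) &
    forall n, N1 (rc (fun x => Re (pe (Pn n) x)) - rc u) < (8^-1) ^+ n / 8].
  by split=> n; rewrite /Pn; case: (cid (ex n)) => P /= [].
have Lu : L1 (rc u) by exact: L2_rc.
have fast n : N1 (pe (Pn n.+1) - pe (Pn n)) <= (8^-1) ^+ n.
  rewrite -peB; apply: le_trans (pe_conjugate_bound _) _.
    by rewrite coefB !ReImE !Pn1 subrr.
  have -> : Rintegral leb circ (fun x => Re (pe (Pn n.+1 - Pn n) x) ^+ 2) =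
      N1 (rc (fun x => Re (pe (Pn n.+1) x)) - rc (fun x => Re (pe (Pn n) x))).
    apply: eq_Rintegral => x _; rewrite mulr1.
    rewrite -[(rc _ - rc _) x]/(rc (fun x => Re (pe (Pn n.+1) x)) x - rc (fun x => Re (pe (Pn n) x)) x).
    by rewrite -rmorphB abs2_real /pe hornerD hornerN !ReImE.
  have := n2_triangle mC ww1 (L2_rc_Re_pe (Pn n.+1)) Lu (L2_rc_Re_pe (Pn n)).
  rewrite (n2BC Lu (L2_rc_Re_pe (Pn n))).
  have := Pn3 n; have := Pn3 n.+1; rewrite exprS.
  have : 0 <= (8^-1) ^+ n :> R by rewrite exprn_ge0.
  by move: ((8^-1) ^+ n) (N1 _) (N1 _) (N1 _) => a b c d; lra.
have wpos : {ae leb, forall x, circ x -> (0 : R) < 1} by apply: aeW.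
have LPn n : L1 (pe (Pn n)) by exact: L2_pe.
have [H0 [LH0 _ cH0]] := L2_complete mC ww1 wpos LPn fast.
have LR n : L1 (rc (fun x => Re (pe (Pn n) x)) - rc u).
  by apply: (L2B mC ww1) => //; exact: L2_rc_Re_pe.
have hb n : N1 (rc (fun x => Re (pe (Pn n) x)) - rc u) <= (8^-1) ^+ n.
  by apply: le_trans (ltW (Pn3 n)) _; rewrite ler_piMr ?exprn_ge0// invf_le1 ?ler1n.
have cR := ae_rapid mC ww1 wpos LR hb.
have [mH0 _] := LH0.
(* The real part of the [L_2] limit [H0] agrees with [u] only almost everywhere; replacing it by [u]
   gives [Re (1 + eps H) >= 1] at every point. *)
exists Pn, (fun x => (u x +i* Im (H0 x))%C); split => //.
  by split => //; case: mH0.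
apply: (ae_imp2 _ cH0 cR) => x c1 c2 Dx; have [_ cI] := c1 Dx; have [k hk] := c2 Dx.
split => //=.
by have [] := @rapid_ccvg R (fun n => (Re (pe (Pn n) x))%:C%C) (u x)%:C%C k hk.
Qed.

(* With [H] of nonnegative real part [sqrt |F| + sqrt |G|], division by
   [1 + eps H] brings [F] and [G] into L2 and preserves the vanishing of
   Fourier coefficients; then let [eps] tend to [0]. *)
Lemma smirnov F G : cintegrable leb circ F -> cintegrable leb circ G ->
  cintegrable leb circ (fun x => F x * G x) ->
  (forall S, cintegral leb circ (fun x => F x * pe S x) = 0) ->
  (forall S, S`_0 = 0 -> cintegral leb circ (fun x => G x * pe S x) = 0) ->
  cintegral leb circ (fun x => F x * G x) = 0.
Proof.
move=> cF cG cFG hF hG.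
have mF := cintegrable_meas cF; have mG := cintegrable_meas cG.
pose u x := Num.sqrt (cmod (F x)) + Num.sqrt (cmod (G x)).
have mu : measurable_fun (circ : set (measurableTypeR R)) u.
  by apply: measurable_funD; apply: measurable_sqrt; exact: measurable_cmod.
have u0 x : 0 <= u x by rewrite addr_ge0 ?sqrtr_ge0.
have uF x : cmod (F x) <= u x ^+ 2.
  rewrite -[leLHS]sqr_sqrtr ?cmod_ge0// ler_sqr ?nnegrE ?sqrtr_ge0//.
  by rewrite lerDl sqrtr_ge0.
have uG x : cmod (G x) <= u x ^+ 2.
  rewrite -[leLHS]sqr_sqrtr ?cmod_ge0// ler_sqr ?nnegrE ?sqrtr_ge0//.
  by rewrite lerDr sqrtr_ge0.
have iu : leb.-integrable circ (EFin \o (fun x => u x ^+ 2)).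
  apply: (rintegrable_dom mC _ _ (rintegrableD mC (rintegrableZ mC 2 (integrable_cmod cF))
    (rintegrableZ mC 2 (integrable_cmod cG)))); first exact: measurable_funX.
  move=> x _; rewrite ger0_norm ?sqr_ge0// /=.
  rewrite -[cmod (F x)]sqr_sqrtr ?cmod_ge0// -[cmod (G x)]sqr_sqrtr ?cmod_ge0// /u.
  by move: (Num.sqrt _) (Num.sqrt _) => a b; have := sqr_ge0 (a - b); nra.
have [Pn [H [mH P0 HE cH]]] := herglotz mu (fun x _ => u0 x) iu.
have H0 x : 0 <= Re (H x) by rewrite HE.
pose E (eps : R) x := (1 + eps%:C%C * H x)^-1.
have mE eps : mcirc (E eps).
  apply: cmeasurableV; apply: cmeasurableD; first exact: cmeasurable_cst.
  by apply: cmeasurableM => //; exact: cmeasurable_cst.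
have ReE eps x : 0 <= eps -> 1 + eps * u x <= Re (1 + eps%:C%C * H x).
  by move=> e0; rewrite !ReImE /= mul0r subr0 HE.
have Re1 eps x : 0 <= eps -> 1 <= Re (1 + eps%:C%C * H x).
  by move=> e0; apply: le_trans (ReE _ _ e0); rewrite lerDl mulr_ge0.
have E1 eps x : 0 <= eps -> abs2 (E eps x) <= 1.
  move=> e0; rewrite abs2V invf_le1 ?abs2_ge1 ?Re1//.
  by rewrite (lt_le_trans ltr01)// abs2_ge1 ?Re1.
have Eu eps x : 0 < eps -> eps ^+ 2 * (abs2 (E eps x) * u x ^+ 2) <= 1.
  move=> e0; rewrite abs2V mulrCA ler_pdivrMl; last first.
    by rewrite (lt_le_trans ltr01)// abs2_ge1 ?Re1 ?ltW.
  rewrite mulr1 -exprMn; apply: le_trans (sqr_Re_le _).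
  have h1 := ReE eps x (ltW e0); rewrite ler_sqr ?nnegrE ?mulr_ge0 ?(ltW e0)//.
    by apply: le_trans h1; rewrite lerDr.
  by apply: le_trans (Re1 eps x (ltW e0)).
(* From [|A| <= u^2] and [eps^2 u^2 |E|^2 <= 1] one gets [|A E|^2 <= eps^-2 |A|], which is
   integrable. This is why [u] is made of square roots. *)
have LE eps A : 0 < eps -> cintegrable leb circ A -> (forall x, cmod (A x) <= u x ^+ 2) ->
    L1 (fun x => A x * E eps x).
  move=> e0 cA uA; have mA := cintegrable_meas cA.
  split; first exact: cmeasurableM.
  apply: (rintegrable_dom mC _ _ (rintegrableZ mC (eps ^- 2) (integrable_cmod cA))).
    apply: measurable_funM; last exact: measurable_cst.
    by apply: cmeasurable_abs2; exact: cmeasurableM.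
  move=> x _; rewrite mulr1 ger0_norm ?abs2_ge0// ler_pdivlMl ?exprn_gt0//= abs2M -sqr_cmod.
  have cA0 := cmod_ge0 (A x).
  have -> : eps ^+ 2 * (cmod (A x) ^+ 2 * abs2 (E eps x)) =
      cmod (A x) * (eps ^+ 2 * (abs2 (E eps x) * cmod (A x))) by ring.
  rewrite ler_piMr//; apply: le_trans (Eu eps x e0).
  by rewrite ler_wpM2l ?exprn_ge0 ?(ltW e0)// ler_wpM2l ?abs2_ge0.
have zero eps : 0 < eps ->
    cintegral leb circ (fun x => (F x * E eps x) * (G x * E eps x)) = 0.
  move=> e0; apply: analytic_product; [exact: LE|exact: LE| |].
  (* The hypothesis covers all polynomials, so [F] times [pe S] is annihilated as well, and
     [annihilated_div] applies to this product. *)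
  - move=> S; have [k [k0 hk]] := pe_bounded S.
    rewrite (_ : (fun x => _) = fun x => (F x * pe S x) * E eps x); last first.
      by apply/funext => x; rewrite mulrAC.
    apply: (annihilated_div (Pn := Pn)) => //; last 2 first.
    + exact: ltW.
    + by move=> S'; rewrite -[RHS](hF (S * S')); apply: cintegral_ext => x _; rewrite peM mulrA.
    by apply: (cintegrableM cF (k := k)) => //; exact: cmeasurable_pe.
  - move=> S S0; have [k [k0 hk]] := pe_bounded S.
    rewrite (_ : (fun x => _) = fun x => (G x * pe S x) * E eps x); last first.
      by apply/funext => x; rewrite mulrAC.
    apply: (annihilated_div (Pn := Pn)) => //; last 2 first.
    + exact: ltW.
    + move=> S'; rewrite -[RHS](hG (S * S')); last by rewrite coef0M S0 mul0r.
      by apply: cintegral_ext => x _; rewrite peM mulrA.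
    by apply: (cintegrableM cG (k := k)) => //; exact: cmeasurable_pe.
(* [eps] runs through [harmonic n]; since [|E| <= 1], the integrable function [|F G|] dominates. *)
pose An n x := (F x * E (harmonic n) x) * (G x * E (harmonic n) x).
have mAn n : mcirc (An n) by apply: cmeasurableM; exact: cmeasurableM.
have bd n x : circ x -> abs2 (An n x) <= cmod (F x * G x) ^+ 2.
  move=> _; rewrite sqr_cmod /An mulrACA (abs2M (F x * G x)) ler_piMr ?abs2_ge0// abs2M.
  by rewrite -[leRHS]mulr1 ler_pM ?abs2_ge0 ?E1 ?harmonic_ge0.
have cv : {ae leb, forall x, circ x -> ccvg (An^~ x) (F x * G x)}.
  apply: aeW => x _; rewrite /An; under eq_fun do rewrite mulrACA.
  rewrite -[X in ccvg _ X]mulr1; apply: ccvgM; first exact: ccvg_cst.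
  rewrite -[X in ccvg _ X]mulr1.
  suff c : ccvg (fun n => E (harmonic n) x) 1 by apply: ccvgM.
  apply: ccvg_abs2.
  have ch : (fun n => (@harmonic R n) ^+ 2 * abs2 (H x)) @ \oo --> (0 : R).
    rewrite -[X in _ --> X](mul0r (abs2 (H x))); apply: cvgM; last exact: cvg_cst.
    rewrite -[X in _ --> X](mul0r 0); under eq_fun do rewrite expr2.
    by apply: cvgM; exact: cvg_harmonic.
  apply: (squeeze_cvgr _ (cvg_cst 0) ch); apply: nearW => n.
  rewrite abs2_ge0 /=; have hn : 0 <= @harmonic R n by exact: harmonic_ge0.
  have -> : E (harmonic n) x - 1 = - (E (harmonic n) x) * ((harmonic n)%:C%C * H x).
    rewrite /E; set z := _%:C%C * H x.
    by field; apply: neq0_Re_ge1; exact: Re1.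
  rewrite abs2M abs2N abs2M abs2_real ler_piMl ?mulr_ge0 ?sqr_ge0 ?abs2_ge0//.
  exact: E1.
have [_ c] := cintegral_dominated mC mAn (cintegrable_meas cFG) (integrable_cmod cFG) bd
  (fun x _ => cmod_ge0 _) cv.
apply: (ccvg_unique c); rewrite (_ : (fun n => _) = fun=> 0); first exact: ccvg_cst.
by apply/funext => n; apply: zero; exact: harmonic_gt0.
Qed.

End Smirnov.

(** The inequalities of [stoch_int_bound], with [q4] and [ns] the norms of the differences of the
    simple approximants. Unfolding them gives at most [(6 + 32 K) dd + 8 K nFG], where [dd] is the
    common bound on the approximation errors; hence its denominator [8 + 32 K]. The final 16 is not
    sharp. *)
Lemma bound_arith {R : realType} (q1 q2 q3 q4 q5 ns nd nFG nF nG K e : R) :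
  0 <= K -> 0 < e -> 0 <= nFG -> q1 <= 2 * q2 + 2 * q3 -> q3 <= 2 * q4 + 2 * q5 ->
  ns <= 2 * nd + 2 * nFG -> nd <= 2 * nF + 2 * nG -> q4 <= K * ns ->
  q2 < e / (8 + 32 * K) -> q5 < e / (8 + 32 * K) ->
  nF < e / (8 + 32 * K) -> nG < e / (8 + 32 * K) -> q1 <= e + 16 * K * nFG.
Proof.
move=> K0 e0 n0 t1 t2 t3 t4 t5.
have de : (8 + 32 * K) * (e / (8 + 32 * K)) = e.
  by rewrite mulrC divfK// gt_eqF// ltr_wpDr// mulr_ge0.
set dd := e / _ in de * => a1 a2 b1 b2.
have h1 : q4 <= K * (8 * dd + 2 * nFG) by apply: le_trans t5 _; rewrite ler_wpM2l//; lra.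
have h2 : 0 <= K * nFG by rewrite mulr_ge0.
have h3 : q1 <= 8 * dd + 4 * (K * (8 * dd + 2 * nFG)).
  have dd0 : 0 < dd by rewrite divr_gt0// ltr_wpDr// mulr_ge0.
  lra.
rewrite -de; lra.
Qed.

(** * Stochastic integrals *)

Section Stochastic_integral.
Context {R : realType} {d : measure_display} {T : measurableType d}.
Variable P : probability T R.
Implicit Types (f w : R -> R) (Z : set R -> T -> R[i]) (F G : R -> R[i]) (X Y : T -> R[i]).
Local Notation leb := (@lebesgue_measure R).
Local Notation LP := (L2 P setT (fun=> 1)).
Local Notation NP := (n2 P setT (fun=> 1)).
Local Notation CP := (cip P setT (fun=> 1)).
Local Notation Lw := (L2 leb circ).
Local Notation Nw := (n2 leb circ).
Local Notation Cw := (cip leb circ).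
Let mC := @measurable_circ R.
Let mT : measurable [set: T] := measurableT.

Lemma weightT : weight [set: T] (fun=> 1 : R).
Proof. by split; [exact: measurable_cst|move=> x _; exact: ler01]. Qed.
Let wT := weightT.

Lemma msnorm_int X : (msnorm P X = \int[P]_(t in setT) (abs2 (X t) * 1)%:E)%E.
Proof. by rewrite /msnorm; apply: eq_integral => t _; rewrite mulr1. Qed.

Lemma sq_integrableP X : sq_integrable P X <-> LP X.
Proof.
split=> [[mX lX]|LX]; first by apply: L2P => //; rewrite -msnorm_int.
by split; [case: LX|rewrite msnorm_int; exact: L2_lty].
Qed.

Lemma msnormE X : LP X -> msnorm P X = (NP X)%:E.
Proof. by move=> LX; rewrite msnorm_int n2E. Qed.

Lemma covarE X Y : covar P X Y = CP X Y.
Proof.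
by rewrite /covar /cexpect /cip; apply: cintegral_ext => t _; rewrite mulr1.
Qed.

Lemma in_L2P w F : wcirc w -> in_L2 w F <-> Lw w F.
Proof.
move=> ww; split=> [[mF lF]|LF]; first exact: L2P.
by split; [case: LF|exact: L2_lty].
Qed.

Lemma wnorm2E w F : Lw w F -> wnorm2 w F = (Nw w F)%:E.
Proof. by move=> LF; rewrite /wnorm2 n2E. Qed.

Definition ind (A : set R) : R -> R[i] := fun x => (\1_A x)%:C%C.

Lemma L2_ind w A : wcirc w -> leb.-integrable circ (EFin \o w) -> borel_arc A -> Lw w (ind A).
Proof.
move=> ww iw [mA _].
have mI : mcirc (ind A) by apply: cmeasurable_real; apply: measurable_indic.
have hI x : circ x -> abs2 (ind A x) <= 1.
  by move=> _; rewrite abs2_real indicE; case: (_ \in _); rewrite ?expr1n// expr0n ler01.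
by have [] := L2_bounded mC ww iw mI hI.
Qed.

Lemma simple_fctE n u (A : nat -> set R) :
  simple_fct n u A = \sum_(k < n) u k *: ind (A k).
Proof. by apply/funext => x; rewrite fct_sumE. Qed.

Lemma simple_intE Z n u (A : nat -> set R) :
  simple_int Z n u A = \sum_(k < n) u k *: Z (A k).
Proof. by apply/funext => x; rewrite fct_sumE. Qed.

Lemma L2_simple w n u A : wcirc w -> leb.-integrable circ (EFin \o w) ->
  (forall k, borel_arc (A k)) -> Lw w (simple_fct n u A).
Proof.
move=> ww iw hA; rewrite simple_fctE; apply: L2_sum => // k.
by apply: L2Z => //; exact: L2_ind.
Qed.

Lemma cip_ind w A B : wcirc w -> borel_arc A -> borel_arc B ->
  Cw w (ind A) (ind B) = (Rintegral leb (A `&` B) w)%:C%C.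
Proof.
move=> ww [mA sA] [mB sB].
have E1 : (fun x => ind A x * (ind B x)^*%C * (w x)%:C%C) = fun x => ((w \_ (A `&` B)) x)%:C%C.
  have p0 : (point : R) = 0 by [].
  apply/funext => x; rewrite /ind !indicE patchE in_setI.
  by case: (x \in A); case: (x \in B); apply: complex_ext;
    rewrite !ReImE /= ?p0; ring.
rewrite /cip E1 /cintegral; apply: complex_ext => /=; last first.
  by rewrite Rintegral_cst_circ mul0r.
by rewrite -Rintegral_mkcondr setIidr// => x [/sA].
Qed.

(** The substitute for the isometry from which the calculus of stochastic integrals is developed; it
    passes to the sum of two stochastic measures. *)
Definition bounded_int Z w (K : R) : Prop := forall n u (A : nat -> set R),
  (forall k, borel_arc (A k)) ->
  LP (simple_int Z n u A) /\ NP (simple_int Z n u A) <= K * Nw w (simple_fct n u A).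

Lemma L2_orth Z f A : orth_measure P Z f -> borel_arc A -> LP (Z A).
Proof. by move=> [h _ _] /h/sq_integrableP. Qed.

(** Both squared norms are Gram sums with the same coefficients, and the covariances of the
    [Z (A k)] are [(2 pi)^-1] times the inner products of the indicators, also for overlapping sets.
    Equality holds. *)
Lemma orth_bounded_int Z f : wcirc f -> leb.-integrable circ (EFin \o f) ->
  orth_measure P Z f -> bounded_int Z f (2 * pi)^-1.
Proof.
move=> wf iF oZ n u A hA.
have LZ k : LP (Z (A k)) by apply: L2_orth oZ _.
have LI k : Lw f (ind (A k)) by exact: L2_ind.
rewrite simple_intE simple_fctE; split.
  by apply: L2_sum => // k; exact: L2Z.
rewrite le_eqVlt; apply/orP; left; apply/eqP.
have L1 : LP (\sum_(k < n) u k *: Z (A k)) by apply: L2_sum => // k; exact: L2Z.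
have L2' : Lw f (\sum_(k < n) u k *: ind (A k)) by apply: L2_sum => // k; exact: L2Z.
have := cip_self mT L1; have := cip_self mC L2'; rewrite (gram mT wT n n u u LZ LZ) (gram mC wf n n u u LI LI).
move=> e2 e1; have : ((NP (\sum_(k < n) u k *: Z (A k)))%:C%C : R[i]) =
   (2 * pi)^-1%:C%C * (Nw f (\sum_(k < n) u k *: ind (A k)))%:C%C.
  rewrite -e1 -e2 mulr_sumr; apply: eq_bigr => j _.
  rewrite mulr_sumr; apply: eq_bigr => k _.
  have [_ _ cZ] := oZ.
  rewrite -covarE cZ// cip_ind// rmorphM; ring.
by rewrite -rmorphM => /(congr1 (@complex.Re R)).
Qed.

(** Concatenation of the two families; the same coefficients and sets serve every [Z]. *)
Lemma simple_lin (c : R[i]) n u (A : nat -> set R) m v (B : nat -> set R) :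
  (forall k, borel_arc (A k)) -> (forall k, borel_arc (B k)) ->
  exists N U W, [/\ forall k, borel_arc (W k),
    simple_fct N U W = simple_fct n u A + c *: simple_fct m v B &
    forall Z, simple_int Z N U W = simple_int Z n u A + c *: simple_int Z m v B].
Proof.
move=> hA hB.
exists (n + m)%N, (fun k => if (k < n)%N then u k else c * v (k - n)%N),
  (fun k => if (k < n)%N then A k else B (k - n)%N); split.
- by move=> k; case: ifP.
- apply/funext => x; rewrite /simple_fct big_split_ord /=; congr (_ + _).
    by apply: eq_bigr => k _; rewrite ltn_ord.
  rewrite -[RHS]/(c * _) mulr_sumr; apply: eq_bigr => k _.
  by rewrite ltnNge leq_addr /= addKn mulrA.
- move=> Z; apply/funext => x; rewrite /simple_int big_split_ord /=; congr (_ + _).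
    by apply: eq_bigr => k _; rewrite ltn_ord.
  rewrite -[RHS]/(c * _) mulr_sumr; apply: eq_bigr => k _.
  by rewrite ltnNge leq_addr /= addKn mulrA.
Qed.

Lemma stoch_intP Z w K F X : wcirc w -> leb.-integrable circ (EFin \o w) ->
  bounded_int Z w K ->
  (stoch_int P Z w F X <-> [/\ Lw w F, LP X & forall e : R, 0 < e ->
    exists n u (A : nat -> set R), [/\ forall k, borel_arc (A k),
      Nw w (F - simple_fct n u A) < e & NP (X - simple_int Z n u A) < e]]).
Proof.
move=> ww iw bZ; split.
  move=> [/(in_L2P F ww) LF /sq_integrableP LX h]; split=> // e e0.
  have [n [u [A [hA h1 h2]]]] := h e e0; exists n, u, A; split=> //.
    rewrite -lte_fin -wnorm2E//; apply: L2B => //; exact: L2_simple.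
  rewrite -lte_fin -msnormE//; apply: L2B => //.
  by have [] := bZ n u A hA.
move=> [LF LX h]; split; [exact/(in_L2P F ww)|exact/sq_integrableP|].
move=> e e0; have [n [u [A [hA h1 h2]]]] := h e e0; exists n, u, A; split=> //.
  rewrite [X in (X < _)%E](_ : _ = wnorm2 w (F - simple_fct n u A))// wnorm2E ?lte_fin//.
  by apply: L2B => //; exact: L2_simple.
rewrite [X in (X < _)%E](_ : _ = msnorm P (X - simple_int Z n u A))// msnormE ?lte_fin//.
by apply: L2B => //; have [] := bZ n u A hA.
Qed.

(* No isometry is available for [Z_xi + Z_eta] (cross covariances of [Z_xi] and
   [Z_eta] are not given), but this bound suffices. *)
Lemma stoch_int_bound Z w K F X G Y : wcirc w -> leb.-integrable circ (EFin \o w) ->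
  0 <= K -> bounded_int Z w K -> stoch_int P Z w F X -> stoch_int P Z w G Y ->
  NP (X - Y) <= 16 * K * Nw w (F - G).
Proof.
move=> ww iw K0 bZ /(stoch_intP F X ww iw bZ)[LF LX hF] /(stoch_intP G Y ww iw bZ)[LG LY hG].
apply/ler_addgt0Pl => e e0.
have d0 : 0 < e / (8 + 32 * K) by rewrite divr_gt0// ltr_wpDr// mulr_ge0.
have [n [u [A [hA a1 a2]]]] := hF _ d0.
have [m [v [B [hB b1 b2]]]] := hG _ d0.
have [N [U [W [hW e1 e2]]]] := simple_lin (-1) n u m v hA hB.
have [LS bS] := bZ N U W hW.
have [LXs _] := bZ n u A hA; have [LYs _] := bZ m v B hB.
have LFs := L2_simple n u ww iw hA; have LGs := L2_simple m v ww iw hB.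
move: bS; rewrite e1 e2 !scaleN1r => t5.
have t0 := n2_triangle mC ww (L2B mC ww LFs LGs) (L2B mC ww LF LG) (L20 leb mC w).
have t1 := n2_triangle mT wT LX LXs LY.
have t2 := n2_triangle mT wT LXs LYs LY.
rewrite (n2BC LYs LY) in t2.
rewrite !subr0 in t0.
have t3 := n2D_le mC ww (L2B mC ww LFs LF) (L2N mC (L2B mC ww LGs LG)).
rewrite (n2N (L2B mC ww LGs LG)) (n2BC LFs LF) (n2BC LGs LG) in t3.
rewrite (_ : simple_fct n u A - F - (simple_fct m v B - G) =
  simple_fct n u A - simple_fct m v B - (F - G)) in t3; last first.
  by rewrite !opprB addrACA [RHS]addrACA (addrC (- F)).
exact: bound_arith K0 e0 (n2_ge0 _ _ ww) t1 t2 t0 t3 t5 a2 b2 a1 b1.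
Qed.

End Stochastic_integral.

(** * Limits of stochastic integrals, and integration against a sum of stochastic measures *)

Lemma triangle_lt {R : realType} (s a b e : R) :
  s <= 2 * a + 2 * b -> a < e / 4 -> b < e / 4 -> s < e.
Proof. by move=> h1 h2 h3; lra. Qed.

Section Stochastic_integral_limits.
Context {R : realType} {d : measure_display} {T : measurableType d}.
Variable P : probability T R.
Implicit Types (f g w : R -> R) (Z : set R -> T -> R[i]) (F G : R -> R[i]) (X Y : T -> R[i]).
Local Notation leb := (@lebesgue_measure R).
Local Notation LP := (L2 P setT (fun=> 1)).
Local Notation NP := (n2 P setT (fun=> 1)).
Local Notation Lw := (L2 leb circ).
Local Notation Nw := (n2 leb circ).
Local Notation Cw := (cip leb circ).
Let mC := @measurable_circ R.
Let mT : measurable [set: T] := measurableT.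
Let wT := @weightT R _ T.

Section fixed_Z.
Variables (Z : set R -> T -> R[i]) (w : R -> R) (K : R).
Hypotheses (ww : wcirc w) (iw : leb.-integrable circ (EFin \o w)) (K0 : 0 <= K).
Hypothesis bZ : bounded_int P Z w K.

Lemma stoch_int_simple n u (A : nat -> set R) : (forall k, borel_arc (A k)) ->
  stoch_int P Z w (simple_fct n u A) (simple_int Z n u A).
Proof.
move=> hA; apply/(stoch_intP _ _ ww iw bZ); split.
- exact: L2_simple.
- by have [] := bZ n u hA.
move=> e e0; exists n, u, A; rewrite !subrr.
suff z0 : Nw w 0 = 0 /\ NP 0 = 0 by case: z0 => -> ->.
by split; apply: EFin_inj; [rewrite -(n2E mC (L20 leb mC w))|rewrite -(n2E mT (L20 P mT (fun=> 1)))];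
  rewrite integral0_eq// => x _; rewrite abs20 mul0r.
Qed.

(** The graph of the stochastic integral is closed. In [spectral_characteristicP] this is applied to
    finite sums of past observations and their trigonometric polynomials. *)
Lemma stoch_int_limit F X : Lw w F -> LP X ->
  (forall e : R, 0 < e -> exists G Y, [/\ stoch_int P Z w G Y, Nw w (F - G) < e & NP (X - Y) < e]) ->
  stoch_int P Z w F X.
Proof.
move=> LF LX h; apply/(stoch_intP _ _ ww iw bZ); split=> // e e0.
have e4 : 0 < e / 4 by rewrite divr_gt0.
have [G [Y [/(stoch_intP _ _ ww iw bZ)[LG LY hG] h1 h2]]] := h _ e4.
have [n [u [A [hA g1 g2]]]] := hG _ e4.
exists n, u, A; split=> //.
  exact: triangle_lt (n2_triangle mC ww LF LG (L2_simple n u ww iw hA)) h1 g1.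
have [LS _] := bZ n u hA.
exact: triangle_lt (n2_triangle mT wT LX LY LS) h2 g2.
Qed.

Lemma stoch_int_lin c F X G Y : stoch_int P Z w F X -> stoch_int P Z w G Y ->
  stoch_int P Z w (F + c *: G) (X + c *: Y).
Proof.
move=> /(stoch_intP _ _ ww iw bZ)[LF LX hF] /(stoch_intP _ _ ww iw bZ)[LG LY hG].
apply: stoch_int_limit; first by apply: L2D => //; exact: L2Z.
  by apply: L2D => //; exact: L2Z.
move=> e e0.
(* Errors below [e / (4 (|c|^2 + 1))] add up to less than [2 (1 + |c|^2)] times this bound, that is
   [e / 2]; the summand 1 covers [c = 0]. *)
have c0 : 0 < 4 * (abs2 c + 1) by rewrite mulr_gt0// ltr_wpDl ?abs2_ge0.
have d0 : 0 < e / (4 * (abs2 c + 1)) by rewrite divr_gt0.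
have [n [u [A [hA a1 a2]]]] := hF _ d0.
have [m [v [B [hB b1 b2]]]] := hG _ d0.
have [N [U [W [hW e1 e2]]]] := simple_lin (T := T) c n u m v hA hB.
exists (simple_fct N U W), (simple_int Z N U W).
have aux (V : lmodType R[i]) (p q r s : V) : p + c *: q - (r + c *: s) = (p - r) + c *: (q - s).
  by rewrite opprD addrACA scalerBr.
have ar (q1 q2 q3 : R) : q1 <= 2 * q2 + 2 * (abs2 c * q3) -> q2 < e / (4 * (abs2 c + 1)) ->
    q3 < e / (4 * (abs2 c + 1)) -> q1 < e.
  rewrite !ltr_pdivlMr// => h1 h2 h3; have := abs2_ge0 c.
  have q2e : q2 < e / 4 \/ 0 <= q2 by case: (ltP q2 0) => h; [left; lra|right].
  move: (abs2 c) h1 h2 h3 c0 => a h1 h2 h3 c0 a0.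
  have : (q2 + a * q3) * (4 * (a + 1)) < e * (a + 1) by nra.
  by rewrite mulrA ltr_pM2r; lra.
split.
- exact: stoch_int_simple.
- rewrite e1 aux.
  have L1 := L2B mC ww LF (L2_simple n u ww iw hA).
  have L2' := L2B mC ww LG (L2_simple m v ww iw hB).
  have := n2D_le mC ww L1 (L2Z mC c L2'); rewrite (n2Z mC ww c L2') => h.
  exact: ar h a1 b1.
- rewrite e2 aux.
  have [LX' _] := bZ n u hA; have [LY' _] := bZ m v hB.
  have L1 := L2B mT wT LX LX'.
  have L2' := L2B mT wT LY LY'.
  have := n2D_le mT wT L1 (L2Z mT c L2'); rewrite (n2Z mT wT c L2') => h.
  exact: ar h a2 b2.
Qed.

Lemma stoch_int0 : stoch_int P Z w 0 0.
Proof.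
have := @stoch_int_simple 0 (fun=> 0) (fun=> set0) (fun k => conj measurable0 (@sub0set _ _)).
by rewrite simple_fctE simple_intE !big_ord0.
Qed.

Lemma stoch_int_sum n (u : nat -> R[i]) (F : nat -> R -> R[i]) (X : nat -> T -> R[i]) :
  (forall k, stoch_int P Z w (F k) (X k)) ->
  stoch_int P Z w (\sum_(k < n) u k *: F k) (\sum_(k < n) u k *: X k).
Proof.
move=> h; elim: n => [|n IH]; first by rewrite !big_ord0; exact: stoch_int0.
by rewrite !big_ord_recr; exact: stoch_int_lin.
Qed.

End fixed_Z.

Definition grid (N k : nat) : R := - pi + k%:R * (2 * pi / N.+1%:R).
Definition cell (N k : nat) : set R := circ `&` `[grid N k, grid N k.+1[%classic.

Lemma cell_arc N k : borel_arc (cell N k).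
Proof.
split; last by move=> x [].
by apply: measurableI; [exact: measurable_circ|exact: measurable_itv].
Qed.

(** The integrals of [E j] against [Z_xi] and against [Z_eta] come with unrelated simple
    approximants. Step functions on an explicit grid, close to [E j] in [L_2(f + g)], serve both
    measures at once. *)
Lemma simple_approx j w e : wcirc w -> leb.-integrable circ (EFin \o w) -> 0 < e ->
  exists n u A, (forall k, borel_arc (A k)) /\ Nw w (E j - simple_fct n u A) < e.
Proof.
move=> ww iw e0.
(* There are [N.+2] cells: the interval is cut into [N.+1] half-open pieces, and the last cell is
   the single point [pi]. *)
pose S N := simple_fct N.+2 (fun k => E j (grid N k)) (cell N).
pose r (N : nat) (x : R) : R := grid N (Num.truncn ((x + pi) / (2 * pi / N.+1%:R))).
have step N : 0 < 2 * pi / N.+1%:R :> R by rewrite divr_gt0// mulr_gt0// pi_gt0.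
have key N x : circ x -> S N x = E j (r N x) /\ `|r N x - x| <= 2 * pi / N.+1%:R.
  rewrite /circ /= in_itv /= => /andP[x1 x2].
  set s := 2 * pi / N.+1%:R in step *.
  have s0 : 0 < s := step N.
  set y := (x + pi) / s.
  have y0 : 0 <= y by rewrite divr_ge0 ?(ltW s0)//; lra.
  have /andP[k1 k2] := Num.Theory.truncn_itv y0.
  set k := Num.truncn y in k1 k2.
  have xE : x = - pi + y * s by rewrite /y divfK ?gt_eqF//; ring.
  have kN : (k < N.+2)%N.
    rewrite -(ltr_nat R) (le_lt_trans k1)//.
    rewrite /y ltr_pdivrMr// /s mulrA ltr_pdivlMr// mulrC.
    have N0 : 0 < N.+1%:R :> R by [].
    have -> : N.+2%:R = N.+1%:R + 1 :> R by rewrite -natr1.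
    have := pi_gt0 R; move: (N.+1%:R : R) N0 => q q0 p0; nra.
  have cellE i : (x \in cell N i) = (i == k).
    apply/idP/idP; rewrite ?inE.
      move=> [_]; rewrite /= in_itv /= /grid -/s => /andP[h1 h2].
      rewrite eq_sym; apply/eqP/Num.Theory.truncn_def.
      rewrite /y ler_pdivlMr// ltr_pdivrMr//; apply/andP; split; lra.
    move=> /eqP ->; split; first by rewrite /circ /= in_itv /= x1 x2.
    rewrite /= in_itv /= /grid -/s; apply/andP; split.
      by rewrite [leRHS]xE lerD2l ler_pM2r.
    by rewrite [ltLHS]xE ltrD2l ltr_pM2r.
  split.
    rewrite /S /simple_fct (bigD1 (Ordinal kN))//= big1 ?addr0.
      by rewrite indicE cellE eqxx mulr1.
    move=> i ik; rewrite indicE cellE (_ : (_ == _) = false) ?mulr0//.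
    by apply: contraNF ik => /eqP h; apply/eqP/val_inj.
  have rE : r N x = - pi + k%:R * s by [].
  have -> : r N x - x = (k%:R - y) * s by rewrite rE [X in _ - X = _]xE; ring.
  rewrite normrM.
  by rewrite (ger0_norm (ltW s0)) ler_piMl ?(ltW s0)// ler_norml; apply/andP; split; lra.
have mS N : mcirc (S N) by have [] := L2_simple N.+2 (fun k => E j (grid N k)) ww iw (cell_arc N).
have c : Nw w (S n - E j) @[n --> \oo] --> (0 : R).
  apply: (n2_dominated mC ww mS (cmeasurable_E j circ) (rintegrableZ mC 4 iw)).
    move=> N x Dx; have [_ w0] := ww; rewrite ler_wpM2r ?w0//.
    rewrite (key N x Dx).1; apply: le_trans (abs2D_le _ _) _.
    by rewrite abs2N !abs2_E; lra.
  apply: aeW => x Dx.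
  have cr : r n x @[n --> \oo] --> x.
    apply/subr_cvg0/norm_cvg0P.
    have ch : 2 * pi * harmonic n @[n --> \oo] --> (0 : R).
      by rewrite -(mulr0 (2 * pi)); apply: cvgM; [exact: cvg_cst|exact: cvg_harmonic].
    apply: (squeeze_cvgr _ (cvg_cst 0) ch); apply: nearW => n.
    by rewrite normr_ge0 (key n x Dx).2.
  have -> : S^~ x = fun n => E j (r n x) by apply/funext => n; rewrite (key n x Dx).1.
  have cj : j%:~R * r n x @[n --> \oo] --> j%:~R * x by apply: cvgM => //; exact: cvg_cst.
  split; rewrite /E /=.
    by apply: (cvg_comp _ _ cj); exact: continuous_cos.
  by apply: (cvg_comp _ _ cj); exact: continuous_sin.
have [N hN] := eventually_small e0 c.
exists N.+2, (fun k => E j (grid N k)), (cell N); split; first exact: cell_arc.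
rewrite n2BC//; [exact: L2_E|apply: L2_simple => // k; exact: cell_arc].
Qed.

Section sum_measure.
Variables (f g : R -> R) (Zf Zg : set R -> T -> R[i]).
Hypotheses (wf : wcirc f) (wg : wcirc g).
Hypotheses (iF : leb.-integrable circ (EFin \o f)) (iG : leb.-integrable circ (EFin \o g)).
Hypotheses (oF : orth_measure P Zf f) (oG : orth_measure P Zg g).
Local Notation w := (fun x => f x + g x).
Local Notation Z := (fun S t => Zf S t + Zg S t).

Lemma weightD : wcirc w.
Proof.
have [m1 p1] := wf; have [m2 p2] := wg; split; first exact: measurable_funD.
by move=> x Dx; rewrite addr_ge0 ?p1 ?p2.
Qed.

Lemma integrable_weightD : leb.-integrable circ (EFin \o w).
Proof. exact: rintegrableD. Qed.

Lemma L2_weightD F : Lw w F <-> Lw f F /\ Lw g F.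
Proof.
split=> [LF|[[mF i1] [_ i2]]].
  have mF := LF.1.
  have [p1 p2] := (wf.2, wg.2).
  have [L1 _] := L2_dom mC (k := 1) weightD wf LF mF (fun x Dx =>
     ltac:(rewrite mul1r ler_wpM2l ?abs2_ge0// lerDl; exact: p2)).
  have [L2' _] := L2_dom mC (k := 1) weightD wg LF mF (fun x Dx =>
     ltac:(rewrite mul1r ler_wpM2l ?abs2_ge0// lerDr; exact: p1)).
  by split.
split=> //; apply: (rintegrable_ext mC _ (rintegrableD mC i1 i2)) => x _.
by rewrite mulrDr.
Qed.

Lemma n2_weightD F : Lw w F -> Nw w F = Nw f F + Nw g F.
Proof.
move=> /L2_weightD[[_ i1] [_ i2]]; rewrite /n2 -RintegralD//.
by apply: eq_Rintegral => x _; rewrite mulrDr.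
Qed.

Lemma cip_weightD F G : Lw w F -> Lw w G -> Cw w F G = Cw f F G + Cw g F G.
Proof.
move=> /L2_weightD[F1 F2] /L2_weightD[G1 G2].
rewrite /cip -cintegralD//; [|exact: cip_int|exact: cip_int].
by apply: cintegral_ext => x _; rewrite rmorphD mulrDr.
Qed.

Let twopi : 0 <= (2 * pi)^-1 :> R.
Proof. by rewrite invr_ge0 mulr_ge0 ?pi_ge0. Qed.

(** The cross terms between [Zf] and [Zg] are absorbed by [n2D_le], at the price of a factor 2. *)
Lemma sum_bounded_int : bounded_int P Z w (2 * (2 * pi)^-1).
Proof.
move=> n u A hA.
have [L1 b1] := orth_bounded_int wf iF oF n u hA.
have [L2' b2] := orth_bounded_int wg iG oG n u hA.
have -> : simple_int Z n u A = simple_int Zf n u A + simple_int Zg n u A.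
  rewrite !simple_intE -big_split /=; apply: eq_bigr => k _.
  by rewrite -scalerDr.
split; first exact: L2D.
apply: le_trans (n2D_le mT wT L1 L2') _.
rewrite n2_weightD; last exact: (L2_simple n u weightD integrable_weightD hA).
by rewrite -mulrA mulrDr mulrDr; apply: lerD; rewrite ler_pM2l.
Qed.

Lemma stoch_int_add j X Y : stoch_int P Zf f (E j) X -> stoch_int P Zg g (E j) Y ->
  stoch_int P Z w (E j) (X + Y).
Proof.
move=> sX sY.
have bF := orth_bounded_int wf iF oF; have bG := orth_bounded_int wg iG oG.
have [_ LX _] := (stoch_intP _ _ wf iF bF).1 sX.
have [_ LY _] := (stoch_intP _ _ wg iG bG).1 sY.
have wD := weightD; have iD := integrable_weightD.
apply: (stoch_int_limit wD iD sum_bounded_int); first exact: L2_E.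
  exact: L2D.
move=> e e0.
(* [stoch_int_bound] contributes [16 (2 pi)^-1] for each of the two measures and [n2D_le] doubles;
   the summand 1 ensures [e / k <= e]. *)
pose k : R := 2 * (16 * (2 * pi)^-1) + 1.
have k0 : 0 < k by rewrite ltr_wpDl// !mulr_ge0.
have d0 : 0 < e / k by rewrite divr_gt0.
have [n [u [A [hA hS]]]] := simple_approx j wD iD d0.
exists (simple_fct n u A), (simple_int Z n u A); split.
- exact: (stoch_int_simple wD iD sum_bounded_int).
- apply: lt_le_trans hS _; rewrite ler_pdivrMr// ler_peMr ?(ltW e0)//.
  by rewrite lerDr !mulr_ge0.
- have b1 := stoch_int_bound wf iF twopi bF sX (stoch_int_simple wf iF bF n u hA).
  have b2 := stoch_int_bound wg iG twopi bG sY (stoch_int_simple wg iG bG n u hA).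
  have [LS1 _] := bF n u A hA; have [LS2 _] := bG n u A hA.
  have -> : X + Y - simple_int Z n u A = (X - simple_int Zf n u A) + (Y - simple_int Zg n u A).
    rewrite addrACA -opprD; congr (_ + _ - _).
    rewrite !simple_intE -big_split /=; apply: eq_bigr => i _.
    by rewrite -scalerDr.
  apply: le_lt_trans (n2D_le mT wT (L2B mT wT LX LS1) (L2B mT wT LY LS2)) _.
  move: hS; rewrite n2_weightD; last first.
    by apply: L2B => //; [exact: L2_E|exact: L2_simple].
  rewrite ltr_pdivlMr//.
  have := n2_ge0 leb (E j - simple_fct n u A) wf.
  have := n2_ge0 leb (E j - simple_fct n u A) wg.
  move: b1 b2; rewrite /k.
  move: (NP _) (NP _) (Nw f _) (Nw g _) ((2 * pi)^-1) => q1 q2 q3 q4 q5.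
  move=> b1 b2 p4 p3; rewrite mulrDr mulr1; nra.
Qed.

End sum_measure.
End Stochastic_integral_limits.

(** * Toeplitz operators *)

Section Frequency_domain.
Context {R : realType}.
Implicit Types (w : R -> R) (F : R -> R[i]) (u : {poly R[i]}) (a : nat -> R[i]).
Local Notation leb := (@lebesgue_measure R).
Local Notation Lw := (L2 leb circ).
Local Notation Nw := (n2 leb circ).
Local Notation Cw := (cip leb circ).
Let mC := @measurable_circ R.
Let ww1 := @weight1 R.
Let iw1 := @integrable_cst_circ R 1.

Lemma weightV w : wcirc w -> wcirc (fun x => (w x)^-1).
Proof.
move=> [mw w0]; split; first exact: measurable_funV.
by move=> x Dx; rewrite invr_ge0 w0.
Qed.

(** The hypothesis uses the inverse in [\bar R], infinite at [0], so its integrability forces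
    [w > 0] almost everywhere. The real inverse, which is [0] at [0], is then integrable by
    comparison. *)
Lemma minimality_weight w : wcirc w ->
  (\int[leb]_(x in circ) ((w x)%:E)^-1 < +oo)%E ->
  {ae leb, forall x, circ x -> 0 < w x} /\
  leb.-integrable circ (EFin \o (fun x => (w x)^-1)).
Proof.
move=> ww hint; have [mw w0] := ww.
pose q x : \bar R := if w x == 0 then +oo%E else ((w x)^-1)%:E.
have qE x : ((w x)%:E)^-1%E = q x by [].
have mq : measurable_fun (circ : set (measurableTypeR R)) q.
  apply: measurable_fun_if => //.
  - by apply: measurable_fun_eqr => //; exact: measurable_cst.
  - apply: (measurable_funS (E := circ)) => //.
    by apply/measurable_EFinP; exact: measurable_funV.
have q0 x : circ x -> (0 <= q x)%E.
  by move=> Dx; rewrite /q; case: ifP => // _; rewrite lee_fin invr_ge0 w0.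
have iq : leb.-integrable circ q.
  apply/integrableP; split => //.
  rewrite (_ : integral _ _ _ = \int[leb]_(x in circ) ((w x)%:E)^-1)%E//.
  by apply: eq_integral => x; rewrite inE => Dx; rewrite gee0_abs ?q0.
have ae0 := integrable_ae mC iq.
have wpos : {ae leb, forall x, circ x -> 0 < w x}.
  apply: (ae_imp _ ae0) => x h Dx; have := h Dx; rewrite /q.
  by case: ifPn => // wn _; rewrite lt_def wn w0.
split=> //; apply/integrableP; split.
  by apply/measurable_EFinP; exact: measurable_funV.
move: iq => /integrableP[_]; apply: le_lt_trans.
apply: ge0_le_integral => //.
- by apply: measurableT_comp => //; apply/measurable_EFinP; exact: measurable_funV.
- exact: measurableT_comp.
- by move=> x Dx; rewrite /q /=; case: ifPn => [/eqP ->|_]//; rewrite leey.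
Qed.

Lemma cmodD (z1 z2 : R[i]) : cmod (z1 + z2) <= cmod z1 + cmod z2.
Proof.
have h (z : R[i]) : cmod z = Normc.normc z by case: z.
by rewrite !h; exact: le_normcD.
Qed.

Lemma cmod_sum n (z : nat -> R[i]) : cmod (\sum_(k < n) z k) <= \sum_(k < n) cmod (z k).
Proof.
elim: n => [|n IH]; first by rewrite !big_ord0 /cmod abs20 sqrtr0.
by rewrite !big_ord_recr; apply: le_trans (cmodD _ _) _; rewrite lerD2r.
Qed.

Definition trig a n : R -> R[i] := \sum_(j < n) a j *: E j%:Z.

Lemma trigE a n x : trig a n x = \sum_(j < n) a j * expi (j%:R * x).
Proof. by rewrite /trig fct_sumE. Qed.

Section symbol.
Variable a : nat -> R[i].
Hypothesis a_sum : (\sum_(0 <= j <oo) (Num.sqrt (abs2 (a j)))%:E < +oo)%E.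

Lemma abs_summable : cvgn (series (fun j => cmod (a j))).
Proof. by apply: nnseries_is_cvg => // j; exact: cmod_ge0. Qed.

Lemma symA_cvg x : ccvg (fun n => trig a n x) (symA a x).
Proof.
have dom (p : nat -> R) : (forall j, `|p j| <= cmod (a j)) -> cvgn (series p).
  move=> h; apply: normed_cvg; apply: (series_le_cvg _ _ h abs_summable) => n.
    exact: normr_ge0.
  exact: cmod_ge0.
have bd j : abs2 (a j * expi (j%:R * x)) <= cmod (a j) ^+ 2.
  by rewrite sqr_cmod abs2M abs2_expi mulr1.
have cR := dom _ (fun j => normRe_le (cmod_ge0 (a j)) (bd j)).
have cI := dom _ (fun j => normIm_le (cmod_ge0 (a j)) (bd j)).
split.
  rewrite (_ : (fun n => _) = series (fun j => Re (a j * expi (j%:R * x))))//.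
  by apply/funext => n; rewrite trigE Re_sum /series /= big_mkord.
rewrite (_ : (fun n => _) = series (fun j => Im (a j * expi (j%:R * x))))//.
by apply/funext => n; rewrite trigE Im_sum /series /= big_mkord.
Qed.

Lemma trig_bounded : exists s, forall n x, abs2 (trig a n x) <= s.
Proof.
pose s := limn (series (fun j => cmod (a j))).
exists (s ^+ 2) => n x; rewrite -sqr_cmod.
have h : cmod (trig a n x) <= s.
  rewrite trigE; apply: le_trans (cmod_sum n (fun j => a j * expi (j%:R * x))) _.
  have -> : \sum_(k < n) cmod (a k * expi (k%:R * x)) = series (fun j => cmod (a j)) n.
    rewrite /series /= big_mkord; apply: eq_bigr => k _.
    by rewrite /cmod abs2M abs2_expi mulr1.
  apply: nondecreasing_cvgn_le; last exact: abs_summable.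
  by apply: nondecreasing_series => // j _ _; exact: cmod_ge0.
by rewrite ler_sqr ?nnegrE ?cmod_ge0// (le_trans (cmod_ge0 _) h).
Qed.

Lemma cmeasurable_trig (b : nat -> R[i]) n : mcirc (trig b n).
Proof. by have [] := L2_sum (mu := leb) (D := circ) mC ww1 (index_enum 'I_n) xpredT
  (F := fun j => b j *: E j%:Z) (fun k => L2Z mC (b k) (L2_E k%:Z ww1 iw1)). Qed.

Lemma cmeasurable_symA : mcirc (symA a).
Proof.
split.
  apply: (@measurable_fun_cvg _ _ _ circ (fun n x => Re (trig a n x))).
    by move=> n; case: (cmeasurable_trig a n).
  by move=> x _; case: (symA_cvg x).
apply: (@measurable_fun_cvg _ _ _ circ (fun n x => Im (trig a n x))).
  by move=> n; case: (cmeasurable_trig a n).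
by move=> x _; case: (symA_cvg x).
Qed.

Lemma symA_L2 v : wcirc v -> leb.-integrable circ (EFin \o v) ->
  [/\ Lw v (symA a), forall n, Lw v (trig a n) &
   Nw v (trig a n - symA a) @[n --> \oo] --> (0 : R)].
Proof.
move=> wv iv; have [s hs] := trig_bounded.
have hA x : abs2 (symA a x) <= s.
  have /ccvg_abs2P h := symA_cvg x.
  have [cR cI] := symA_cvg x.
  have c : abs2 (trig a n x) @[n --> \oo] --> abs2 (symA a x).
    by rewrite /abs2; under eq_fun do rewrite !expr2; rewrite !expr2;
       apply: cvgD; apply: cvgM.
  by apply: (@cvgr_to_le _ _ _ _ _ _ _ c); apply: nearW => n; exact: hs.
have LA : Lw v (symA a).
  by have [] := L2_bounded mC wv iv cmeasurable_symA (fun x _ => hA x).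
have Ln n : Lw v (trig a n).
  by have [] := L2_bounded mC wv iv (cmeasurable_trig a n) (fun x _ => hs n x).
split=> //.
apply: (n2_dominated mC wv (cmeasurable_trig a) cmeasurable_symA (rintegrableZ mC (4 * s) iv)).
  move=> n x Dx; have [_ v0] := wv; rewrite ler_wpM2r ?v0//.
  by apply: le_trans (abs2D_le _ _) _; rewrite abs2N; have := hs n x; have := hA x; lra.
by apply: aeW => x _; exact: symA_cvg.
Qed.

End symbol.

Lemma cip1_E (j k : int) : Cw (fun=> 1) (E j) (E k) = if j == k then (2 * pi)%:C%C else 0.
Proof.
rewrite /cip -(subr_eq0 j k) -cintegral_E.
by apply: cintegral_ext => x _; rewrite mulr1 E_conj E_mul.
Qed.

Lemma L2_E1 (j : int) : Lw (fun=> 1) (E j).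
Proof. exact: L2_E. Qed.

Lemma parseval_trig (c : nat -> R[i]) n :
  Nw (fun=> 1) (trig c n) = 2 * pi * \sum_(k < n) abs2 (c k).
Proof.
have L1 : Lw (fun=> 1) (trig c n) by apply: L2_sum => // k; apply: L2Z => //; exact: L2_E1.
have := cip_self mC L1; rewrite /trig (gram mC ww1 n n c c (fun k => L2_E1 k) (fun k => L2_E1 k)).
move=> /(congr1 (@complex.Re R)) /= <-; rewrite Re_sum mulr_sumr; apply: eq_bigr => j _.
rewrite (bigD1 j)//= big1 ?addr0.
  by rewrite cip1_E eqxx mulJ -rmorphM mulrC.
move=> k kj; rewrite cip1_E ifF ?mulr0//; apply/negbTE.
by apply: contra kj => /eqP[/ord_inj ->].
Qed.

Lemma toeplitzE w (j k : nat) : toeplitz w j k = (2 * pi)^-1%:C%C * Cw w (E k%:Z) (E j%:Z).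
Proof.
congr (_ * _); apply: cintegral_ext => x _; congr (_ * _).
by rewrite E_conj E_mul /E opprB intrD intrN.
Qed.

Lemma toeplitz_row w (v : nat -> R[i]) n j : wcirc w -> leb.-integrable circ (EFin \o w) ->
  \sum_(k < n) toeplitz w j k * v k = (2 * pi)^-1%:C%C * Cw w (trig v n) (E j%:Z).
Proof.
move=> ww iw; rewrite /trig (cip_suml mC ww n v (fun k => L2_E k%:Z ww iw) (L2_E j%:Z ww iw)).
by rewrite mulr_sumr; apply: eq_bigr => k _; rewrite toeplitzE mulrCA mulrC mulrA.
Qed.

Lemma pe_trig u n : (size u <= n)%N -> pe u = trig (fun k => u`_k) n.
Proof. by move=> h; apply/funext => x; rewrite (pe_sum x h) trigE. Qed.

(** Translates the Cauchy condition for the quadratic form in [mat_op] into a Cauchy condition in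
    [L_2(w)]. *)
Lemma mat_form_toeplitz w u : wcirc w -> leb.-integrable circ (EFin \o w) ->
  mat_form (toeplitz w) u = ((2 * pi)^-1 * Nw w (pe u))%:C%C.
Proof.
move=> ww iw; have Lu := L2_pe u ww iw.
rewrite -[RHS](_ : (2 * pi)^-1%:C%C * Cw w (pe u) (pe u) = _); last first.
  by rewrite cip_self// -rmorphM.
rewrite (pe_trig (leqnn _)) /trig.
rewrite (gram mC ww _ _ _ _ (fun k => L2_E k%:Z ww iw) (fun k => L2_E k%:Z ww iw)).
rewrite /mat_form exchange_big mulr_sumr; apply: eq_bigr => k _.
rewrite mulr_sumr; apply: eq_bigr => j _; rewrite toeplitzE -!mulrA; congr (_ * _).
by rewrite mulrC mulrA.
Qed.

End Frequency_domain.

(** * Square summable coefficients and the domain of a Toeplitz operator *)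

Section Coefficients.
Context {R : realType}.
Implicit Types (v : R -> R) (u : {poly R[i]}).
Local Notation leb := (@lebesgue_measure R).
Local Notation Lw := (L2 leb circ).
Local Notation Nw := (n2 leb circ).
Local Notation Cw := (cip leb circ).
Let mC := @measurable_circ R.
Let ww1 := @weight1 R.
Let iw1 := @integrable_cst_circ R 1.

Lemma ereal_cvg0_real (x : nat -> \bar R) : (forall n, (0 <= x n)%E) ->
  (x n @[n --> \oo] --> 0)%E -> forall e : R, 0 < e ->
  exists N, forall n, (N <= n)%N -> (x n <= e%:E)%E.
Proof.
move=> x0 /fine_cvgP[[N1 _ hN1] /cvgrPdist_le h] e e0.
have [N2 _ hN2] := h e e0; exists (maxn N1 N2) => n; rewrite geq_max => /andP[n1 n2].
have := hN2 n n2; rewrite /= sub0r normrN ger0_norm ?fine_ge0// => hn.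
by rewrite -(fineK (hN1 n n1)) lee_fin.
Qed.

Lemma ell2_small (x : nat -> nat -> R[i]) :
  ((\sum_(0 <= k <oo) (abs2 (x m k))%:E)%E @[m --> \oo] --> 0%E) -> forall e : R, 0 < e ->
  exists M, forall m, (M <= m)%N -> forall n, \sum_(k < n) abs2 (x m k) <= e.
Proof.
move=> h e e0.
have x0 m : (0 <= \sum_(0 <= k <oo) (abs2 (x m k))%:E)%E.
  by apply: nneseries_ge0 => k _ _; rewrite lee_fin abs2_ge0.
have [M hM] := ereal_cvg0_real x0 h e0.
exists M => m /hM hm n; rewrite -lee_fin; apply: le_trans hm.
rewrite -sumEFin -(big_mkord xpredT (fun k => (abs2 (x m k))%:E)).
by apply: nneseries_lim_ge => k _ _; rewrite lee_fin abs2_ge0.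
Qed.

Lemma trigB a b n : trig a n - trig b n = trig (fun k => a k - b k) n :> (R -> R[i]).
Proof.
rewrite /trig -sumrB; apply: eq_bigr => k _; by rewrite -scalerBl.
Qed.

Lemma L2_trig1 c n : Lw (fun=> 1) (trig c n).
Proof. by apply: L2_sum => // k; apply: L2Z => //; exact: L2_E1. Qed.

Section L2_sum_facts.
Variables (c : nat -> R[i]) (C : R -> R[i]).
Hypothesis C_def : is_L2_sum c C.

Lemma is_L2_sum_L2 : Lw (fun=> 1) C.
Proof. by case: C_def => /(in_L2P C ww1). Qed.

Lemma is_L2_sum_small e : 0 < e -> exists N, forall n, (N <= n)%N ->
  Nw (fun=> 1) (trig c n - C) <= e.
Proof.
case: C_def => _ h e0.
have E1 n : wnorm2 (fun=> 1) (fun x => C x - \sum_(k < n) c k * expi (k%:R * x)) =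
    (Nw (fun=> 1) (C - trig c n))%:E.
  rewrite -wnorm2E; last by apply: L2B => //; [exact: is_L2_sum_L2|exact: L2_trig1].
  by congr wnorm2; apply/funext => x; rewrite -trigE.
have x0 n : (0 <= wnorm2 (fun=> 1%R) (fun x => C x - \sum_(k < n) c k * expi (k%:R * x))%R)%E.
  by rewrite E1 lee_fin n2_ge0.
have [N hN] := ereal_cvg0_real x0 h e0; exists N => n /hN.
rewrite E1 lee_fin n2BC//; [exact: is_L2_sum_L2|exact: L2_trig1].
Qed.

Lemma is_L2_sum_cvg : Nw (fun=> 1) (trig c n - C) @[n --> \oo] --> (0 : R).
Proof.
apply/cvgrPdist_le => e /is_L2_sum_small[N hN]; exists N => // n /= /hN.
by rewrite sub0r normrN ger0_norm ?n2_ge0.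
Qed.

Lemma is_L2_sum_orth (k : nat) : Cw (fun=> 1) C (E (- k.+1%:Z)) = 0.
Proof.
have c1 := cip_cvg mC ww1 (L2_trig1 c) (fun=> L2_E1 (- k.+1%:Z)) is_L2_sum_L2 (L2_E1 (- k.+1%:Z))
  is_L2_sum_cvg.
apply: (ccvg_unique (c1 _)).
  rewrite subrr (_ : (fun n => _) = fun=> 0); first exact: cvg_cst.
  by apply/funext => n; rewrite /n2; under eq_Rintegral do rewrite abs20 mul0r;
     rewrite Rintegral_cst_circ mul0r.
rewrite (_ : (fun n => _) = fun=> 0); first exact: ccvg_cst.
apply/funext => n; rewrite /trig (cip_suml mC ww1 n c (fun k => L2_E1 k) (L2_E1 _)).
rewrite big1// => j _; rewrite cip1_E (_ : (_ == _) = false)//.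
exact: mulr0.
Qed.

(** Parseval on a common length for [u] and a long partial sum of [C]; its factor [2 pi] is doubled
    by [n2_triangle], and the remainder [eta] is arbitrary. *)
Lemma pe_near u e : (forall n, \sum_(k < n) abs2 (c k - u`_k) <= e) ->
  Nw (fun=> 1) (pe u - C) <= 4 * pi * e.
Proof.
move=> h; apply/ler_addgt0Pl => eta eta0.
have eta2 : 0 < eta / 2 by rewrite divr_gt0.
have [N hN] := is_L2_sum_small eta2.
pose n := maxn N (size u).
have Lu : Lw (fun=> 1) (pe u) by exact: L2_pe.
apply: le_trans (n2_triangle mC ww1 Lu (L2_trig1 c n) is_L2_sum_L2) _.
have -> : Nw (fun=> 1) (pe u - trig c n) = 2 * pi * \sum_(k < n) abs2 (c k - u`_k).
  rewrite (pe_trig (leq_maxr N (size u))) trigB parseval_trig; congr (_ * _).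
  by apply: eq_bigr => k _; rewrite abs2BC.
have h1 := hN n (leq_maxl _ _); have h2 := h n.
have h3 : 2 * pi * \sum_(k < n) abs2 (c k - u`_k) <= 2 * pi * e.
  by rewrite ler_wpM2l// mulr_ge0 ?pi_ge0.
move: h1 h3; move: (Nw _ _) (\sum_(k < n) _) => q1 q2 h1 h3; lra.
Qed.

(** The approximants of [c] converge to [C] in the unweighted [L_2], hence almost everywhere along a
    subsequence; being Cauchy for the form, they also converge in [L_2(v)], and [L2_fatou]
    identifies that limit with [C]. The entrywise limit then reads: [y] consists of the Fourier
    coefficients of [C v] of nonnegative index. *)
Lemma mat_op_L2 v y : wcirc v -> leb.-integrable circ (EFin \o v) ->
  mat_op (toeplitz v) c y -> Lw v C /\ exists V : nat -> {poly R[i]},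
  [/\ Nw v (pe (V m) - C) @[m --> \oo] --> (0 : R),
      forall e : R, 0 < e -> exists M, forall m, (M <= m)%N ->
        forall n, \sum_(k < n) abs2 (c k - (V m)`_k) <= e &
      forall j : nat, y j = (2 * pi)^-1%:C%C * Cw v C (E j%:Z)].
Proof.
move=> wv iv [_ _ [U [U1 U2 U3]]].
have sm := ell2_small U1.
have ex (i : nat) : exists M, forall m, (M <= m)%N ->
    Nw (fun=> 1) (pe (U m) - C) <= (8^-1) ^+ i.
  have d0 : 0 < (8^-1) ^+ i / (4 * pi) :> R by rewrite divr_gt0 ?exprn_gt0 ?mulr_gt0 ?pi_gt0.
  have [M hM] := sm _ d0; exists M => m Mm.
  apply: le_trans (pe_near (hM m Mm)) _.
  by rewrite mulrC divfK// gt_eqF// mulr_gt0 ?pi_gt0.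
pose M i := projT1 (cid (ex i)).
have MP i : forall m, (M i <= m)%N -> Nw (fun=> 1) (pe (U m) - C) <= (8^-1) ^+ i.
  by rewrite /M; case: (cid (ex i)).
(* Adding [i] makes the index at least [i], so all eventual properties of [U] pass to [V] although
   [M] need not be monotone. *)
pose V i := U (M i + i)%N.
have phi_ge i : (i <= M i + i)%N by rewrite leq_addl.
have Lp u0 : Lw (fun=> 1) (pe u0) by exact: L2_pe.
have LC := is_L2_sum_L2.
have wpos : {ae leb, forall x, circ x -> (0 : R) < 1} by apply: aeW.
have aec := ae_rapid mC ww1 wpos (fun m => L2B mC ww1 (Lp (V m)) LC)
   (fun m => MP m _ (leq_addr _ _)).
have aeV : {ae leb, forall x, circ x -> ccvg (fun m => pe (V m) x) (C x)}.
  by apply: (ae_imp _ aec) => x h Dx; have [k hk] := h Dx; exact: (rapid_ccvg hk).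
have cau e : 0 < e -> exists N, forall n m, (N <= n)%N -> (N <= m)%N ->
    Nw v (pe (V n) - pe (V m)) < e.
  move=> e0.
  have p0 : 0 < (2 * pi)^-1 :> R by rewrite invr_gt0 mulr_gt0 ?pi_gt0.
  (* [mat_op] bounds [abs2] of the form, whose value is itself a squared norm; hence the square. *)
  have d0 : 0 < ((2 * pi)^-1 * e) ^+ 2 by rewrite exprn_gt0// mulr_gt0.
  have [m0 h0] := U2 _ d0; exists m0 => n m nm mm.
  have := h0 _ _ (leq_trans nm (phi_ge n)) (leq_trans mm (phi_ge m)).
  rewrite mat_form_toeplitz// abs2_real ltr_sqr ?nnegrE ?mulr_ge0 ?(ltW p0) ?(ltW e0) ?n2_ge0//.
  by rewrite ltr_pM2l// peB.
have LpV m : Lw v (pe (V m)) by exact: L2_pe.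
have [LvC cV] := L2_fatou mC wv LpV LC.1 aeV cau.
split=> //; exists V; split => //.
  move=> e /sm[M0 hM0]; exists M0 => m Mm; apply: hM0.
  exact: leq_trans Mm (phi_ge m).
move=> j.
have LE := L2_E j%:Z wv iv.
have c0 : Nw v (E j%:Z - E j%:Z) @[n --> \oo] --> (0 : R).
  rewrite subrr (_ : Nw v 0 = 0); first exact: cvg_cst.
  by rewrite /n2; under eq_Rintegral do rewrite abs20 mul0r; rewrite Rintegral_cst_circ mul0r.
have c1 := ccvgM (ccvg_cst (2 * pi)^-1%:C%C) (cip_cvg mC wv LpV (fun=> LE) LvC LE cV c0).
apply: (ccvg_unique _ c1).
have -> : (fun n => (2 * pi)^-1%:C%C * Cw v (pe (V n)) (E j)) =
    fun n => \sum_(k < size (V n)) toeplitz v j k * (V n)`_k.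
  by apply/funext => n; rewrite (toeplitz_row (fun k => (V n)`_k))// -pe_trig.
apply: ccvg_abs2; apply/cvgrPdist_lt => e /(U3 j)[m0 h0]; exists m0 => // n /= m0n.
rewrite sub0r normrN ger0_norm ?abs2_ge0//; apply: h0.
exact: leq_trans m0n (phi_ge n).
Qed.

End L2_sum_facts.
End Coefficients.

(** * Duality between the weights [w] and [1/w], and a vanishing criterion *)

Section Identification.
Context {R : realType}.
Implicit Types (w v : R -> R) (F G : R -> R[i]).
Local Notation leb := (@lebesgue_measure R).
Local Notation Lw := (L2 leb circ).
Local Notation Nw := (n2 leb circ).
Local Notation Cw := (cip leb circ).
Let mC := @measurable_circ R.

Lemma rintegrable_ae (p q : R -> R) : leb.-integrable circ (EFin \o p) ->
  measurable_fun (circ : set (measurableTypeR R)) q ->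
  {ae leb, forall x, circ x -> p x = q x} -> leb.-integrable circ (EFin \o q).
Proof.
move=> ip mq h; have mp := rintegrable_meas ip; move: ip => /integrableP[_ lp].
apply/integrableP; split; first exact/measurable_EFinP.
rewrite (_ : integral _ _ _ = \int[leb]_(x in circ) `|(EFin \o p) x|)%E//.
apply: ae_eq_integral => //; try by apply: measurableT_comp => //; exact/measurable_EFinP.
by apply: (ae_imp _ h) => x hx Dx; rewrite /= hx.
Qed.

Lemma Rintegral_ae (p q : R -> R) :
  measurable_fun (circ : set (measurableTypeR R)) p ->
  measurable_fun (circ : set (measurableTypeR R)) q ->
  {ae leb, forall x, circ x -> p x = q x} -> Rintegral leb circ p = Rintegral leb circ q.
Proof.
move=> mp mq h; congr fine; apply: ae_eq_integral => //; try exact/measurable_EFinP.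
by apply: (ae_imp _ h) => x hx Dx; rewrite hx.
Qed.

Lemma cintegral_ae F G : mcirc F -> mcirc G ->
  {ae leb, forall x, circ x -> F x = G x} -> cintegral leb circ F = cintegral leb circ G.
Proof.
move=> [a b] [c e] h; apply: complex_ext; apply: Rintegral_ae => //;
  by apply: (ae_imp _ h) => x hx Dx; rewrite hx.
Qed.

Lemma cintegrable_ae F G : cintegrable leb circ F -> mcirc G ->
  {ae leb, forall x, circ x -> F x = G x} -> cintegrable leb circ G.
Proof.
move=> [a b] [c e] h; split; [apply: (rintegrable_ae a)|apply: (rintegrable_ae b)] => //;
  by apply: (ae_imp _ h) => x hx Dx; rewrite hx.
Qed.

Section weight.
Variable w : R -> R.
Hypotheses (ww : wcirc w) (iw : leb.-integrable circ (EFin \o w)).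
Hypothesis wpos : {ae leb, forall x, circ x -> 0 < w x}.
Local Notation v := (fun x => (w x)^-1).
Hypothesis iv : leb.-integrable circ (EFin \o v).

Lemma L2_inv_weight F : Lw v F -> Lw w (fun x => F x * (v x)%:C%C).
Proof.
move=> LF; have wv := weightV ww.
have mF : mcirc (fun x => F x * (v x)%:C%C).
  by apply: cmeasurableM; [case: LF|apply: cmeasurable_real; case: wv].
have h x : circ x -> abs2 (F x * (v x)%:C%C) * w x <= 1 * (abs2 (F x) * v x).
  move=> Dx; rewrite abs2M abs2_real mul1r -mulrA ler_wpM2l ?abs2_ge0//.
  have [->|w0] := eqVneq (w x) 0; first by rewrite invr0 expr0n mul0r.
  by rewrite expr2 -mulrA mulVf// mulr1.
by have [] := L2_dom mC wv ww LF mF h.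
Qed.

(** Pairing with [G / w] in [L_2(w)] removes the weight, so plain Fourier coefficients are
    continuous functionals on [L_2(w)]. The integrands agree only where [w] is nonzero. *)
Lemma cip_inv_weight F G : Lw w F -> Lw v G ->
  Cw w F (fun x => G x * (v x)%:C%C) = cintegral leb circ (fun x => F x * (G x)^*%C).
Proof.
move=> LF LG; have wv := weightV ww.
have mv : mcirc (fun x => (v x)%:C%C) by apply: cmeasurable_real; case: wv.
have mw : mcirc (fun x => (w x)%:C%C) by apply: cmeasurable_real; case: ww.
have [mF _] := LF; have [mG _] := LG.
apply: cintegral_ae.
- apply: cmeasurableM => //; apply: cmeasurableM => //; apply: cmeasurable_conj.
  exact: cmeasurableM.
- by apply: cmeasurableM => //; exact: cmeasurable_conj.
apply: (ae_imp _ wpos) => x wx Dx; have {}wx := wx Dx.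
by rewrite conjM conj_real -!mulrA -rmorphM mulVf ?gt_eqF//= mulr1.
Qed.

Lemma cintegrable_L2 F G : Lw w F -> Lw v G ->
  cintegrable leb circ (fun x => F x * (G x)^*%C).
Proof.
move=> LF LG; have wv := weightV ww.
have [mF _] := LF; have [mG _] := LG.
apply: (cintegrable_ae (cip_int mC ww LF (L2_inv_weight LG))).
  by apply: cmeasurableM => //; exact: cmeasurable_conj.
apply: (ae_imp _ wpos) => x wx Dx; have {}wx := wx Dx.
by rewrite conjM conj_real -!mulrA -rmorphM mulVf ?gt_eqF//= mulr1.
Qed.

Lemma cintegral_pe_sum F (S : {poly R[i]}) : cintegrable leb circ F ->
  cintegral leb circ (fun x => F x * pe S x) =
  \sum_(k < size S) S`_k * cintegral leb circ (fun x => F x * E k%:Z x).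
Proof.
move=> cF.
have cFE (k : nat) : cintegrable leb circ (fun x => F x * E k%:Z x).
  apply: (cintegrableM cF (k := 1)); first exact: cmeasurable_E.
  by move=> x _; rewrite abs2_E.
have [_ e] := cintegral_sum mC (size S) (fun k => cintegrableZ mC S`_k (cFE k)).
rewrite (_ : (fun x => _) = fun x => \sum_(k < size S) S`_k * (F x * E k%:Z x)).
  by rewrite e; apply: eq_bigr => k _; rewrite cintegralZ.
apply/funext => x; rewrite peE mulr_sumr; apply: eq_bigr => k _.
by rewrite mulrCA.
Qed.

Lemma vanishing psi : Lw w psi ->
  (forall j : nat, cintegral leb circ (fun x => psi x * (E j%:Z x)^*%C) = 0) ->
  (forall k : nat, Cw w psi (E (- k.+1%:Z)) = 0) -> Nw w psi = 0.
Proof.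
move=> Lpsi h1 h2; have wv := weightV ww.
have LE j : Lw v (E j) by exact: L2_E.
have LEw j : Lw w (E j) by exact: L2_E.
have [mpsi _] := Lpsi.
have mw : mcirc (fun x => (w x)%:C%C) by apply: cmeasurable_real; case: ww.
(* The constant 1 lies in [L_2(1/w)], by minimality, and the product of a function in [L_2(w)] with
   one in [L_2(1/w)] is integrable. *)
have cpsi : cintegrable leb circ psi.
  by apply: (cintegrable_ext mC _ (cintegrable_L2 Lpsi (LE 0))) => x _;
    rewrite E_conj oppr0 E0 mulr1.
pose F x := (psi x)^*%C; pose G x := psi x * (w x)%:C%C.
have cF : cintegrable leb circ F by exact: cintegrable_conj.
have cG : cintegrable leb circ G.
  by apply: (cintegrable_ext mC _ (cip_int mC ww Lpsi (LEw 0))) => x _;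
    rewrite E_conj oppr0 E0 mulr1.
have FG : (fun x => F x * G x) = fun x => psi x * (psi x)^*%C * (w x)%:C%C.
  by apply/funext => x; rewrite /F /G mulrA [_^*%C * _]mulrC.
have cFG : cintegrable leb circ (fun x => F x * G x) by rewrite FG; exact: cip_int.
have aF (S : {poly R[i]}) : cintegral leb circ (fun x => F x * pe S x) = 0.
  rewrite cintegral_pe_sum// big1// => k _.
  rewrite (_ : (fun x => _) = fun x => (psi x * (E k%:Z x)^*%C)^*%C); last first.
    apply/funext => x; rewrite conjM; congr (_ * _).
    by rewrite !E_conj opprK.
  rewrite cintegral_conj//; last exact: cintegrable_L2.
  by rewrite h1 (_ : (0 : R[i])^*%C = 0) ?mulr0//; apply: complex_ext; rewrite ReImE //= oppr0.
have aG (S : {poly R[i]}) : S`_0 = 0 -> cintegral leb circ (fun x => G x * pe S x) = 0.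
  (* [h2] covers strictly negative indices only; the term of frequency 0 disappears because [S] has
     no constant coefficient. *)
  move=> S0; rewrite cintegral_pe_sum// big1// => -[[|k] hk] _ /=; first by rewrite S0 mul0r.
  rewrite (_ : (fun x => _) = fun x => psi x * (E (- k.+1%:Z) x)^*%C * (w x)%:C%C); last first.
    by apply/funext => x; rewrite E_conj opprK mulrAC.
  by rewrite -/(cip leb circ w psi (E (- k.+1%:Z))) h2 mulr0.
have := smirnov cF cG cFG aF aG.
by rewrite FG -/(cip leb circ w psi psi) cip_self// => /(congr1 (@complex.Re R)).
Qed.

End weight.
End Identification.

(** * Linear prediction *)

Section Prediction.
Context {R : realType} {d : measure_display} {T : measurableType d}.
Variables (P : probability T R) (xi eta : int -> T -> R[i]) (f g : R -> R).
Implicit Types (F G : R -> R[i]) (X Y : T -> R[i]) (u a : nat -> R[i]).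
Hypotheses (xi_stat : stationary P xi) (eta_stat : stationary P eta).
Hypothesis xi_eta : mutually_uncorrelated P xi eta.
Hypotheses (xi_f : spectral_density P xi f) (eta_g : spectral_density P eta g).

Local Notation leb := (@lebesgue_measure R).
Local Notation LP := (L2 P setT (fun=> 1)).
Local Notation NP := (n2 P setT (fun=> 1)).
Local Notation CP := (cip P setT (fun=> 1)).
Local Notation Lw := (L2 leb circ).
Local Notation Nw := (n2 leb circ).
Local Notation Cw := (cip leb circ).
Local Notation kap := ((2 * pi)^-1 : R).
Local Notation w := (fun x => f x + g x).
Let mC := @measurable_circ R.
Let mT : measurable [set: T] := measurableT.
Let wT := @weightT R _ T.

Lemma n2B d' (T' : measurableType d') (mu : {measure set T' -> \bar R})
    (D : set T') (v : T' -> R) (F G : T' -> R[i]) :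
  measurable D -> weight D v -> L2 mu D v F -> L2 mu D v G ->
  n2 mu D v (F - G) = n2 mu D v F - 2 * Re (cip mu D v F G) + n2 mu D v G.
Proof.
move=> mD wv LF LG; rewrite n2D ?cipNr ?n2N//; last exact: L2N.
by rewrite ReImE; ring.
Qed.

Lemma spectral_density_weight zeta v : spectral_density P zeta v ->
  wcirc v /\ leb.-integrable circ (EFin \o v).
Proof.
move=> [v0 iv _]; split => //; split; first exact: rintegrable_meas iv.
by move=> x Dx; apply: v0; rewrite inE.
Qed.

Lemma stationary_L2 zeta j : stationary P zeta -> LP (zeta j).
Proof. by move=> [h _ _]; exact/sq_integrableP. Qed.

Lemma spectral_cov zeta v (j k : int) : spectral_density P zeta v ->
  CP (zeta j) (zeta k) = kap%:C%C * Cw v (E j) (E k).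
Proof.
move=> [_ _ h]; rewrite -covarE; have := h k (j - k); rewrite addrC subrK => ->.
by congr (_ * _); apply: cintegral_ext => x _; rewrite E_conj E_mul.
Qed.

Let wf : wcirc f. Proof. by case: (spectral_density_weight xi_f). Qed.
Let wg : wcirc g. Proof. by case: (spectral_density_weight eta_g). Qed.
Let iF : leb.-integrable circ (EFin \o f). Proof. by case: (spectral_density_weight xi_f). Qed.
Let iG : leb.-integrable circ (EFin \o g). Proof. by case: (spectral_density_weight eta_g). Qed.
Let ww : wcirc w := weightD wf wg.
Let iw : leb.-integrable circ (EFin \o w) := integrable_weightD iF iG.
Let Lxi j : LP (xi j) := stationary_L2 j xi_stat.
Let Leta j : LP (eta j) := stationary_L2 j eta_stat.

Definition observed (j : int) : T -> R[i] := xi j + eta j.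

Lemma L2_observed j : LP (observed j). Proof. exact: L2D. Qed.

Lemma cip_xi_eta j k : CP (xi j) (eta k) = 0.
Proof. by rewrite -covarE xi_eta. Qed.

Lemma cip_eta_xi j k : CP (eta j) (xi k) = 0.
Proof.
rewrite (cip_conj mT wT (Lxi k) (Leta j)) cip_xi_eta.
by apply: complex_ext; rewrite ReImE //= oppr0.
Qed.

Lemma cov_xi_observed j k : CP (xi j) (observed k) = kap%:C%C * Cw f (E j) (E k).
Proof. by rewrite cipDr// cip_xi_eta addr0 (spectral_cov _ _ xi_f). Qed.

Lemma cov_observed j k : CP (observed j) (observed k) = kap%:C%C * Cw w (E j) (E k).
Proof.
rewrite cipDl//; last exact: L2_observed.
rewrite cov_xi_observed cipDr// cip_eta_xi add0r (spectral_cov _ _ eta_g) -mulrDr.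
by rewrite (cip_weightD wf wg)//; exact: L2_E.
Qed.

Definition Xsum a n : T -> R[i] := \sum_(j < n) a j *: xi j%:Z.
Definition Ysum n u : T -> R[i] := \sum_(k < n) u k *: observed (- k.+1%:Z).

Lemma negtrigE n u : negtrig n u = \sum_(k < n) u k *: E (- k.+1%:Z) :> (R -> R[i]).
Proof.
apply/funext => x; rewrite fct_sumE /negtrig; apply: eq_bigr => k _.
by rewrite /E intrN.
Qed.

Lemma YsumE n u : Ysum n u = fun t => \sum_(k < n) u k * (xi (- k.+1%:Z) t + eta (- k.+1%:Z) t).
Proof. by apply/funext => t; rewrite /Ysum fct_sumE. Qed.

Lemma XsumE a n : Xsum a n = fun t => \sum_(j < n) a j * xi j%:Z t.
Proof. by apply/funext => t; rewrite /Xsum fct_sumE. Qed.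

Lemma L2_Xsum a n : LP (Xsum a n).
Proof. by apply: L2_sum => // j; exact: L2Z. Qed.
Lemma L2_Ysum n u : LP (Ysum n u).
Proof. by apply: L2_sum => // j; apply: L2Z => //; exact: L2_observed. Qed.
Lemma L2_negtrig v n u : wcirc v -> leb.-integrable circ (EFin \o v) -> Lw v (negtrig n u).
Proof. by move=> wv iv; rewrite negtrigE; apply: L2_sum => // j; apply: L2Z => //; exact: L2_E. Qed.
(** Bilinearity carries an identity between covariances and weighted integrals over to finite
    combinations; it is used for the pairs observed-observed, signal-observed and signal-signal. *)
Lemma gram_transfer v (U V : nat -> T -> R[i]) (s r : nat -> int) n m (a b : nat -> R[i]) :
  wcirc v -> leb.-integrable circ (EFin \o v) ->
  (forall k, LP (U k)) -> (forall k, LP (V k)) ->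
  (forall j k, CP (U j) (V k) = kap%:C%C * Cw v (E (s j)) (E (r k))) ->
  CP (\sum_(j < n) a j *: U j) (\sum_(k < m) b k *: V k) =
  kap%:C%C * Cw v (\sum_(j < n) a j *: E (s j)) (\sum_(k < m) b k *: E (r k)).
Proof.
move=> wv iv LU LV h; rewrite (gram mT wT n m a b LU LV).
rewrite (gram mC wv n m a b (fun k => L2_E (s k) wv iv) (fun k => L2_E (r k) wv iv)).
rewrite mulr_sumr; apply: eq_bigr => j _; rewrite mulr_sumr; apply: eq_bigr => k _.
by rewrite h mulrCA.
Qed.

Lemma cip_YY n u m u' : CP (Ysum n u) (Ysum m u') =
  kap%:C%C * Cw w (negtrig n u) (negtrig m u').
Proof.
rewrite !negtrigE; apply: (gram_transfer (U := fun k => observed (- k.+1%:Z))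
  (V := fun k => observed (- k.+1%:Z)) (s := fun k => - k.+1%:Z) (r := fun k => - k.+1%:Z)) => //.
- by move=> k; exact: L2_observed.
- by move=> k; exact: L2_observed.
- by move=> j k; exact: cov_observed.
Qed.

Lemma cip_XY a n m u : CP (Xsum a n) (Ysum m u) =
  kap%:C%C * Cw f (trig a n) (negtrig m u).
Proof.
rewrite !negtrigE; apply: (gram_transfer (U := fun k => xi k%:Z)
  (V := fun k => observed (- k.+1%:Z)) (s := fun k => k%:Z) (r := fun k => - k.+1%:Z)) => //.
- by move=> k; exact: L2_observed.
- by move=> j k; exact: cov_xi_observed.
Qed.

Lemma cip_XX a n m (b : nat -> R[i]) : CP (Xsum a n) (Xsum b m) = kap%:C%C * Cw f (trig a n) (trig b m).
Proof.
apply: (gram_transfer (U := fun k => xi k%:Z)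
  (V := fun k => xi k%:Z) (s := fun k => k%:Z) (r := fun k => k%:Z)) => //.
by move=> j k; exact: (spectral_cov _ _ xi_f).
Qed.

Lemma NP_Ysum n u : NP (Ysum n u) = kap * Nw w (negtrig n u).
Proof.
have := cip_self mT (L2_Ysum n u).
rewrite cip_YY cip_self//; last exact: L2_negtrig.
by rewrite -rmorphM => /(congr1 (@complex.Re R)) /= <-.
Qed.

(** An exact isometry, in contrast with the inequality for stochastic integrals: the covariances of
    [xi] and [eta] are known, those between [Z_xi] and [Z_eta] are not. *)
Lemma NP_YsumB n u m u' : NP (Ysum n u - Ysum m u') = kap * Nw w (negtrig n u - negtrig m u').
Proof.
rewrite (n2B mT wT (L2_Ysum n u) (L2_Ysum m u')).
rewrite (n2B mC ww (L2_negtrig n u ww iw) (L2_negtrig m u' ww iw)).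
rewrite !NP_Ysum cip_YY cReM /= mul0r subr0; ring.
Qed.

Lemma linear_estimateP Y : linear_estimate P (fun j t => xi j t + eta j t) Y <->
  LP Y /\ forall e : R, 0 < e -> exists n u, NP (Y - Ysum n u) < e.
Proof.
split=> [[/sq_integrableP LY h]|[LY h]].
  split=> // e /h[n [u hu]]; exists n, u.
  by rewrite -lte_fin -msnormE ?YsumE//; apply: L2B => //; rewrite -YsumE; exact: L2_Ysum.
split; first exact/sq_integrableP.
move=> e /h[n [u hu]]; exists n, u.
rewrite [X in (X < _)%E](_ : _ = msnorm P (Y - Ysum n u)); last by rewrite YsumE.
by rewrite msnormE ?lte_fin//; apply: L2B => //; exact: L2_Ysum.
Qed.

(** The perturbations against which optimality is tested; the approximating sums are padded with
    zeros so that the index [k] fits. *)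
Lemma linear_estimate_shift Y c k : linear_estimate P (fun j t => xi j t + eta j t) Y ->
  linear_estimate P (fun j t => xi j t + eta j t) (Y + c *: observed (- k.+1%:Z)).
Proof.
move=> /linear_estimateP[LY h]; apply/linear_estimateP; split.
  by apply: L2D => //; apply: L2Z => //; exact: L2_observed.
move=> e /h[n [u hu]].
exists (maxn n k.+1), (fun j => (if (j < n)%N then u j else 0) + (if j == k then c else 0)).
rewrite (_ : _ - _ = Y - Ysum n u)//.
have -> : Ysum (maxn n k.+1) (fun j => (if (j < n)%N then u j else 0) + (if j == k then c else 0)) =
   Ysum n u + c *: observed (- k.+1%:Z).
  rewrite /Ysum; under eq_bigr => j _ do rewrite scalerDl.
  rewrite big_split /=; congr (_ + _).
    rewrite (big_ord_widen_cond (maxn n k.+1) xpredT (fun j => u j *: observed (- j.+1%:Z)))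
      ?leq_maxl// [RHS]big_mkcond /=.
    by apply: eq_bigr => j _; case: ifP => // _; rewrite scale0r.
  have kk : (k < maxn n k.+1)%N by rewrite leq_max ltnSn orbT.
  rewrite (bigD1 (Ordinal kk))//= eqxx big1 ?addr0// => j jk.
  rewrite (_ : (_ == _) = false) ?scale0r//.
  by apply: contraNF jk => /eqP h0; apply/eqP/val_inj.
by rewrite opprD addrACA subrr addr0.
Qed.

Lemma optimal_orth X Y k : LP X ->
  optimal_estimate P (fun j t => xi j t + eta j t) X Y ->
  CP X (observed (- k.+1%:Z)) = CP Y (observed (- k.+1%:Z)).
Proof.
move=> LX [lY hY]; have /linear_estimateP[LY _] := lY.
set zk := observed _; have Lz : LP zk by exact: L2_observed.
pose D := X - Y; have LD : LP D by exact: L2B.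
apply/eqP; rewrite -subr_eq0 -cipBl// -/D; apply/eqP/abs2_eq0.
set z := CP D zk.
(* Perturbing [Y] by [t z zk], with [z] the covariance to be annihilated, turns optimality into a
   quadratic in [t] with constant term 0; its discriminant gives [|z|^4 <= 0]. *)
have h t : 0 <= 0 + 2 * (- abs2 z) * t + (abs2 z * NP zk) * t ^+ 2.
  have := hY _ (linear_estimate_shift (t%:C%C * z) k lY); rewrite -/zk.
  rewrite [X in (X <= _)%E](_ : _ = (NP D)%:E); last first.
    by rewrite -msnormE.
  have Lc : LP ((t%:C%C * z) *: zk) by exact: L2Z.
  rewrite [X in (_ <= X)%E](_ : _ = msnorm P (D - (t%:C%C * z) *: zk)); last first.
    by congr msnorm; apply/funext => s; rewrite /D /= !fctE; ring.
  rewrite msnormE ?lee_fin; last exact: L2B.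
  rewrite (n2B mT wT LD Lc) cipZr// n2Z// -/z conjM conj_real -mulrA [_^*%C * _]mulrC mulJ.
  rewrite cReM /= mul0r subr0 abs2M abs2_real; lra.
have := discriminant_le h; rewrite mul0r sqrrN => h2.
by apply/eqP; rewrite -sqrf_eq0 eq_le h2 sqr_ge0.
Qed.

End Prediction.

(** * Matrix products and [ell_2] inner products as weighted integrals *)

Section Spectral.
Context {R : realType}.
Implicit Types (F G : R -> R[i]).
Local Notation leb := (@lebesgue_measure R).
Local Notation Lw := (L2 leb circ).
Local Notation Nw := (n2 leb circ).
Local Notation Cw := (cip leb circ).
Local Notation kap := ((2 * pi)^-1 : R).
Let mC := @measurable_circ R.
Let ww1 := @weight1 R.

Lemma cip_cvgl d' (T' : measurableType d') (mu : {measure set T' -> \bar R})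
    (D : set T') (v : T' -> R) (Fn : nat -> T' -> R[i]) (F G : T' -> R[i]) :
  measurable D -> weight D v -> (forall n, L2 mu D v (Fn n)) -> L2 mu D v F -> L2 mu D v G ->
  n2 mu D v (Fn n - F) @[n --> \oo] --> (0 : R) ->
  ccvg (fun n => cip mu D v (Fn n) G) (cip mu D v F G).
Proof.
move=> mD wv LFn LF LG h; apply: (@cip_cvg _ _ _ mu D mD v wv Fn (fun=> G)) => //.
rewrite (_ : (fun _ => _) = fun=> 0); first exact: cvg_cst.
apply/funext => n; rewrite n2B// cip_self//=; ring.
Qed.

(** The inequality for trigonometric polynomials in [L_2(1)], read through Parseval. *)
Lemma cauchy_schwarz_sum n (x y : nat -> R[i]) :
  abs2 (\sum_(k < n) x k * (y k)^*%C) <= (\sum_(k < n) abs2 (x k)) * \sum_(k < n) abs2 (y k).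
Proof.
have := cip_CauchySchwarz mC ww1 (L2_trig1 x n) (L2_trig1 y n).
rewrite !parseval_trig {1}/trig (gram mC ww1 n n x y (fun k => L2_E1 k) (fun k => L2_E1 k)).
rewrite (_ : \sum_(i < n) _ = (2 * pi)%:C%C * \sum_(k < n) x k * (y k)^*%C); last first.
  rewrite mulr_sumr; apply: eq_bigr => j _; rewrite (bigD1 j)//= big1 ?addr0.
    by rewrite cip1_E eqxx mulrC.
  move=> k kj; rewrite cip1_E ifF ?mulr0//; apply/negbTE.
  by apply: contra kj => /eqP[/ord_inj ->].
rewrite abs2M abs2_real mulrACA -expr2 ler_pM2l// exprn_gt0//.
by rewrite mulr_gt0// pi_gt0.
Qed.

Section toeplitz_of_density.
Variables (v : R -> R) (a : nat -> R[i]).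
Hypotheses (wv : wcirc v) (iv : leb.-integrable circ (EFin \o v)).
Hypothesis a_sum : (\sum_(0 <= j <oo) (Num.sqrt (abs2 (a j)))%:E < +oo)%E.

Lemma mat_apply_toeplitz j :
  mat_apply (toeplitz v) a j = kap%:C%C * Cw v (symA a) (E j%:Z).
Proof.
have [LA Lt h] := symA_L2 a_sum wv iv.
apply: csumE; under eq_fun do rewrite (toeplitz_row a _ _ wv iv).
apply: ccvgM; first exact: ccvg_cst.
by apply: cip_cvgl => //; exact: L2_E.
Qed.

(** The partial sums are [kap] times the pairings of [symA a] with [trig a n]; they converge even
    when [mat_apply (toeplitz v) a] is not in [ell_2]. *)
Lemma ell2_inner_toeplitz :
  ell2_inner (mat_apply (toeplitz v) a) a = (kap * Nw v (symA a))%:C%C.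
Proof.
have [LA Lt h] := symA_L2 a_sum wv iv.
apply: csumE; rewrite (_ : (fun n => _) = fun n => kap%:C%C * Cw v (symA a) (trig a n)).
  rewrite [X in ccvg _ X](_ : _ = kap%:C%C * Cw v (symA a) (symA a)); last first.
    by rewrite cip_self// -rmorphM.
  apply: ccvgM; first exact: ccvg_cst.
  have := ccvg_conj (cip_cvgl mC wv Lt LA LA h).
  rewrite -cip_conj//; congr ccvg; apply/funext => n.
  by rewrite -cip_conj.
apply/funext => n; rewrite /trig (cip_sumr mC wv n a (fun k => L2_E k%:Z wv iv) LA) mulr_sumr.
by apply: eq_bigr => k _; rewrite mat_apply_toeplitz mulrAC -mulrA.
Qed.

End toeplitz_of_density.

(** Since [trig c n] need not converge to [C] in [L_2(v)], the partial sums of [<y, c>] are compared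
    with those where [c] is replaced by a finitely supported [V m]. The latter equal
    [kap <C, pe (V m)>], which tends to the value sought, and the difference is small by
    Cauchy-Schwarz, uniformly in the length, because [y] is in [ell_2]. *)
Lemma ell2_inner_inverse (v : R -> R) (y c : nat -> R[i]) (C : R -> R[i]) :
  wcirc v -> leb.-integrable circ (EFin \o v) -> is_L2_sum c C ->
  mat_op (toeplitz v) c y -> ell2_inner y c = (kap * Nw v C)%:C%C.
Proof.
move=> wv iv hC hop; have [_ y2 _] := hop.
have [LC [V [VC Vc yE]]] := mat_op_L2 hC wv iv hop.
have [S S0 hS] : exists2 S : R, 0 < S & forall n, \sum_(k < n) abs2 (y k) <= S.
  have S0 : (0 <= \sum_(0 <= k <oo) (abs2 (y k))%:E)%E.
    by apply: nneseries_ge0 => k _ _; rewrite lee_fin abs2_ge0.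
  have Sf : (\sum_(0 <= k <oo) (abs2 (y k))%:E)%E \is a fin_num by rewrite ge0_fin_numE.
  exists (fine (\sum_(0 <= k <oo) (abs2 (y k))%:E)%E + 1).
    by rewrite ltr_wpDl// fine_ge0.
  move=> n; rewrite ler_wpDr// -lee_fin fineK//.
  rewrite -sumEFin -(big_mkord xpredT (fun k => (abs2 (y k))%:E)).
  by apply: nneseries_lim_ge => k _; rewrite lee_fin abs2_ge0.
pose J m := kap%:C%C * Cw v C (pe (V m)).
have LV m : Lw v (pe (V m)) by exact: L2_pe.
have cJ : ccvg J (kap * Nw v C)%:C%C.
  rewrite [X in ccvg _ X](_ : _ = kap%:C%C * Cw v C C); last by rewrite cip_self// -rmorphM.
  apply: ccvgM; first exact: ccvg_cst.
  have := ccvg_conj (cip_cvgl mC wv LV LC LC VC).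
  by rewrite -cip_conj//; congr ccvg; apply/funext => n; rewrite -cip_conj.
have JE m n : (size (V m) <= n)%N -> J m = \sum_(k < n) y k * ((V m)`_k)^*%C.
  move=> h; rewrite /J (pe_trig h) /trig.
  rewrite (cip_sumr mC wv n _ (fun k => L2_E k%:Z wv iv) LC) mulr_sumr.
  by apply: eq_bigr => k _; rewrite yE [in RHS]mulrAC -mulrA.
apply: csumE; apply: ccvg_abs2; apply/cvgrPdist_le => e e0.
have e4 : 0 < e / 4 by rewrite divr_gt0.
have [M hM] := Vc (e / 4 / S) (divr_gt0 e4 S0).
have /cvgrPdist_le/(_ _ e4)[M' _ hM'] := ccvg_abs2P cJ.
pose m := maxn M M'; exists (size (V m)) => // n /= hn.
rewrite sub0r normrN ger0_norm ?abs2_ge0//.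
have := hM' m (leq_maxr _ _); rewrite /= sub0r normrN ger0_norm ?abs2_ge0// => h1.
rewrite (_ : _ - _ = (\sum_(k < n) y k * (c k)^*%C - J m) + (J m - (kap * Nw v C)%:C%C)); last first.
  by rewrite addrA subrK.
apply: le_trans (abs2D_le _ _) _.
suff h2 : abs2 (\sum_(k < n) y k * (c k)^*%C - J m) <= e / 4.
  by move: h1 h2; move: (abs2 _) (abs2 _) => r s h1 h2; lra.
rewrite (JE _ _ hn) -sumrB.
rewrite (eq_bigr (fun k : 'I_n => y k * (c k - (V m)`_k)^*%C)); last first.
  by move=> k _; rewrite -mulrBr; congr (_ * _); apply: complex_ext; rewrite !ReImE //; ring.
apply: le_trans (cauchy_schwarz_sum n y (fun k => c k - (V m)`_k)) _.
have -> : e / 4 = S * (e / 4 / S) by rewrite [RHS]mulrC divfK// gt_eqF.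
apply: ler_pM => //; first by apply: sumr_ge0 => k _; exact: abs2_ge0.
  by apply: sumr_ge0 => k _; exact: abs2_ge0.
exact: hM (leq_maxl _ _) _.
Qed.

End Spectral.

(** * The candidate characteristic: its Fourier coefficients and its error density *)

Section Identify.
Context {R : realType}.
Variables (f g : R -> R) (A C : R -> R[i]).
Local Notation leb := (@lebesgue_measure R).
Local Notation Lw := (L2 leb circ).
Local Notation Nw := (n2 leb circ).
Local Notation Cw := (cip leb circ).
Local Notation w := (fun x : R => f x + g x).
Local Notation v := (fun x : R => (f x + g x)^-1).
Local Notation fw := (fun x : R => f x / (f x + g x)).
Local Notation q := (fun x : R => f x * g x / (f x + g x)).
Let mC := @measurable_circ R.
Let ww1 := @weight1 R.
Let iw1 := @integrable_cst_circ R 1.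
Hypotheses (wf : wcirc f) (wg : wcirc g).
Hypotheses (iF : leb.-integrable circ (EFin \o f)) (iG : leb.-integrable circ (EFin \o g)).
Let ww : wcirc w := weightD wf wg.
Let iw : leb.-integrable circ (EFin \o w) := integrable_weightD iF iG.
Hypotheses (wpos : {ae leb, forall x, circ x -> 0 < w x})
  (iv : leb.-integrable circ (EFin \o v)).
Let wv : wcirc v := weightV ww.
Hypotheses (LA : Lw w A) (LC : Lw v C).

Lemma ratio_le1 x : circ x -> 0 <= f x / (f x + g x) <= 1.
Proof.
move=> Dx; have [_ /(_ _ Dx) f0] := wf; have [_ /(_ _ Dx) g0] := wg.
rewrite divr_ge0 ?addr_ge0//=; have [->|w0] := eqVneq (f x + g x) 0.
  by rewrite invr0 mulr0.
by rewrite ler_pdivrMr ?mul1r ?lerDl// lt_neqAle eq_sym w0 addr_ge0.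
Qed.

Lemma weight_ratio : wcirc fw.
Proof.
have [mf _] := wf; have [mv _] := wv; split; first exact: measurable_funM.
by move=> x /ratio_le1/andP[].
Qed.

Lemma integrable_ratio : leb.-integrable circ (EFin \o fw).
Proof.
apply: (rintegrable_dom mC weight_ratio.1 _ iw1) => x /ratio_le1/andP[a b].
by rewrite ger0_norm.
Qed.

Lemma weight_harmonic : wcirc q.
Proof.
have [mf f0] := wf; have [mg g0] := wg; have [mv v0] := wv; split.
  by apply: measurable_funM => //; exact: measurable_funM.
by move=> x Dx; rewrite mulr_ge0 ?v0// mulr_ge0 ?f0 ?g0.
Qed.

Lemma integrable_harmonic : leb.-integrable circ (EFin \o q).
Proof.
have [_ g0] := wg; have [_ q0] := weight_harmonic.
apply: (rintegrable_dom mC weight_harmonic.1 _ iG) => x Dx; rewrite ger0_norm ?q0//.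
have /andP[a b] := ratio_le1 Dx; rewrite mulrAC -[leRHS]mul1r.
by rewrite ler_wpM2r ?g0.
Qed.

Definition characteristic (x : R) : R[i] :=
  A x * (f x / (f x + g x))%:C%C - C x * ((f x + g x)^-1)%:C%C.
Local Notation h := characteristic.

Let Af : R -> R[i] := fun x => A x * (f x / (f x + g x))%:C%C.
Let Cv : R -> R[i] := fun x => C x * ((f x + g x)^-1)%:C%C.

Let LAf : Lw w Af.
Proof.
have [] := @L2_dom _ _ _ leb circ mC w w A Af 1 ww ww LA _ _ => //.
  by apply: cmeasurableM; [case: LA|apply: cmeasurable_real; case: weight_ratio].
move=> x Dx; have /andP[a b] := ratio_le1 Dx; have [_ /(_ _ Dx) w0] := ww.
rewrite mul1r ler_wpM2r// abs2M abs2_real ler_piMr ?abs2_ge0//.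
by rewrite expr_le1.
Qed.

Let LCv : Lw w Cv. Proof. exact: L2_inv_weight. Qed.

Lemma L2_characteristic : Lw w h. Proof. exact: L2B. Qed.

Let h0 := L2_characteristic.

(** The hypothesis is the [j]-th entry of [B c = R a], up to the factor [(2 pi)^-1]. *)
Lemma characteristic_pos (j : nat) : Lw fw A ->
  Cw v C (E j%:Z) = Cw fw A (E j%:Z) ->
  cintegral leb circ (fun x => h x * (E j%:Z x)^*%C) = 0.
Proof.
move=> LfA e; rewrite -(cip_inv_weight ww wpos h0); last exact: L2_E.
rewrite cipBl//; last by apply: L2_inv_weight => //; exact: L2_E.
rewrite !(cip_inv_weight ww wpos)//; try exact: L2_E.
apply/eqP; rewrite subr_eq0; apply/eqP.
transitivity (Cw fw A (E j%:Z)); last rewrite -e.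
  by apply: cintegral_ext => x _; rewrite /Af mulrAC.
by apply: cintegral_ext => x _; rewrite /Cv mulrAC.
Qed.

(** [h w = A f - C], and [C] has no coefficient of negative index. The [A f] part is an identity
    everywhere, as [f = 0] where [f + g = 0]; the [C] part holds only almost everywhere. *)
Lemma characteristic_neg (k : nat) : Cw (fun=> 1) C (E (- k.+1%:Z)) = 0 ->
  Cw w h (E (- k.+1%:Z)) = Cw f A (E (- k.+1%:Z)).
Proof.
move=> e; set s := - _; have LE : Lw w (E s) by exact: L2_E.
rewrite cipBl// (_ : Cw w Cv (E s) = Cw (fun=> 1) C (E s)).
  rewrite e subr0; apply: cintegral_ext => x Dx.
  have [_ /(_ _ Dx) f0] := wf; have [_ /(_ _ Dx) g0] := wg.
  have -> : (f x)%:C%C = (f x / (f x + g x))%:C%C * (f x + g x)%:C%C.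
    rewrite -rmorphM; congr (_%:C%C).
    by have [w0|w0] := eqVneq (f x + g x) 0; [rewrite w0 mulr0; lra|rewrite divfK].
  by rewrite /Af; ring.
have [mc _] := LC.
have mE := cmeasurable_E s circ.
apply: cintegral_ae.
- apply: cmeasurableM; last by apply: cmeasurable_real; case: ww.
  by apply: cmeasurableM; [case: LCv|exact: cmeasurable_conj].
- apply: cmeasurableM; last by apply: cmeasurable_real; exact: measurable_cst.
  by apply: cmeasurableM => //; exact: cmeasurable_conj.
apply: (ae_imp _ wpos) => x w0 Dx; rewrite /Cv.
have -> : C x * (E s x)^*%C * 1%:C%C = C x * (E s x)^*%C * (((f x + g x)^-1)%:C%C * (f x + g x)%:C%C).
  by rewrite -rmorphM mulVf// gt_eqF// w0.
by ring.
Qed.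

(** [u0] is an [L_2(w)] limit of polynomials with negative frequencies; paired with [E j / w], which
    lies in [L_2(w)], these give 0 for [j >= 0], hence so does [u0]. Then [vanishing] applies to
    [h - u0]. *)
Lemma identify (u0 : R -> R[i]) (n : nat -> nat) (u : nat -> nat -> R[i]) :
  Lw w u0 ->
  Nw w (negtrig (n m) (u m) - u0) @[m --> \oo] --> (0 : R) ->
  (forall k, Cw w u0 (E (- k.+1%:Z)) = Cw f A (E (- k.+1%:Z))) ->
  (forall k, Cw (fun=> 1) C (E (- k.+1%:Z)) = 0) ->
  Lw fw A -> (forall j : nat, Cw v C (E j%:Z) = Cw fw A (E j%:Z)) ->
  Nw w (h - u0) = 0.
Proof.
move=> Lu0 pu0 eneg Cneg LfA epos.
apply: (vanishing ww iw wpos iv); first exact: L2B.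
  move=> j; rewrite -(cip_inv_weight ww wpos); [|exact: L2B|exact: L2_E].
  have Lj : Lw w (fun x => E j%:Z x * (v x)%:C%C) by apply: L2_inv_weight => //; exact: L2_E.
  rewrite cipBl// (cip_inv_weight ww wpos h0); last exact: L2_E.
  rewrite characteristic_pos// sub0r.
  have Lp m : Lw w (negtrig (n m) (u m)) by exact: L2_negtrig.
  have c := cip_cvgl mC ww Lp Lu0 Lj pu0.
  suff -> : Cw w u0 (fun x => E j%:Z x * (v x)%:C%C) = 0 by rewrite oppr0.
  apply: (ccvg_unique c).
  have p0 m : Cw w (negtrig (n m) (u m)) (fun x => E j%:Z x * (v x)%:C%C) = 0.
    rewrite (cip_inv_weight ww wpos (Lp m)); last exact: L2_E.
    transitivity (Cw (fun=> 1) (negtrig (n m) (u m)) (E j%:Z)).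
      by apply: cintegral_ext => x _; rewrite mulr1.
    rewrite negtrigE (cip_suml mC ww1 _ _ (fun k => L2_E1 (- k.+1%:Z)) (L2_E1 j%:Z)).
    by rewrite big1// => k _; rewrite cip1_E; case: eqP; rewrite ?mulr0.
  by under eq_fun do rewrite p0; exact: ccvg_cst.
move=> k; rewrite cipBl//; last exact: L2_E.
by rewrite characteristic_neg// eneg subrr.
Qed.

(* Also where [f + g = 0], since [f = g = 0] there. *)
Lemma error_algebra (x : R) : circ x ->
  abs2 (A x - h x) * f x + abs2 (h x) * g x =
  abs2 (C x) / (f x + g x) + abs2 (A x) * (f x * g x / (f x + g x)).
Proof.
have [_ f0] := wf; have [_ g0] := wg => Dx.
have [w0|w0] := eqVneq (f x + g x) 0.
  have [-> ->] : f x = 0 /\ g x = 0 by split; have := f0 _ Dx; have := g0 _ Dx; lra.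
  by rewrite addr0 invr0; ring.
rewrite /h /abs2 !ReImE /=.
by field.
Qed.

(** [A - h = (A g + C) / (f + g)] where the denominator is nonzero; elsewhere the factor [f]
    vanishes on both sides. *)
Lemma error_density_l (x : R) : circ x ->
  abs2 (A x * (g x)%:C%C + C x) / (f x + g x) ^+ 2 * f x = abs2 (A x - h x) * f x.
Proof.
have [_ f0] := wf; have [_ g0] := wg => Dx.
have [w0|w0] := eqVneq (f x + g x) 0.
  have -> : f x = 0 by have := f0 _ Dx; have := g0 _ Dx; lra.
  by rewrite !mulr0.
by rewrite /h /abs2 !ReImE /=; field.
Qed.

Lemma error_density_r (x : R) : circ x ->
  abs2 (A x * (f x)%:C%C - C x) / (f x + g x) ^+ 2 * g x = abs2 (h x) * g x.
Proof.
have [_ f0] := wf; have [_ g0] := wg => Dx.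
have [w0|w0] := eqVneq (f x + g x) 0.
  have -> : g x = 0 by have := f0 _ Dx; have := g0 _ Dx; lra.
  by rewrite !mulr0.
by rewrite /h /abs2 !ReImE /=; field.
Qed.

End Identify.

(** * The optimal estimate, uniqueness of its characteristic, and its error *)

Section Optimal.
Context {R : realType} {d : measure_display} {T : measurableType d}.
Variables (P : probability T R) (xi eta : int -> T -> R[i]) (f g : R -> R).
Variables (Z_xi Z_eta : set R -> T -> R[i]) (a : nat -> R[i]).
Variables (Axi Ahat : T -> R[i]) (c : nat -> R[i]) (C : R -> R[i]).
Hypotheses (xi_stat : stationary P xi) (eta_stat : stationary P eta).
Hypothesis xi_eta : mutually_uncorrelated P xi eta.
Hypotheses (xi_f : spectral_density P xi f) (eta_g : spectral_density P eta g).
Hypotheses (xi_Z : spectral_representation P xi Z_xi f)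
  (eta_Z : spectral_representation P eta Z_eta g).
Hypothesis minimality :
  (\int[lebesgue_measure]_(x in circ) ((f x + g x)%R%:E)^-1 < +oo)%E.
Hypothesis a_sum : (\sum_(0 <= j <oo) (Num.sqrt (abs2 (a j)))%:E < +oo)%E.
Hypothesis Axi_def : is_functional P a xi Axi.
Hypothesis c_op : mat_op (matB f g) c (mat_apply (matR f g) a).
Hypothesis C_def : is_L2_sum c C.
Hypothesis Ahat_opt : optimal_estimate P (fun j t => xi j t + eta j t) Axi Ahat.

Local Notation leb := (@lebesgue_measure R).
Local Notation LP := (L2 P setT (fun=> 1)).
Local Notation NP := (n2 P setT (fun=> 1)).
Local Notation CP := (cip P setT (fun=> 1)).
Local Notation Lw := (L2 leb circ).
Local Notation Nw := (n2 leb circ).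
Local Notation Cw := (cip leb circ).
Local Notation kap := ((2 * pi)^-1 : R).
Local Notation w := (fun x : R => f x + g x).
Local Notation v := (fun x : R => (f x + g x)^-1).
Local Notation q := (fun x : R => f x * g x / (f x + g x)).
Local Notation zeta := (observed xi eta).
Local Notation Y := (Ysum xi eta).
Local Notation X := (Xsum xi a).
Local Notation A := (symA a).
Local Notation h := (characteristic f g A C).
Let mC := @measurable_circ R.
Let mT : measurable [set: T] := measurableT.
Let wT := @weightT R _ T.
Let wf : wcirc f. Proof. by case: (spectral_density_weight xi_f). Qed.
Let wg : wcirc g. Proof. by case: (spectral_density_weight eta_g). Qed.
Let iF : leb.-integrable circ (EFin \o f). Proof. by case: (spectral_density_weight xi_f). Qed.
Let iG : leb.-integrable circ (EFin \o g). Proof. by case: (spectral_density_weight eta_g). Qed.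
Let ww : wcirc w := weightD wf wg.
Let iw : leb.-integrable circ (EFin \o w) := integrable_weightD iF iG.
Let wv : wcirc v := weightV ww.
Let wpos : {ae leb, forall x, circ x -> 0 < w x}.
Proof. by case: (minimality_weight ww minimality). Qed.
Let iv : leb.-integrable circ (EFin \o v).
Proof. by case: (minimality_weight ww minimality). Qed.
Let kap_gt0 : 0 < kap. Proof. by rewrite invr_gt0 mulr_gt0 ?pi_gt0. Qed.

Let LA : Lw w A. Proof. by case: (symA_L2 a_sum ww iw). Qed.
Let LfA : Lw f A. Proof. by case: (symA_L2 a_sum wf iF). Qed.
Let LC : Lw v C. Proof. by case: (mat_op_L2 C_def wv iv c_op). Qed.
Let Lh : Lw w h. Proof. exact: L2_characteristic. Qed.
Let LAxi : LP Axi. Proof. by case: Axi_def => /sq_integrableP. Qed.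
Let LAhat : LP Ahat.
Proof. by case: Ahat_opt => [/(linear_estimateP xi_stat eta_stat)[]]. Qed.
Let LX n : LP (X n). Proof. exact: L2_Xsum. Qed.
Let LY n u : LP (Y n u). Proof. exact: L2_Ysum. Qed.
Let Lz j : LP (zeta j). Proof. exact: L2_observed. Qed.
Let Lnt n u : Lw w (negtrig n u). Proof. exact: L2_negtrig. Qed.

Lemma Xsum_cvg : NP (X n - Axi) @[n --> \oo] --> (0 : R).
Proof.
have [_ /fine_cvg] := Axi_def; rewrite [X in X @ _](_ : _ = fun n => NP (X n - Axi))//.
apply/funext => n /=.
rewrite n2BC// (_ : msnorm _ _ = msnorm P (Axi - X n)); last by rewrite XsumE.
by rewrite msnormE//; exact: L2B.
Qed.

Lemma cip_X_observed j : CP Axi (zeta j) = kap%:C%C * Cw f A (E j).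
Proof.
have [_ Lt hA] := symA_L2 a_sum wf iF.
have LE : Lw f (E j) by exact: L2_E.
apply: (ccvg_unique (cip_cvgl mT wT LX LAxi (Lz j) Xsum_cvg)).
rewrite [F in ccvg F _](_ : _ = fun n => kap%:C%C * Cw f (trig a n) (E j)).
  by apply: ccvgM; [exact: ccvg_cst|exact: cip_cvgl].
apply/funext => n; rewrite /Xsum /trig.
rewrite (cip_suml mT wT n a (fun k : nat => stationary_L2 k%:Z xi_stat) (Lz j)).
rewrite (cip_suml mC wf n a (fun k : nat => L2_E k%:Z wf iF) LE) mulr_sumr.
by apply: eq_bigr => k _; rewrite (cov_xi_observed _ _ _ xi_f)// mulrCA.
Qed.

Lemma cip_Y_observed n u j : CP (Y n u) (zeta j) = kap%:C%C * Cw w (negtrig n u) (E j).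
Proof.
have LE : Lw w (E j) by exact: L2_E.
rewrite negtrigE /Ysum.
rewrite (cip_suml mT wT n u (fun k : nat => Lz (- k.+1%:Z)) (Lz j)).
rewrite (cip_suml mC ww n u (fun k : nat => L2_E (- k.+1%:Z) ww iw) LE) mulr_sumr.
by apply: eq_bigr => k _; rewrite (cov_observed xi_stat eta_stat xi_eta xi_f eta_g) mulrCA.
Qed.

Lemma n2_cvg0_geometric (u : nat -> R) (k : R) : (forall m, 0 <= u m) ->
  (forall m, u m <= k * 8^-1 ^+ m) -> u m @[m --> \oo] --> (0 : R).
Proof.
move=> u0 hu; apply: (@squeeze_cvgr _ _ _ _ (fun=> 0) (fun m => k * 8^-1 ^+ m)).
- by apply: nearW => m; rewrite u0 hu.
- exact: cvg_cst.
by apply: (cvg_geometric k); rewrite ger0_norm; lra.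
Qed.

(* The optimal estimate as a limit of finite linear estimates: the covariance
   isometry turns mean-square convergence into convergence in [L_2(f + g)], and
   orthogonality of the error identifies the limit. *)
Lemma approximants : exists (n : nat -> nat) (u : nat -> nat -> R[i]),
  Nw w (negtrig (n m) (u m) - h) @[m --> \oo] --> (0 : R) /\
  NP (Y (n m) (u m) - Ahat) @[m --> \oo] --> (0 : R).
Proof.
have [lY _] := Ahat_opt; have [_ hY] := (linear_estimateP xi_stat eta_stat _).1 lY.
(* With these errors the triangle inequality bounds [kap] times consecutive distances by
   [2 (1/4 + 1/32) kap 8^-m], so the polynomials satisfy the rate required by [L2_complete]. *)
have d0 m : 0 < kap / 4 * 8^-1 ^+ m.
  by rewrite mulr_gt0 ?exprn_gt0 ?invr_gt0//; move: kap_gt0; lra.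
have /choice[nu hnu] : forall m, exists nu : nat * (nat -> R[i]),
    NP (Ahat - Y nu.1 nu.2) < kap / 4 * 8^-1 ^+ m.
  by move=> m; have [n [u H]] := hY _ (d0 m); exists (n, u).
pose p m := negtrig (nu m).1 (nu m).2; pose Ym m := Y (nu m).1 (nu m).2.
have cY : NP (Ym m - Ahat) @[m --> \oo] --> (0 : R).
  apply: (@n2_cvg0_geometric _ (kap / 4)) => m; first exact: n2_ge0.
  by rewrite (n2BC (LY _ _) LAhat); exact/ltW/hnu.
have step m : Nw w (p m.+1 - p m) <= 8^-1 ^+ m.
  rewrite -(ler_pM2l kap_gt0) -(NP_YsumB xi_stat eta_stat xi_eta xi_f eta_g).
  apply: le_trans (n2_triangle mT wT (LY _ _) LAhat (LY _ _)) _.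
  rewrite (n2BC (LY _ _) LAhat); have := hnu m; have := hnu m.+1.
  have : 0 <= (8^-1 : R) ^+ m by rewrite exprn_ge0.
  rewrite exprS; move: (NP _) (NP _) (8^-1 ^+ m) kap kap_gt0 => r s t k k0 t0 h1 h2.
  have := mulr_ge0 (ltW k0) t0. lra.
have [u0 [Lu0 cu _]] := L2_complete mC ww wpos (fun m => Lnt _ _) step.
have kz : kap%:C%C != 0.
  by apply/eqP => /(congr1 (@complex.Re R)) /= e; move: kap_gt0; rewrite e ltxx.
have e0 : Nw w (h - u0) = 0.
  have [LfwA _ _] := symA_L2 a_sum (weight_ratio wf wg) (integrable_ratio wf wg).
  apply: (identify wf wg iF iG wpos iv LA LC Lu0 cu) => //.
  - move=> k; apply: (mulfI kz); rewrite -cip_X_observed (optimal_orth _ _ k LAxi Ahat_opt)//.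
    have LE : Lw w (E (- k.+1%:Z)) by exact: L2_E.
    apply: (ccvg_unique _ (cip_cvgl mT wT (fun m => LY _ _) LAhat (Lz _) cY)).
    under eq_fun do rewrite cip_Y_observed.
    by apply: ccvgM; [exact: ccvg_cst|exact: (cip_cvgl mC ww _ _ _ cu)].
  - exact: is_L2_sum_orth C_def.
  - move=> j; have [_ [_ [_ _ hy]]] := mat_op_L2 C_def wv iv c_op.
    apply: (mulfI kz); rewrite -hy.
    exact: (mat_apply_toeplitz (weight_ratio wf wg) (integrable_ratio wf wg) a_sum).
exists (fun m => (nu m).1), (fun m => (nu m).2); split => //.
apply: (@squeeze_cvgr _ _ _ _ (fun=> 0) (fun m => 2 * Nw w (p m - u0))).
- apply: nearW => m; rewrite n2_ge0//=; apply: le_trans (n2_triangle mC ww (Lnt _ _) Lu0 Lh) _.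
  by rewrite (n2BC Lu0 Lh) e0 mulr0 addr0.
- exact: cvg_cst.
by rewrite -(mulr0 2); apply: cvgMr.
Qed.

Lemma n2B_cvg d' (T' : measurableType d') (mu : {measure set T' -> \bar R})
    (D : set T') (r : T' -> R) (Fn Gn : nat -> T' -> R[i]) (F G : T' -> R[i]) :
  measurable D -> weight D r ->
  (forall n, L2 mu D r (Fn n)) -> (forall n, L2 mu D r (Gn n)) -> L2 mu D r F -> L2 mu D r G ->
  n2 mu D r (Fn n - F) @[n --> \oo] --> (0 : R) ->
  n2 mu D r (Gn n - G) @[n --> \oo] --> (0 : R) ->
  n2 mu D r (Fn n - Gn n) @[n --> \oo] --> n2 mu D r (F - G).
Proof.
move=> mD wr LFn LGn LF LG hF hG.
apply: (@n2_cvg _ _ _ mu D mD r wr (fun n => Fn n - Gn n)); [by move=> n; exact: L2B|exact: L2B|].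
apply: (@squeeze_cvgr _ _ _ _ (fun=> 0)
  (fun n => 2 * n2 mu D r (Fn n - F) + 2 * n2 mu D r (Gn n - G))).
- apply: nearW => n; rewrite n2_ge0//=.
  rewrite (n2BC (LGn n) LG) (_ : _ - _ = (Fn n - F) + (G - Gn n)); last first.
    by apply/funext => t; rewrite !fctE; ring.
  by apply: n2D_le => //; exact: L2B.
- exact: cvg_cst.
have -> : (0 : R) = 2 * 0 + 2 * 0 by rewrite mulr0 addr0.
by apply: cvgD; apply: cvgMr.
Qed.

Let Z := fun S t => Z_xi S t + Z_eta S t.
Let bZ : bounded_int P Z w (2 * kap).
Proof. by case: xi_Z => oZ _; case: eta_Z => oZ' _; exact: sum_bounded_int. Qed.

Lemma stoch_int_Ysum n u : stoch_int P Z w (negtrig n u) (Y n u).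
Proof.
rewrite negtrigE /Ysum.
apply: (stoch_int_sum ww iw bZ n u (F := fun k => E (- k.+1%:Z)) (X := fun k => zeta (- k.+1%:Z))).
move=> k; case: xi_Z => oZ sx; case: eta_Z => oZ' sy.
exact: (stoch_int_add wf wg iF iG oZ oZ' (sx _) (sy _)).
Qed.

Lemma approximants_lt e : 0 < e -> exists n u,
  Nw w (negtrig n u - h) < e /\ NP (Y n u - Ahat) < e.
Proof.
have [n [u [c1 c2]]] := approximants => e0.
have c12 : Nw w (negtrig (n m) (u m) - h) + NP (Y (n m) (u m) - Ahat) @[m --> \oo] --> (0 : R).
  by rewrite -[X in _ --> X](addr0 (0 : R)); exact: cvgD.
have [m hm] := eventually_small e0 c12; exists (n m), (u m).
have := n2_ge0 leb (negtrig (n m) (u m) - h) ww; have := n2_ge0 P (Y (n m) (u m) - Ahat) wT.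
by move: hm; move: (Nw w _) (NP _) => r s; split; lra.
Qed.

Lemma spectral_characteristicP : spectral_characteristic P Z w h Ahat.
Proof.
split.
  split=> [|e /approximants_lt[n [u [H _]]]]; first exact/in_L2P.
  exists n, u; rewrite [X in (X < _)%E](_ : _ = wnorm2 w (h - negtrig n u))//.
  by rewrite wnorm2E ?lte_fin ?(n2BC Lh)//; exact: L2B.
apply: (stoch_int_limit ww iw bZ Lh LAhat) => e /approximants_lt[n [u [H1 H2]]].
exists (negtrig n u), (Y n u); rewrite (n2BC Lh)// (n2BC LAhat)//; split=> //.
exact: stoch_int_Ysum.
Qed.

(** Without an isometry for [Z_xi + Z_eta], equality of the integrals does not compare [h'] with [h]
    directly. Both are approximated by polynomials in past frequencies: [stoch_int_bound] brings the
    corresponding sums of observations close to [Ahat], hence to each other, and the isometry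
    [NP_YsumB] returns this closeness to the polynomials. *)
Lemma spectral_characteristic_unique h' : spectral_characteristic P Z w h' Ahat ->
  {ae leb, forall x, x \in circ -> h' x = h x}.
Proof.
move=> [[/in_L2P -/(_ ww) Lh' hneg] sh'].
have L' : Lw w (h' - h) by exact: L2B.
suff e0 : Nw w (h' - h) = 0.
  apply: (ae_imp _ (n2_eq0 mC ww wpos L' e0)) => x H; rewrite inE => Dx.
  by apply/eqP; rewrite -subr_eq0; apply/eqP; exact: H.
apply/eqP; rewrite eq_le n2_ge0// andbT leNgt; apply/negP => N0.
(* If all approximations are within [e], then [kap D <= 64 kap e + 2 e] for the distance [D] of the
   two polynomials, and [N <= 6 e + 4 D] for [N] the distance of [h'] to [h]. Thus
   [kap N <= (262 kap + 8) e], and [e] is chosen to make the right side [kap N / 2]. *)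
have M0 : 0 < 262 * kap + 8 by move: kap_gt0; lra.
pose e := kap * Nw w (h' - h) / (2 * (262 * kap + 8)).
have e0 : 0 < e by rewrite divr_gt0 ?mulr_gt0.
have [n' [u' H']] := hneg e e0.
have {}H' : Nw w (h' - negtrig n' u') < e.
  by rewrite -lte_fin -wnorm2E//; exact: L2B.
have [n [u [H1 H2]]] := approximants_lt e0.
have K0 : 0 <= 2 * kap by move: kap_gt0; lra.
have H3 := stoch_int_bound ww iw K0 bZ sh' (stoch_int_Ysum n' u').
have H4 := NP_YsumB xi_stat eta_stat xi_eta xi_f eta_g n' u' n u.
have H5 := n2_triangle mT wT (LY n' u') LAhat (LY n u).
have H6 := n2_triangle mC ww (Lnt n' u') (Lnt n u) Lh.
have H7 := n2_triangle mC ww Lh' (Lnt n' u') Lh.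
rewrite (n2BC LAhat (LY n u)) in H5; rewrite (n2BC (LY n' u') LAhat) H4 in H5.
have eM : e * (262 * kap + 8) = kap * Nw w (h' - h) / 2.
  by rewrite /e; move: kap (Nw w _) M0 => k N M0; field; rewrite gt_eqF.
move: H1 H2 H3 H5 H6 H7 H' N0 kap_gt0 eM e0; move: (e : R) kap => {}e k.
move: (Nw w (h' - h)) (Nw w (negtrig n' u' - negtrig n u)) => N D.
move: (Nw w _) (Nw w _) (Nw w _) (NP _) (NP _) => q1 q2 q3 r1 r2.
move=> H1 H2 H3 H5 H6 H7 H' N0 k0 eM e0.
clear H4 K0 M0.
have a1 : k * q2 < k * e by rewrite ltr_pM2l.
have a2 : k * q3 < k * e by rewrite ltr_pM2l.
have a3 : k * N <= k * (2 * q2 + 2 * (2 * D + 2 * q3)) by rewrite ler_pM2l//; lra.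
have a4 : 0 < k * N by rewrite mulr_gt0.
by nra.
Qed.

(** The error splits into uncorrelated parts: [xi] carries the symbol [trig a n - negtrig m u], and
    [eta] carries [- negtrig m u]. *)
Lemma NP_XsumB n m u :
  NP (X n - Y m u) = kap * (Nw f (trig a n - negtrig m u) + Nw g (negtrig m u)).
Proof.
have [_ Lt _] := symA_L2 a_sum wf iF.
have Ln : Lw f (negtrig m u) by exact: L2_negtrig.
rewrite (n2B mT wT)// (n2B mC wf)//.
rewrite (NP_Ysum xi_stat eta_stat xi_eta xi_f eta_g) (n2_weightD wf wg)//.
rewrite (cip_XY xi_stat eta_stat xi_eta xi_f).
have -> : NP (X n) = kap * Nw f (trig a n).
  have := cip_self mT (LX n); rewrite (cip_XX xi_stat xi_f) cip_self// -rmorphM.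
  by move=> /(congr1 (@complex.Re R)) /= <-.
by rewrite cReM [Re _%:C%C]/= [Im _%:C%C]/= mul0r subr0; ring.
Qed.

(** Both sides are limits of the error [NP_XsumB] along [approximants]: convergence in [L_2(f + g)]
    gives convergence in [L_2(f)] and in [L_2(g)] separately. *)
Lemma error_value : NP (Axi - Ahat) = kap * (Nw f (A - h) + Nw g h).
Proof.
have [n [u [c1 c2]]] := approximants.
have [_ Lt hA] := symA_L2 a_sum wf iF.
have /(L2_weightD wf wg)[Lfh Lgh] := Lh.
have Lpf m : Lw f (negtrig (n m) (u m)) by exact: L2_negtrig.
have Lpg m : Lw g (negtrig (n m) (u m)) by exact: L2_negtrig.
have split m : Nw w (negtrig (n m) (u m) - h) =
    Nw f (negtrig (n m) (u m) - h) + Nw g (negtrig (n m) (u m) - h).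
  by apply: n2_weightD => //; exact: L2B.
have cf : Nw f (negtrig (n m) (u m) - h) @[m --> \oo] --> (0 : R).
  apply: (@squeeze_cvgr _ _ _ _ (fun=> 0) _ _ _ _ (cvg_cst _) c1).
  by apply: nearW => m; rewrite n2_ge0//= split lerDl n2_ge0.
have cg : Nw g (negtrig (n m) (u m) - h) @[m --> \oo] --> (0 : R).
  apply: (@squeeze_cvgr _ _ _ _ (fun=> 0) _ _ _ _ (cvg_cst _) c1).
  by apply: nearW => m; rewrite n2_ge0//= split lerDr n2_ge0.
have l1 := n2B_cvg mT wT LX (fun m => LY (n m) (u m)) LAxi LAhat Xsum_cvg c2.
have l2 := n2B_cvg mC wf Lt Lpf LfA Lfh hA cf.
have l3 := n2_cvg mC wg Lpg Lgh cg.
have l4 : NP (X m - Y (n m) (u m)) @[m --> \oo] --> kap * (Nw f (A - h) + Nw g h).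
  by under eq_fun do rewrite NP_XsumB; apply: cvgMr; apply: cvgD.
exact: (cvg_unique _ l1 l4).
Qed.

Lemma error_operators : NP (Axi - Ahat) = kap * Nw v C + kap * Nw q A.
Proof.
have wq := weight_harmonic wf wg; have iq := integrable_harmonic wf wg iG.
have [LqA _ _] := symA_L2 a_sum wq iq.
have /(L2_weightD wf wg)[Lfh Lgh] := Lh.
have LfB : Lw f (A - h) by exact: L2B.
rewrite error_value -mulrDr; congr (_ * _).
rewrite /n2 -!RintegralD//; try by case: LfB; try by case: Lgh; try by case: LC; try by case: LqA.
by apply: eq_Rintegral => x; rewrite inE => Dx; exact: error_algebra.
Qed.

End Optimal.

Theorem theorem5p1 (R : realType) (d : measure_display) (T : measurableType d)
    (P : probability T R) (xi eta : int -> T -> R[i]) (f g : R -> R)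
    (Z_xi Z_eta : set R -> T -> R[i]) (a : nat -> R[i])
    (Axi Ahat : T -> R[i]) (C : R -> R[i])
    (xi_stat : stationary P xi) (eta_stat : stationary P eta)
    (xi_mean : zero_mean P xi) (eta_mean : zero_mean P eta)
    (xi_eta : mutually_uncorrelated P xi eta)
    (xi_f : spectral_density P xi f) (eta_g : spectral_density P eta g)
    (xi_Z : spectral_representation P xi Z_xi f)
    (eta_Z : spectral_representation P eta Z_eta g)
    (minimality :
      (\int[lebesgue_measure]_(x in circ) ((f x + g x)%R%:E)^-1 < +oo)%E)
    (a_sum : (\sum_(0 <= j <oo) (Num.sqrt (abs2 (a j)))%:E < +oo)%E)
    (a_wsum : (\sum_(0 <= j <oo) ((j.+1)%:R * abs2 (a j))%R%:E < +oo)%E)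
    (* A xi *)
    (Axi_def : is_functional P a xi Axi)
    (* B^-1 R a is defined: R a is in the range of B (automatic if f + g is
       essentially bounded) *)
    (Ra_range : exists c, mat_op (matB f g) c (mat_apply (matR f g) a))
    (* C(lambda) = sum_k (B^-1 R a)_k e^{ik lambda} *)
    (C_def : is_L2_sum (mat_inv (matB f g) (mat_apply (matR f g) a)) C)
    (Ahat_opt : optimal_estimate P (fun j t => xi j t + eta j t) Axi Ahat) :
  let A := symA a in
  let Ra := mat_apply (matR f g) a in
  let Qa := mat_apply (matQ f g) a in
  let c := mat_inv (matB f g) Ra in
  let h := fun x : R =>
    A x * (f x / (f x + g x))%:C%C - C x * ((f x + g x)^-1)%:C%C in
  let Z := fun S t => Z_xi S t + Z_eta S t in
  let w := fun x => f x + g x in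
  let Delta := msnorm P (fun t => Axi t - Ahat t) in
  [/\ spectral_characteristic P Z w h Ahat,
      (forall h', spectral_characteristic P Z w h' Ahat ->
         {ae lebesgue_measure, forall x, x \in circ -> h' x = h x}),
      (Delta =
         ((2 * pi)^-1)%:E *
           \int[lebesgue_measure]_(x in circ)
             (abs2 (A x * (g x)%:C%C + C x) / (f x + g x) ^+ 2 * f x)%R%:E
         + ((2 * pi)^-1)%:E *
           \int[lebesgue_measure]_(x in circ)
             (abs2 (A x * (f x)%:C%C - C x) / (f x + g x) ^+ 2 * g x)%R%:E)%E
    & Delta \is a fin_num /\
      (fine Delta)%:C%C = ell2_inner Ra c + ell2_inner Qa a].
Proof.
(* By the range hypothesis [mat_inv] selects an actual preimage of [R a], not the default
   sequence. *)
have c_op := xgetPex (fun=> 0) Ra_range.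
rewrite -/(mat_inv _ _) in c_op.
have [wf iF] := spectral_density_weight xi_f.
have [wg iG] := spectral_density_weight eta_g.
have ww := weightD wf wg; have iw := integrable_weightD iF iG.
have [wpos iv] := minimality_weight ww minimality.
have wq := weight_harmonic wf wg; have iq := integrable_harmonic wf wg iG.
move=> A Ra Qa c h Z w Delta.
have [LA _ _] := symA_L2 a_sum ww iw.
have [LC _] := mat_op_L2 C_def (weightV ww) iv c_op.
have Lh : L2 lebesgue_measure circ w h by exact: (L2_characteristic wf wg LA LC).
have /(L2_weightD wf wg)[LfA _] := LA; have /(L2_weightD wf wg)[Lfh Lgh] := Lh.
have DeltaE : Delta = (n2 P setT (fun=> 1) (Axi - Ahat))%:E.
  rewrite -msnormE//; apply: (L2B measurableT (@weightT R _ T)).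
    by case: Axi_def => /sq_integrableP.
  by case: Ahat_opt => [/(linear_estimateP xi_stat eta_stat)[]].
have error := error_value xi_stat eta_stat xi_eta xi_f eta_g minimality a_sum Axi_def c_op C_def Ahat_opt.
have error' := error_operators xi_stat eta_stat xi_eta xi_f eta_g minimality a_sum Axi_def c_op C_def Ahat_opt.
split.
- exact: (spectral_characteristicP xi_stat eta_stat xi_eta xi_f eta_g xi_Z eta_Z minimality
    a_sum Axi_def c_op C_def Ahat_opt).
- exact: (spectral_characteristic_unique xi_stat eta_stat xi_eta xi_f eta_g xi_Z eta_Z minimality
    a_sum Axi_def c_op C_def Ahat_opt).
- rewrite DeltaE error mulrDr EFinD !EFinM; congr (_ * _ + _ * _)%E.
    rewrite -(n2E measurable_circ (L2B measurable_circ wf LfA Lfh)).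
    by apply: eq_integral => x; rewrite inE => Dx; rewrite (error_density_l A C wf wg Dx).
  rewrite -(n2E measurable_circ Lgh).
  by apply: eq_integral => x; rewrite inE => Dx; rewrite (error_density_r A C wf wg Dx).
split; first by rewrite DeltaE.
rewrite DeltaE error' rmorphD /=; congr (_ + _).
  by rewrite (ell2_inner_inverse (weightV ww) iv C_def c_op).
by rewrite (ell2_inner_toeplitz wq iq a_sum).
Qed.
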